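(* Let $\{\mathcal M_n\}_{n\in\mathbb N}$ be a family of sets satisfying properties (P1)–(P5) and let $\rho\in\mathcal D(\mathcal H)$. (Direct part) For every $\epsilon>0$ there exists a sequence of two-outcome POVMs $\{A_n,\mathbb 1-A_n\}_{n\in\mathbb N}$ ($0\le A_n\le \mathbb 1$ on $\mathcal H^{\otimes n}$) such that $\lim_{n\to\infty}\mathrm{tr}\big((\mathbb 1-A_n)\rho^{\otimes n}\big)=0$ and, for every $n\in\mathbb N$ and every $\omega_n\in\mathcal M_n$, $$-\frac{\log\mathrm{tr}(A_n\omega_n)}{n}+\epsilon\ \ge\ E^{\infty}_{\mathcal M}(\rho).$$ (Strong converse) If a real number $\epsilon>0$ and a sequence of POVMs $\{A_n,\mathbb 1-A_n\}_{n\in\mathbb N}$ satisfy, for every $n\in\mathbb N$ and every $\omega_n\in\mathcal M_n$, $$-\frac{\log\mathrm{tr}(A_n\omega_n)}{n}-\epsilon\ \ge\ E^{\infty}_{\mathcal M}(\rho),$$ then $\lim_{n\to\infty}\mathrm{tr}\big((\mathbb 1-A_n)\rho^{\otimes n}\big)=1$.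
   Context: $\mathcal H$ is a finite-dimensional Hilbert space, $\mathcal D(\mathcal K)$ denotes the set of density operators on $\mathcal K$, and $\log$ is base 2. For $\pi\in S_n$, $P_\pi$ is the unitary on $\mathcal H^{\otimes n}$ permuting the tensor factors. A family $\{\mathcal M_n\}_{n\in\mathbb N}$ with $\mathcal M_n\subseteq\mathcal D(\mathcal H^{\otimes n})$ satisfies properties (P1)–(P5) if: (P1) each $\mathcal M_n$ is convex and closed; (P2) there is a full-rank $\sigma\in\mathcal D(\mathcal H)$ with $\sigma^{\otimes n}\in\mathcal M_n$ for every $n$; (P3) if $\rho\in\mathcal M_{n+1}$ then $\mathrm{tr}_k(\rho)\in\mathcal M_n$ for every $k\in\{1,\dots,n+1\}$, where $\mathrm{tr}_k$ is the partial trace over the $k$-th tensor factor; (P4) if $\rho\in\mathcal M_n$ and $\nu\in\mathcal M_m$ then $\rho\otimes\nu\in\mathcal M_{n+m}$; (P5) if $\rho\in\mathcal M_n$ then $P_\pi\rho P_\pi^{*}\in\mathcal M_n$ for every $\pi\in S_n$. The quantum relative entropy is $S(\rho\|\sigma)=\mathrm{tr}(\rho(\log\rho-\log\sigma))$ if $\mathrm{supp}\rho\subseteq\mathrm{supp}\sigma$ and $+\infty$ otherwise. Define $E_{\mathcal M_n}(\rho)=\inf_{\sigma\in\mathcal M_n}S(\rho\|\sigma)$ and $E^\infty_{\mathcal M}(\rho)=\lim_{n\to\infty}\frac1n E_{\mathcal M_n}(\rho^{\otimes n})$ (this limit exists under (P4) by subadditivity). *)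

(* Defs.v *)
From Stdlib Require Import Reals List Bool Arith ClassicalEpsilon.
Import ListNotations.
Open Scope R_scope.

Record C := mkC { Cre : R; Cim : R }.
Definition C0 : C := mkC 0 0.
Definition C1 : C := mkC 1 0.
Definition RtoC (x : R) : C := mkC x 0.
Definition Cadd (a b : C) : C := mkC (Cre a + Cre b) (Cim a + Cim b).
Definition Cneg (a : C) : C := mkC (- Cre a) (- Cim a).
Definition Cmul (a b : C) : C :=
  mkC (Cre a * Cre b - Cim a * Cim b) (Cre a * Cim b + Cim a * Cre b).
Definition Cconj (a : C) : C := mkC (Cre a) (- Cim a).
Definition Cnorm2 (a : C) : R := Cre a * Cre a + Cim a * Cim a.

Fixpoint sumC {A : Type} (l : list A) (f : A -> C) : C :=
  match l with nil => C0 | x :: l' => Cadd (f x) (sumC l' f) end.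
Fixpoint sumR {A : Type} (l : list A) (f : A -> R) : R :=
  match l with nil => 0 | x :: l' => f x + sumR l' f end.

(* ---------- H = C^d ; basis of H^{(x)n} indexed by words of length n ---------- *)
Definition word := list nat.

(* all words of length n over the alphabet {0,..,d-1}; the i-th letter is
   the index in the i-th tensor factor *)
Fixpoint words (d n : nat) : list word :=
  match n with
  | O => [nil]
  | S n' => flat_map (fun a => map (fun w => a :: w) (words d n')) (seq 0 d)
  end.

Definition validb (d n : nat) (w : word) : bool :=
  Nat.eqb (length w) n && forallb (fun a => Nat.ltb a d) w.
Definition valid (d n : nat) (w : word) : Prop := validb d n w = true.

(* operators / vectors on H^{(x)n} : matrices indexed by words;
   entries outside valid indices are required to vanish (see op_on) *)
Definition Op := word -> word -> C.
Definition Vec := word -> C.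

Definition op_on (d n : nat) (A : Op) : Prop :=
  forall i j, ~ (valid d n i /\ valid d n j) -> A i j = C0.

Definition idop (d n : nat) : Op := fun i j =>
  if validb d n i then (if list_eq_dec Nat.eq_dec i j then C1 else C0) else C0.
Definition addop (A B : Op) : Op := fun i j => Cadd (A i j) (B i j).
Definition subop (A B : Op) : Op := fun i j => Cadd (A i j) (Cneg (B i j)).
Definition scaleop (t : R) (A : Op) : Op := fun i j => Cmul (RtoC t) (A i j).
Definition mulop (d n : nat) (A B : Op) : Op :=
  fun i j => sumC (words d n) (fun k => Cmul (A i k) (B k j)).
Definition tr (d n : nat) (A : Op) : C := sumC (words d n) (fun i => A i i).

Definition inner (d n : nat) (u v : Vec) : C :=
  sumC (words d n) (fun i => Cmul (Cconj (u i)) (v i)).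
Definition apply (d n : nat) (A : Op) (v : Vec) : Vec :=
  fun i => sumC (words d n) (fun j => Cmul (A i j) (v j)).

Definition psd (d n : nat) (A : Op) : Prop :=
  op_on d n A /\
  (forall i j, A j i = Cconj (A i j)) /\
  (forall v : Vec, 0 <= Cre (inner d n v (apply d n A v))).

Definition density (d n : nat) (A : Op) : Prop := psd d n A /\ tr d n A = C1.

Definition full_rank (d n : nat) (A : Op) : Prop :=
  forall v : Vec, (forall i, valid d n i -> apply d n A v i = C0) ->
    forall i, valid d n i -> v i = C0.

Definition povm_elem (d n : nat) (A : Op) : Prop :=
  psd d n A /\ psd d n (subop (idop d n) A).

Definition tens (n : nat) (A B : Op) : Op := fun i j =>
  Cmul (A (firstn n i) (firstn n j)) (B (skipn n i) (skipn n j)).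

Fixpoint tpow (n : nat) (A : Op) : Op :=
  match n with
  | O => fun i j => match i, j with nil, nil => C1 | _, _ => C0 end
  | S n' => tens 1 A (tpow n' A)
  end.

Definition insert_at (k a : nat) (w : word) : word := firstn k w ++ a :: skipn k w.

Definition ptr (d k : nat) (A : Op) : Op := fun i j =>
  sumC (seq 0 d) (fun a => A (insert_at k a i) (insert_at k a j)).

Definition is_perm (n : nat) (p : nat -> nat) : Prop :=
  (forall k, (k < n)%nat -> (p k < n)%nat) /\
  (forall k l, (k < n)%nat -> (l < n)%nat -> p k = p l -> k = l).

Definition permw (n : nat) (p : nat -> nat) (w : word) : word :=
  map (fun k => nth (p k) w 0%nat) (seq 0 n).

Definition permop (d n : nat) (p : nat -> nat) (A : Op) : Op := fun i j =>
  if validb d n i && validb d n j then A (permw n p i) (permw n p j) else C0.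

Definition log2 (x : R) : R := ln x / ln 2.

Definition spec (d n : nat) (A : Op) (lam : word -> R) (e : word -> Vec) : Prop :=
  (forall j k, valid d n j -> valid d n k ->
     inner d n (e j) (e k) = if list_eq_dec Nat.eq_dec j k then C1 else C0) /\
  (forall i i', valid d n i -> valid d n i' ->
     A i i' = sumC (words d n)
                (fun j => Cmul (RtoC (lam j)) (Cmul (e j i) (Cconj (e j i'))))).

Definition xlog2x (x : R) : R := if Rlt_dec 0 x then x * log2 x else 0.
Definition log2pos (x : R) : R := if Rlt_dec 0 x then log2 x else 0.

(* S(rho||sigma) = v, with v = None meaning +infinity.
   supp rho <= supp sigma  iff  no eigenvector of rho with positive eigenvalue
   overlaps an eigenvector of sigma with eigenvalue 0. *)
Definition relent_is (d n : nat) (rho sigma : Op) (v : option R) : Prop :=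
  exists lam e mu f,
    spec d n rho lam e /\ spec d n sigma mu f /\
    let supp_ok := forall j k, valid d n j -> valid d n k ->
                     0 < lam j -> mu k = 0 -> inner d n (e j) (f k) = C0 in
    ((supp_ok /\
      v = Some (sumR (words d n) (fun j => xlog2x (lam j))
                - sumR (words d n) (fun j => sumR (words d n) (fun k =>
                      lam j * Cnorm2 (inner d n (e j) (f k)) * log2pos (mu k)))))
     \/ (~ supp_ok /\ v = None)).

Definition is_inf (E : R -> Prop) (x : R) : Prop :=
  (forall y, E y -> x <= y) /\ (forall z, (forall y, E y -> z <= y) -> z <= x).

Definition Family := nat -> Op -> Prop.

Definition E_M (M : Family) (d n : nat) (rho : Op) : R :=
  epsilon (inhabits 0)
    (is_inf (fun x => exists sigma, M n sigma /\ relent_is d n rho sigma (Some x))).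

Definition E_inf (M : Family) (d : nat) (rho : Op) : R :=
  epsilon (inhabits 0)
    (fun l => Un_cv (fun n => E_M M d n (tpow n rho) / INR n) l).

Definition op_cv (A : nat -> Op) (B : Op) : Prop :=
  forall i j, Un_cv (fun k => Cre (A k i j)) (Cre (B i j)) /\
              Un_cv (fun k => Cim (A k i j)) (Cim (B i j)).

Definition P_props (d : nat) (M : Family) : Prop :=
  (forall n A, M n A -> density d n A) /\
  (forall n A B t, M n A -> M n B -> 0 <= t <= 1 ->
     M n (addop (scaleop t A) (scaleop (1 - t) B))) /\
  (forall n (A : nat -> Op) B, (forall k, M n (A k)) -> op_cv A B -> M n B) /\
  (exists sigma, density d 1 sigma /\ full_rank d 1 sigma /\
     forall n, M n (tpow n sigma)) /\
  (forall n A, M (S n) A -> forall k, (k < S n)%nat -> M n (ptr d k A)) /\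
  (forall n m A B, M n A -> M m B -> M (n + m)%nat (tens n A B)) /\
  (forall n A p, M n A -> is_perm n p -> M n (permop d n p A)).

(* Main.v *)
(** Write [L] for the regularised relative entropy, in nats.

    Strong converse: for a test [T] and eigenbases [e], [f] of the states [r], [s]
    with eigenvalues [lam], [mu], inserting [1 = (1 - T) + T] into [<e_j|f_k>] bounds
    [sum_jk min (lam_j, c mu_k) |<e_j|f_k>|^2] by [(1 + t) tr r(1-T) + (1 + 1/t) c tr sT]
    for every [t > 0].  The left-hand side tends to 1 along tensor powers by a Chernoff
    bound for the log-likelihood ratio under the Nussbaum-Szkola distribution
    [lam_j |<e_j|f_k>|^2], as soon as [log c] exceeds the relative entropy.

    Direct part: suppose that for some [eta > 0] no test has type-I error at most [eta]
    and type-II error at most [exp (- n (L - eps))] on all of [M_n].  By minimax a single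
    [w] in [M_n] defeats all tests.  Mix it with a full-rank product state and with a
    near-optimal block power, and pinch [r^n] along the O(n) blocks on which the logarithm
    of the mixture [s] varies by at most 1.  Under the pinched state the log-likelihood
    ratio against [s] is O(n) (full rank), exceeds [n (L + delta)] with vanishing
    probability (strong converse for the block power), and is below [n (L - eps/2)] with
    probability at least [eta] (choice of [w]).  So the relative entropy of [r^n] to [s]
    is smaller than [n L], a contradiction. *)

(* Since [r] and [s] do not commute, their log-likelihood ratio has no joint distribution, and the
   two parts repair this differently. The strong converse keeps both product eigenbases: the
   classical Nussbaum-Szkola pair has the right relative entropy and a multiplicative moment
   generating function. In the direct part [s] has no product structure and the ratio must be read
   off from genuine tests; pinching supplies one orthonormal basis whose threshold sets are
   projections. As [s] may have exponentially many eigenvalues, its eigenspaces are merged by the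
   integer part of minus the logarithm. This costs 1 for the rounding and the logarithm of the
   number of blocks, both o(n).

   The contradiction needs an upper bound on the mean of the ratio, hence control of its upper tail.
   A small probability alone is not enough there: the bound O(n) on the ratio is what keeps the
   contribution of the tail a small fraction of [n]. On the other side, Fekete's lemma makes [n L] a
   lower bound for the relative entropy to every state of [M_n] at each positive [n], not only in
   the limit. *)
From Stdlib Require Import Reals List Lra Lia Arith ZArith Bool FunctionalExtensionality ClassicalEpsilon.
Require Import Defs.
Open Scope R_scope.

(** * The spectral theorem *)

Module MatrixBridge.
From mathcomp Require Import all_boot all_order all_algebra Rstruct.
From mathcomp.real_closed Require Import complex.
Import Order.TTheory GRing.Theory Num.Theory.
Local Open Scope ring_scope.
Local Open Scope sesquilinear_scope.

Local Notation K := (complex Rdefinitions.R).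
Definition toK (a : Defs.C) : K := Complex (Cre a) (Cim a).
Definition ofK (z : K) : Defs.C := let: Complex a b := z in mkC a b.

Lemma toKK a : ofK (toK a) = a. Proof. by case: a. Qed.
Lemma toK_inj a b : toK a = toK b -> a = b.
Proof. by move=> h; rewrite -(toKK a) h toKK. Qed.
Lemma ofKK z : toK (ofK z) = z. Proof. by case: z. Qed.
Lemma toK_mul a b : toK (Cmul a b) = toK a * toK b. Proof. by []. Qed.
Lemma toK_conj a : toK (Cconj a) = (toK a)^*%C. Proof. by []. Qed.
Lemma toK_if (b : bool) : toK (if b then Defs.C1 else Defs.C0) = b%:R.
Proof. by case: b. Qed.
Lemma conjK (z : K) : Num.conj z = z^*%C.
Proof. by []. Qed.

Lemma toK_sum N (f : nat -> Defs.C) :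
  toK (sumC (List.seq 0 N) f) = \sum_(i < N) toK (f i).
Proof.
rewrite -(big_mkord xpredT (fun i => toK (f i))) /index_iota subn0.
elim: N 0%N => [|N IH] s /=; first by rewrite big_nil.
by rewrite big_cons -IH.
Qed.

(** Applied with [G] the matrix whose columns are an orthonormal family and [F] its adjoint:
    orthonormality is [F G = 1], and swapping the factors of square matrices gives the completeness
    relation [onb_complete]. *)
Lemma left_inverse_right_inverse N (F G : nat -> nat -> Defs.C) :
  (forall i j, (i < N)%coq_nat -> (j < N)%coq_nat ->
     sumC (List.seq 0 N) (fun k => Cmul (F i k) (G k j)) =
     if Nat.eqb i j then Defs.C1 else Defs.C0) ->
  forall i j, (i < N)%coq_nat -> (j < N)%coq_nat ->
     sumC (List.seq 0 N) (fun k => Cmul (G i k) (F k j)) =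
     if Nat.eqb i j then Defs.C1 else Defs.C0.
Proof.
move=> h i j /ssrnat.ltP hi /ssrnat.ltP hj.
pose A : 'M[K]_N := \matrix_(i, j) toK (F i j).
pose B : 'M[K]_N := \matrix_(i, j) toK (G i j).
have AB : A *m B = 1%:M.
  apply/matrixP => a b; rewrite !mxE.
  have /(congr1 toK) := h a b (ssrnat.ltP (ltn_ord a)) (ssrnat.ltP (ltn_ord b)).
  rewrite toK_sum toK_if => e; rewrite -[(a == b)]/(Nat.eqb a b) -e.
  by apply: eq_bigr => k _; rewrite !mxE toK_mul.
move/mulmx1C/matrixP/(_ (Ordinal hi) (Ordinal hj)): AB.
rewrite !mxE => e; apply: toK_inj; rewrite toK_sum toK_if.
rewrite -[Nat.eqb i j]/(Ordinal hi == Ordinal hj) -e.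
by apply: eq_bigr => k _; rewrite !mxE toK_mul.
Qed.

(** A hermitian matrix is normal, so [B = P^-1 D P] with [P] unitary and [D] diagonal. The
    eigenvectors are the conjugated rows of [P], and since [D] is real its real part suffices. *)
Lemma hermitian_spectral N (A : nat -> nat -> Defs.C) :
  (forall i j, A j i = Cconj (A i j)) ->
  exists (lam : nat -> Rdefinitions.R) (e : nat -> nat -> Defs.C),
    (forall j k, (j < N)%coq_nat -> (k < N)%coq_nat ->
      sumC (List.seq 0 N) (fun i => Cmul (Cconj (e j i)) (e k i)) =
      if Nat.eqb j k then Defs.C1 else Defs.C0) /\
    (forall i i', (i < N)%coq_nat -> (i' < N)%coq_nat ->
      A i i' = sumC (List.seq 0 N)
        (fun j => Cmul (RtoC (lam j)) (Cmul (e j i) (Cconj (e j i'))))).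
Proof.
(* [inord] needs a nonempty index type, so dimension 0 is treated apart. *)
move=> hA; case: N => [|n].
  by exists (fun=> Rdefinitions.IZR 0), (fun _ _ => Defs.C0);
    split=> ? ? /ssrnat.ltP.
set N := n.+1.
pose B : 'M[K]_N := \matrix_(i, j) toK (A i j).
have hB : B \is hermsymmx.
  apply/is_hermitianmxP; rewrite expr0 scale1r.
  by apply/matrixP => i j; rewrite !mxE hA toK_conj conjK.
have U := spectral_unitarymx B.
have /orthomx_spectralP := hermitian_normalmx hB.
have := hermitian_spectral_diag_real hB.
move: U; set P := spectralmx B; set D := spectral_diag B => U Dr.
rewrite invmx_unitary // => E.
exists (fun j => Cre (ofK (D 0 (inord j)))),
       (fun j i => ofK (P (inord j) (inord i))^*%C); split.
- move=> j k /ssrnat.ltP hj /ssrnat.ltP hk; apply: toK_inj; rewrite toK_sum toK_if.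
  have /unitarymxP/matrixP/(_ (Ordinal hj) (Ordinal hk)) := U.
  rewrite !mxE => e; rewrite -[Nat.eqb j k]/(Ordinal hj == Ordinal hk) -e.
  apply: eq_bigr => i _; rewrite !mxE toK_mul toK_conj !ofKK conjK.
  have -> : inord j = Ordinal hj by apply: val_inj; rewrite /= inordK.
  have -> : inord k = Ordinal hk by apply: val_inj; rewrite /= inordK.
  by rewrite inord_val conjcK.
- move=> i i' /ssrnat.ltP hi /ssrnat.ltP hi'; apply: toK_inj; rewrite toK_sum.
  move/matrixP/(_ (Ordinal hi) (Ordinal hi')): E; rewrite mul_mx_diag !mxE /= => ->.
  apply: eq_bigr => j _; rewrite !mxE !toK_mul toK_conj !ofKK conjK.
  have -> : inord i = Ordinal hi by apply: val_inj; rewrite /= inordK.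
  have -> : inord i' = Ordinal hi' by apply: val_inj; rewrite /= inordK.
  rewrite inord_val conjcK mulrCA mulrA; congr (_ * _ * _).
  have /mxOverP/(_ 0 j)/CrealP := Dr; rewrite conjK.
  case: (D 0 j) => a b /= [] /eqP; rewrite eq_sym -addr_eq0 -mulr2n mulrn_eq0 /= => /eqP hb.
  by rewrite /toK /= hb.
Qed.
End MatrixBridge.

(** * Finite sums and words *)

Lemma C_eq a b : Cre a = Cre b -> Cim a = Cim b -> a = b.
Proof. destruct a, b; simpl; intros; subst; reflexivity. Qed.

Definition Csub (a b : C) : C := Cadd a (Cneg b).

Lemma C_ring : ring_theory C0 C1 Cadd Cmul Csub Cneg eq.
Proof. constructor; intros; apply C_eq; simpl; ring. Qed.
Add Ring C_ring : C_ring.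

Ltac ceq := apply C_eq; simpl; ring.

Lemma Cconj_add a b : Cconj (Cadd a b) = Cadd (Cconj a) (Cconj b).
Proof. ceq. Qed.
Lemma Cconj_mul a b : Cconj (Cmul a b) = Cmul (Cconj a) (Cconj b).
Proof. ceq. Qed.
Lemma Cnorm2_ge0 a : 0 <= Cnorm2 a.
Proof. unfold Cnorm2; nra. Qed.
Lemma Cnorm2_eq0 a : Cnorm2 a = 0 -> a = C0.
Proof. unfold Cnorm2; intros; apply C_eq; simpl; nra. Qed.
Lemma Cnorm2_conj a : Cnorm2 (Cconj a) = Cnorm2 a.
Proof. unfold Cnorm2; simpl; ring. Qed.
Lemma Cnorm2_mul a b : Cnorm2 (Cmul a b) = Cnorm2 a * Cnorm2 b.
Proof. unfold Cnorm2; simpl; ring. Qed.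
Lemma Cmul_conj_re a : Cre (Cmul (Cconj a) a) = Cnorm2 a.
Proof. unfold Cnorm2; simpl; ring. Qed.
Section Sums.
Context {A : Type}.

Lemma sumC_ext (l : list A) f g : (forall x, In x l -> f x = g x) -> sumC l f = sumC l g.
Proof. induction l; simpl; intros H; auto. rewrite H, IHl; auto. Qed.
Lemma sumC_zero (l : list A) f : (forall x, In x l -> f x = C0) -> sumC l f = C0.
Proof. induction l; simpl; intros H; auto. rewrite H, IHl; auto. ring. Qed.
Lemma sumC_add (l : list A) f g : sumC l (fun x => Cadd (f x) (g x)) = Cadd (sumC l f) (sumC l g).
Proof. induction l; simpl; [ring|]. rewrite IHl; ring. Qed.
Lemma sumC_mul_l (l : list A) c f : sumC l (fun x => Cmul c (f x)) = Cmul c (sumC l f).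
Proof. induction l; simpl; [ring|]. rewrite IHl; ring. Qed.
Lemma sumC_mul_r (l : list A) c f : sumC l (fun x => Cmul (f x) c) = Cmul (sumC l f) c.
Proof. induction l; simpl; [ring|]. rewrite IHl; ring. Qed.
Lemma sumC_neg (l : list A) f : sumC l (fun x => Cneg (f x)) = Cneg (sumC l f).
Proof. induction l; simpl; [ceq|]. rewrite IHl; ring. Qed.
Lemma sumC_conj (l : list A) f : Cconj (sumC l f) = sumC l (fun x => Cconj (f x)).
Proof. induction l; simpl; [ceq|]. rewrite Cconj_add, IHl; reflexivity. Qed.
Lemma Cre_sumC (l : list A) f : Cre (sumC l f) = sumR l (fun x => Cre (f x)).
Proof. induction l; simpl; auto. rewrite IHl; auto. Qed.
Lemma sumR_ext (l : list A) f g : (forall x, In x l -> f x = g x) -> sumR l f = sumR l g.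
Proof. induction l; simpl; intros H; auto. rewrite H, IHl; auto. Qed.
Lemma sumR_zero (l : list A) f : (forall x, In x l -> f x = 0) -> sumR l f = 0.
Proof. induction l; simpl; intros H; auto. rewrite H, IHl; auto. ring. Qed.
Lemma sumR_add (l : list A) f g : sumR l (fun x => f x + g x) = sumR l f + sumR l g.
Proof. induction l; simpl; [ring|]. rewrite IHl; ring. Qed.
Lemma sumR_sub (l : list A) f g : sumR l (fun x => f x - g x) = sumR l f - sumR l g.
Proof. induction l; simpl; [ring|]. rewrite IHl; ring. Qed.
Lemma sumR_mul_l (l : list A) c f : sumR l (fun x => c * f x) = c * sumR l f.
Proof. induction l; simpl; [ring|]. rewrite IHl; ring. Qed.
Lemma sumR_mul_r (l : list A) c f : sumR l (fun x => f x * c) = sumR l f * c.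
Proof. induction l; simpl; [ring|]. rewrite IHl; ring. Qed.
Lemma sumR_le (l : list A) f g : (forall x, In x l -> f x <= g x) -> sumR l f <= sumR l g.
Proof.
  induction l; simpl; intros H; [lra|].
  assert (f a <= g a) by auto. assert (sumR l f <= sumR l g) by auto. lra.
Qed.
Lemma sumR_ge0 (l : list A) f : (forall x, In x l -> 0 <= f x) -> 0 <= sumR l f.
Proof.
  intros H. rewrite <- (sumR_zero l (fun _ => 0)); auto. apply sumR_le; auto.
Qed.
Lemma sumR_term_le (l : list A) f x : (forall x, In x l -> 0 <= f x) -> In x l -> f x <= sumR l f.
Proof.
  induction l; simpl; intros H []; subst.
  - assert (0 <= sumR l f) by (apply sumR_ge0; auto). lra.
  - assert (0 <= f a) by auto. assert (f x <= sumR l f) by auto. lra.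
Qed.
Lemma sumR_eq0 (l : list A) f x : (forall x, In x l -> 0 <= f x) -> sumR l f = 0 -> In x l -> f x = 0.
Proof.
  intros H H0 Hx. assert (f x <= sumR l f) by (apply sumR_term_le; auto).
  assert (0 <= f x) by auto. lra.
Qed.
End Sums.

Lemma sumC_map {A B : Type} (l : list A) (h : A -> B) f : sumC (map h l) f = sumC l (fun x => f (h x)).
Proof. induction l; simpl; auto. rewrite IHl; auto. Qed.
Lemma sumC_flat_map {A B : Type} (l : list A) (h : A -> list B) f :
  sumC (flat_map h l) f = sumC l (fun x => sumC (h x) f).
Proof.
  induction l; simpl; auto. rewrite <- IHl. clear IHl.
  induction (h a); simpl; [ring|]. rewrite IHl0; ring.
Qed.
Lemma sumC_swap {A B : Type} (l : list A) (l' : list B) f :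
  sumC l (fun x => sumC l' (fun y => f x y)) = sumC l' (fun y => sumC l (fun x => f x y)).
Proof.
  induction l; simpl. symmetry; apply sumC_zero; auto.
  rewrite IHl, <- sumC_add; auto.
Qed.
Lemma sumR_map {A B : Type} (l : list A) (h : A -> B) f : sumR (map h l) f = sumR l (fun x => f (h x)).
Proof. induction l; simpl; auto. rewrite IHl; auto. Qed.
Lemma sumR_flat_map {A B : Type} (l : list A) (h : A -> list B) f :
  sumR (flat_map h l) f = sumR l (fun x => sumR (h x) f).
Proof.
  induction l; simpl; auto. rewrite <- IHl. clear IHl.
  induction (h a); simpl; [ring|]. rewrite IHl0; ring.
Qed.
Lemma sumR_swap {A B : Type} (l : list A) (l' : list B) f :
  sumR l (fun x => sumR l' (fun y => f x y)) = sumR l' (fun y => sumR l (fun x => f x y)).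
Proof.
  induction l; simpl. symmetry; apply sumR_zero; auto.
  rewrite IHl, <- sumR_add; auto.
Qed.
Lemma sumC_nth {A : Type} (l : list A) (x0 : A) f :
  sumC l f = sumC (seq 0 (length l)) (fun i => f (nth i l x0)).
Proof.
  induction l; simpl; auto. rewrite IHl, <- seq_shift, sumC_map. reflexivity.
Qed.

Definition eqw (j k : word) : {j = k} + {j <> k} := list_eq_dec Nat.eq_dec j k.

Lemma sumC_delta (l : list word) (j : word) f : NoDup l -> In j l ->
  sumC l (fun k => Cmul (if eqw j k then C1 else C0) (f k)) = f j.
Proof.
  induction 1 as [|a l Ha Hl IH]; simpl; [tauto|].
  intros [->|Hj].
  - destruct (eqw j j); [|congruence]. rewrite (sumC_zero l); [ring|].
    intros x Hx. destruct (eqw j x); [subst; tauto | ring].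
  - rewrite IH by auto. destruct (eqw j a); [subst; tauto | ring].
Qed.

Lemma validE d n w : valid d n w <-> length w = n /\ (forall a, In a w -> (a < d)%nat).
Proof.
  unfold valid, validb. rewrite andb_true_iff, Nat.eqb_eq, forallb_forall.
  split; intros [H1 H2]; split; auto; intros a Ha; apply Nat.ltb_lt; auto.
Qed.

Lemma valid_dec d n w : {valid d n w} + {~ valid d n w}.
Proof. unfold valid. destruct (validb d n w); [left|right]; auto; discriminate. Qed.

Lemma words_valid d n w : In w (words d n) <-> valid d n w.
Proof.
  rewrite validE. revert w; induction n as [|n IH]; simpl; intros w.
  - split.
    + intros [<-|[]]; split; simpl; auto; tauto.
    + intros [H _]; destruct w; [auto|discriminate].
  - rewrite in_flat_map. split.
    + intros (a & Ha & Hw). apply in_map_iff in Hw. destruct Hw as (w' & <- & Hw').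
      apply IH in Hw'. apply in_seq in Ha. simpl. destruct Hw' as [H1 H2].
      split; [lia|]. intros b [<-|Hb]; [lia|auto].
    + intros [H1 H2]. destruct w as [|a w]; [discriminate|]. simpl in *.
      exists a. split; [apply in_seq; specialize (H2 a (or_introl eq_refl)); lia|].
      apply in_map, IH. split; [lia|auto].
Qed.

Lemma words_NoDup d n : NoDup (words d n).
Proof.
  induction n as [|n IH]; simpl; [repeat constructor; auto|].
  assert (H : forall l, NoDup l -> NoDup (flat_map (fun a => map (fun w => a :: w) (words d n)) l)).
  { induction 1 as [|a l Ha Hl IHl]; simpl; [constructor|].
    apply NoDup_app; auto.
    - apply NoDup_map_NoDup_ForallPairs; auto. intros x y _ _ E; congruence.
    - intros w Hw Hw'. apply in_map_iff in Hw. destruct Hw as (u & <- & _).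
      apply in_flat_map in Hw'. destruct Hw' as (b & Hb & Hw').
      apply in_map_iff in Hw'. destruct Hw' as (v & E & _). congruence. }
  apply H, seq_NoDup.
Qed.

Lemma sumC_words_add d n m f :
  sumC (words d (n + m)) f =
  sumC (words d n) (fun u => sumC (words d m) (fun v => f (u ++ v))).
Proof.
  revert f; induction n as [|n IH]; intros f; simpl.
  - change (fun v => f v) with f. ring.
  - rewrite !sumC_flat_map. apply sumC_ext; intros a _. rewrite !sumC_map. apply IH.
Qed.
Lemma sumR_words_add d n m f :
  sumR (words d (n + m)) f =
  sumR (words d n) (fun u => sumR (words d m) (fun v => f (u ++ v))).
Proof.
  revert f; induction n as [|n IH]; intros f; simpl.
  - change (fun v => f v) with f. ring.
  - rewrite !sumR_flat_map. apply sumR_ext; intros a _. rewrite !sumR_map. apply IH.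
Qed.

(** * Orthonormal bases indexed by words *)

Definition onb (d n : nat) (e : word -> Vec) : Prop :=
  forall j k, valid d n j -> valid d n k ->
    inner d n (e j) (e k) = if eqw j k then C1 else C0.

(** This numbering of [words d n] carries the matrix facts above, stated for indices below [N], over
    to operators indexed by words. *)
Fixpoint index_of (w : word) (l : list word) : nat :=
  match l with
  | nil => 0
  | x :: l' => if eqw w x then 0%nat else S (index_of w l')
  end.
Lemma index_of_lt w l : In w l -> (index_of w l < length l)%nat.
Proof.
  induction l as [|x l IH]; simpl; [tauto|]. intros H. destruct (eqw w x); [lia|].
  destruct H as [H|H]; [congruence|]. specialize (IH H); lia.
Qed.
Lemma nth_index_of w l : In w l -> nth (index_of w l) l nil = w.
Proof.
  induction l as [|x l IH]; simpl; [tauto|]. intros H. destruct (eqw w x); [auto|].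
  destruct H as [H|H]; [congruence|]. auto.
Qed.
Lemma index_of_nth i l : NoDup l -> (i < length l)%nat -> index_of (nth i l nil) l = i.
Proof.
  intros Hl; revert i; induction Hl as [|x l Hx Hl IH]; simpl; intros i Hi; [lia|].
  destruct i as [|i]; [destruct (eqw x x); congruence|].
  destruct (eqw (nth i l nil) x) as [E|E].
  - exfalso; apply Hx. rewrite <- E. apply nth_In; lia.
  - rewrite IH; lia.
Qed.
Lemma index_of_inj w w' l : In w l -> In w' l -> index_of w l = index_of w' l -> w = w'.
Proof. intros H H' E. rewrite <- (nth_index_of w l), <- (nth_index_of w' l), E; auto. Qed.

Lemma eqb_index w w' l {T} (a b : T) : In w l -> In w' l ->
  (if Nat.eqb (index_of w l) (index_of w' l) then a else b) = if eqw w w' then a else b.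
Proof.
  intros H H'. destruct (Nat.eqb_spec (index_of w l) (index_of w' l)) as [E|E];
  destruct (eqw w w'); auto; [|congruence]. exfalso; eauto using index_of_inj.
Qed.

Lemma onb_complete d n e i i' : onb d n e -> valid d n i -> valid d n i' ->
  sumC (words d n) (fun j => Cmul (e j i) (Cconj (e j i'))) = if eqw i i' then C1 else C0.
Proof.
  intros He Hi Hi'. set (l := words d n). set (x := fun p => nth p l nil).
  apply words_valid in Hi, Hi'.
  assert (Hx : forall p, (p < length l)%nat -> valid d n (x p)).
  { intros p Hp. apply words_valid, nth_In, Hp. }
  pose proof (MatrixBridge.left_inverse_right_inverse (length l)
    (fun p k => Cconj (e (x p) (x k))) (fun k q => e (x q) (x k))) as H.
  cbv beta in H.
  rewrite <- (eqb_index i i' l), <- H; auto using index_of_lt.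
  - rewrite (sumC_nth (A:=word) l nil). apply sumC_ext; intros p Hp.
    unfold x. rewrite !nth_index_of by auto. reflexivity.
  - intros p q Hp Hq. specialize (He _ _ (Hx p Hp) (Hx q Hq)).
    unfold inner in He. rewrite (sumC_nth (A:=word) _ nil) in He. fold l in He.
    fold x in He. change (fun i0 : nat => Cmul (Cconj (e (x p) (nth i0 l nil))) (e (x q) (nth i0 l nil)))
      with (fun i0 : nat => Cmul (Cconj (e (x p) (x i0))) (e (x q) (x i0))) in He.
    rewrite He, <- (eqb_index (x p) (x q) l); try apply words_valid; auto.
    unfold x. rewrite !index_of_nth; auto; apply words_NoDup.
Qed.

Lemma spectral_theorem d n (A : Op) : (forall i j, A j i = Cconj (A i j)) ->
  exists lam e, spec d n A lam e.
Proof.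
  intros HA. set (l := words d n). set (x := fun p => nth p l nil).
  destruct (MatrixBridge.hermitian_spectral (length l) (fun p q => A (x p) (x q)))
    as (lam & e & He & HAe); [auto|].
  set (ix := fun w => index_of w l).
  assert (Hix : forall w, valid d n w -> (ix w < length l)%nat).
  { intros w Hw. apply index_of_lt, words_valid, Hw. }
  exists (fun w => lam (ix w)), (fun w i => e (ix w) (ix i)). split.
  - intros j k Hj Hk. fold (eqw j k).
    rewrite <- (eqb_index j k l); try apply words_valid; auto.
    fold (ix j) (ix k). rewrite <- He; auto. unfold inner. rewrite (sumC_nth (A:=word) _ nil). fold l.
    apply sumC_ext; intros p Hp. apply in_seq in Hp.
    assert (E : ix (nth p l nil) = p) by (apply index_of_nth; [apply words_NoDup|apply Hp]).
    rewrite E; reflexivity.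
  - intros i i' Hi Hi'. specialize (HAe _ _ (Hix _ Hi) (Hix _ Hi')).
    unfold x, ix in HAe. rewrite !nth_index_of in HAe by (apply words_valid; auto).
    rewrite HAe. rewrite (sumC_nth (A:=word) (words d n) nil). fold l.
    apply sumC_ext; intros p Hp. apply in_seq in Hp.
    assert (E : ix (nth p l nil) = p) by (apply index_of_nth; [apply words_NoDup|apply Hp]).
    unfold ix in *. rewrite E; reflexivity.
Qed.

(** * Quadratic forms, traces and tests *)

Section Hilbert.
Context (d n : nat).
Notation W := (words d n).
Notation valid := (valid d n).
Notation inner := (inner d n).
Notation apply := (apply d n).

Definition nrm2 (v : Vec) : R := Cre (inner v v).
Definition Qf (A : Op) (v : Vec) : R := Cre (inner v (apply A v)).
Definition hermitian (A : Op) : Prop := forall i j, A j i = Cconj (A i j).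

Lemma inner_ext u u' v v' : (forall i, valid i -> u i = u' i) ->
  (forall i, valid i -> v i = v' i) -> inner u v = inner u' v'.
Proof.
  intros H H'. apply sumC_ext; intros i Hi. apply words_valid in Hi. rewrite H, H'; auto.
Qed.
Lemma inner_sym u v : Cconj (inner u v) = inner v u.
Proof. unfold Defs.inner. rewrite sumC_conj. apply sumC_ext; intros. ceq. Qed.
Lemma inner_add_r u v w : inner u (fun i => Cadd (v i) (w i)) = Cadd (inner u v) (inner u w).
Proof. unfold Defs.inner. rewrite <- sumC_add. apply sumC_ext; intros; ring. Qed.
Lemma inner_mul_r u c v : inner u (fun i => Cmul c (v i)) = Cmul c (inner u v).
Proof. unfold Defs.inner. rewrite <- sumC_mul_l. apply sumC_ext; intros; ring. Qed.
Lemma inner_sum_r {B} (l : list B) u v :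
  inner u (fun i => sumC l (fun k => v k i)) = sumC l (fun k => inner u (v k)).
Proof.
  unfold Defs.inner. rewrite <- sumC_swap. apply sumC_ext; intros. symmetry; apply sumC_mul_l.
Qed.
Lemma nrm2_sum v : nrm2 v = sumR W (fun i => Cnorm2 (v i)).
Proof.
  unfold nrm2, Defs.inner. rewrite Cre_sumC. apply sumR_ext; intros; apply Cmul_conj_re.
Qed.
Lemma nrm2_ge0 v : 0 <= nrm2 v.
Proof. rewrite nrm2_sum. apply sumR_ge0; intros; apply Cnorm2_ge0. Qed.
Lemma nrm2_eq0 v i : nrm2 v = 0 -> valid i -> v i = C0.
Proof.
  rewrite nrm2_sum. intros H Hi. apply Cnorm2_eq0.
  apply (sumR_eq0 W (fun i => Cnorm2 (v i))); auto; intros; try apply Cnorm2_ge0.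
  apply words_valid; auto.
Qed.
Lemma Cnorm2_inner_sym u v : Cnorm2 (inner u v) = Cnorm2 (inner v u).
Proof. rewrite <- inner_sym. apply Cnorm2_conj. Qed.

Lemma apply_sum A {B} (l : list B) v i :
  apply A (fun i => sumC l (fun k => v k i)) i = sumC l (fun k => apply A (v k) i).
Proof.
  unfold Defs.apply. rewrite <- sumC_swap. apply sumC_ext; intros. symmetry; apply sumC_mul_l.
Qed.
Lemma apply_mul A c v i : apply A (fun i => Cmul c (v i)) i = Cmul c (apply A v i).
Proof. unfold Defs.apply. rewrite <- sumC_mul_l. apply sumC_ext; intros; ring. Qed.

Lemma apply_adjoint A u v : hermitian A -> inner u (apply A v) = inner (apply A u) v.
Proof.
  intros HA. unfold Defs.inner, Defs.apply.
  erewrite sumC_ext by (intros; symmetry; apply sumC_mul_l). rewrite sumC_swap.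
  apply sumC_ext; intros j _. rewrite sumC_conj, <- sumC_mul_r. apply sumC_ext; intros i _.
  rewrite (HA j i), Cconj_mul. ring.
Qed.

Lemma onb_expand e u v : onb d n e ->
  inner u v = sumC W (fun k => Cmul (inner u (e k)) (inner (e k) v)).
Proof.
  intros He.
  transitivity (sumC W (fun i => sumC W (fun i' => Cmul (Cmul (Cconj (u i)) (v i'))
     (sumC W (fun k => Cmul (e k i) (Cconj (e k i'))))))).
  - apply sumC_ext; intros i Hi. apply words_valid in Hi.
    rewrite (sumC_ext _ _ (fun i' => Cmul (if eqw i i' then C1 else C0) (Cmul (Cconj (u i)) (v i')))).
    + rewrite sumC_delta; auto. apply words_NoDup. apply words_valid; auto.
    + intros i' Hi'. apply words_valid in Hi'. rewrite onb_complete by auto. ring.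
  - unfold Defs.inner.
    erewrite sumC_ext by (intros; apply sumC_ext; intros; symmetry; apply sumC_mul_l).
    erewrite sumC_ext by (intros; apply sumC_swap).
    rewrite sumC_swap. apply sumC_ext; intros k _.
    rewrite <- sumC_mul_r. apply sumC_ext; intros i _.
    rewrite <- sumC_mul_l. apply sumC_ext; intros i' _. ring.
Qed.

Lemma parseval e v : onb d n e -> nrm2 v = sumR W (fun k => Cnorm2 (inner (e k) v)).
Proof.
  intros He. unfold nrm2. rewrite (onb_expand e) by auto. rewrite Cre_sumC.
  apply sumR_ext; intros k _. rewrite <- (inner_sym (e k) v). apply Cmul_conj_re.
Qed.

Lemma onb_nrm2 e k : onb d n e -> valid k -> nrm2 (e k) = 1.
Proof.
  intros He Hk. unfold nrm2. rewrite He by auto. destruct (eqw k k); [reflexivity|congruence].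
Qed.

Lemma onb_mass e v : onb d n e -> nrm2 v = 1 -> sumR W (fun k => Cnorm2 (inner v (e k))) = 1.
Proof.
  intros He Hv. rewrite <- Hv, (parseval e) by auto.
  apply sumR_ext; intros; apply Cnorm2_inner_sym.
Qed.

Lemma spec_apply A lam e v i : spec d n A lam e -> valid i ->
  apply A v i = sumC W (fun j => Cmul (Cmul (RtoC (lam j)) (inner (e j) v)) (e j i)).
Proof.
  intros [He HA] Hi. unfold Defs.apply, Defs.inner.
  rewrite (sumC_ext _ _ (fun i' => sumC W (fun j =>
    Cmul (Cmul (RtoC (lam j)) (Cmul (e j i) (Cconj (e j i')))) (v i')))).
  - rewrite sumC_swap. apply sumC_ext; intros j _. rewrite <- sumC_mul_l, <- sumC_mul_r.
    apply sumC_ext; intros; ring.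
  - intros i' Hi'. apply words_valid in Hi'. rewrite HA by auto. symmetry; apply sumC_mul_r.
Qed.

Lemma spec_onb A lam e : spec d n A lam e -> onb d n e.
Proof. intros [H _]; exact H. Qed.

Lemma spec_inner A lam e u v : spec d n A lam e ->
  inner u (apply A v) = sumC W (fun j => Cmul (RtoC (lam j)) (Cmul (inner u (e j)) (inner (e j) v))).
Proof.
  intros H.
  rewrite (inner_ext u u _ (fun i => sumC W (fun j => Cmul (Cmul (RtoC (lam j)) (inner (e j) v)) (e j i))));
    auto using spec_apply.
  rewrite inner_sum_r. apply sumC_ext; intros j _. rewrite inner_mul_r. ring.
Qed.

Lemma spec_Qf A lam e v : spec d n A lam e ->
  Qf A v = sumR W (fun j => lam j * Cnorm2 (inner (e j) v)).
Proof.
  intros H. unfold Qf. rewrite (spec_inner A lam e) by auto. rewrite Cre_sumC.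
  apply sumR_ext; intros j _. rewrite <- (inner_sym (e j) v). unfold Cnorm2; simpl; ring.
Qed.

Lemma spec_eigen A lam e k : spec d n A lam e -> valid k ->
  forall i, valid i -> apply A (e k) i = Cmul (RtoC (lam k)) (e k i).
Proof.
  intros H Hk i Hi. rewrite (spec_apply A lam e) by auto.
  rewrite (sumC_ext _ _ (fun j => Cmul (if eqw k j then C1 else C0) (Cmul (RtoC (lam j)) (e j i)))).
  - apply (sumC_delta W k (fun j => Cmul (RtoC (lam j)) (e j i))); [apply words_NoDup|apply words_valid; auto].
  - intros j Hj. apply words_valid in Hj. rewrite (spec_onb _ _ _ H) by auto.
    destruct (eqw j k), (eqw k j); try congruence; ring.
Qed.

Lemma spec_Qf_eigen A lam e k : spec d n A lam e -> valid k -> Qf A (e k) = lam k.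
Proof.
  intros H Hk. unfold Qf.
  rewrite (inner_ext _ (e k) _ (fun i => Cmul (RtoC (lam k)) (e k i))); auto.
  - rewrite inner_mul_r, (spec_onb _ _ _ H) by auto. destruct (eqw k k); [simpl; ring|congruence].
  - apply spec_eigen with (1 := H); auto.
Qed.

Lemma Qf_onb_tr A e : onb d n e -> Cre (tr d n A) = sumR W (fun k => Qf A (e k)).
Proof.
  intros He. unfold Qf. rewrite <- Cre_sumC. f_equal. unfold tr, Defs.inner, Defs.apply.
  symmetry.
  erewrite sumC_ext by (intros; apply sumC_ext; intros; symmetry; apply sumC_mul_l).
  rewrite sumC_swap. apply sumC_ext; intros i Hi. apply words_valid in Hi.
  rewrite sumC_swap.
  rewrite (sumC_ext _ _ (fun j => Cmul (if eqw i j then C1 else C0) (A i j))).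
  - apply sumC_delta; [apply words_NoDup|apply words_valid; auto].
  - intros j Hj. apply words_valid in Hj.
    transitivity (Cmul (sumC W (fun k => Cmul (e k j) (Cconj (e k i)))) (A i j)).
    + rewrite <- sumC_mul_r. apply sumC_ext; intros; ring.
    + rewrite onb_complete by auto. destruct (eqw j i), (eqw i j); congruence.
Qed.

(** The list [l] is arbitrary and the vectors need not be orthonormal, so the formula serves both
    for spectral decompositions and for the projections [subset_test]. *)
Lemma tr_mul_sum A (l : list word) lam e B :
  (forall i i', valid i -> valid i' ->
     B i i' = sumC l (fun j => Cmul (RtoC (lam j)) (Cmul (e j i) (Cconj (e j i'))))) ->
  Cre (tr d n (mulop d n A B)) = sumR l (fun j => lam j * Qf A (e j)).
Proof.
  intros HB. unfold tr, mulop.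
  rewrite (sumC_ext _ _ (fun i => sumC l (fun j => Cmul (RtoC (lam j)) (Cmul (Cconj (e j i)) (apply A (e j) i))))).
  - rewrite sumC_swap, Cre_sumC. apply sumR_ext; intros j _. rewrite sumC_mul_l. unfold Qf, Defs.inner.
    simpl. ring.
  - intros i Hi. apply words_valid in Hi.
    rewrite (sumC_ext _ _ (fun k => sumC l (fun j => Cmul (RtoC (lam j)) (Cmul (Cconj (e j i)) (Cmul (A i k) (e j k)))))).
    + rewrite sumC_swap. apply sumC_ext; intros j _. rewrite !sumC_mul_l. reflexivity.
    + intros k Hk. apply words_valid in Hk. rewrite HB, <- sumC_mul_l by auto.
      apply sumC_ext; intros; ring.
Qed.

Lemma tr_mul_spec A B lam e : spec d n B lam e ->
  Cre (tr d n (mulop d n A B)) = sumR W (fun j => lam j * Qf A (e j)).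
Proof. intros [_ H]; apply tr_mul_sum; auto. Qed.

Lemma tr_mul_comm A B : tr d n (mulop d n A B) = tr d n (mulop d n B A).
Proof.
  unfold tr, mulop. rewrite sumC_swap. apply sumC_ext; intros; apply sumC_ext; intros; ring.
Qed.

Lemma Qf_add A B v : Qf (addop A B) v = Qf A v + Qf B v.
Proof.
  unfold Qf. change (Cre (inner v (apply A v)) + Cre (inner v (apply B v)))
    with (Cre (Cadd (inner v (apply A v)) (inner v (apply B v)))).
  rewrite <- inner_add_r. f_equal. apply inner_ext; auto. intros i _.
  unfold Defs.apply, addop. rewrite <- sumC_add. apply sumC_ext; intros; ring.
Qed.
Lemma Qf_scale t A v : Qf (scaleop t A) v = t * Qf A v.
Proof.
  unfold Qf. transitivity (Cre (Cmul (RtoC t) (inner v (apply A v)))); [|simpl; ring].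
  rewrite <- inner_mul_r. f_equal. apply inner_ext; auto. intros i _.
  unfold Defs.apply, scaleop. rewrite <- sumC_mul_l. apply sumC_ext; intros; ring.
Qed.
Lemma subop_add A B : subop A B = addop A (scaleop (-1) B).
Proof.
  extensionality i; extensionality j. unfold subop, addop, scaleop. ceq.
Qed.
Lemma Qf_sub A B v : Qf (subop A B) v = Qf A v - Qf B v.
Proof. rewrite subop_add, Qf_add, Qf_scale; ring. Qed.
Lemma apply_id v i : valid i -> apply (idop d n) v i = v i.
Proof.
  intros Hi. unfold Defs.apply.
  rewrite <- (sumC_delta W i v); [|apply words_NoDup|apply words_valid; auto].
  apply sumC_ext; intros j Hj. unfold idop. unfold Defs.valid in Hi. rewrite Hi. reflexivity.
Qed.
Lemma Qf_id v : Qf (idop d n) v = nrm2 v.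
Proof. unfold Qf, nrm2. f_equal. apply inner_ext; auto. apply apply_id. Qed.

Lemma psd_hermitian A : psd d n A -> hermitian A.
Proof. intros (_ & H & _); exact H. Qed.
Lemma psd_Qf A v : psd d n A -> 0 <= Qf A v.
Proof. intros (_ & _ & H); apply H. Qed.
Lemma psd_intro A : op_on d n A -> hermitian A -> (forall v, 0 <= Qf A v) -> psd d n A.
Proof. intros; repeat split; auto. Qed.

Lemma psd_spec_exists A : psd d n A -> exists lam e, spec d n A lam e.
Proof. intros H. apply spectral_theorem, psd_hermitian, H. Qed.
Lemma psd_eigen_ge0 A lam e k : psd d n A -> spec d n A lam e -> valid k -> 0 <= lam k.
Proof. intros H Hs Hk. rewrite <- (spec_Qf_eigen A lam e); auto using psd_Qf. Qed.
Lemma density_eigen_sum A lam e : density d n A -> spec d n A lam e -> sumR W lam = 1.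
Proof.
  intros [H Ht] Hs. transitivity (Cre (tr d n A)); [|rewrite Ht; reflexivity].
  rewrite (Qf_onb_tr A e) by (eapply spec_onb; eauto).
  apply sumR_ext; intros k Hk. symmetry; apply (spec_Qf_eigen A lam e); auto. apply words_valid; auto.
Qed.
Lemma density_eigen_le1 A lam e k : density d n A -> spec d n A lam e -> valid k -> lam k <= 1.
Proof.
  intros H Hs Hk. rewrite <- (density_eigen_sum A lam e) by auto.
  apply (sumR_term_le W lam); [|apply words_valid; auto].
  intros x Hx. apply words_valid in Hx. eapply psd_eigen_ge0; eauto. apply H.
Qed.
Lemma density_Qf_le A v : density d n A -> Qf A v <= nrm2 v.
Proof.
  intros H. destruct (psd_spec_exists A) as (lam & e & Hs); [apply H|].
  rewrite (spec_Qf A lam e), (parseval e) by (auto; eapply spec_onb; eauto).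
  apply sumR_le; intros k Hk. apply words_valid in Hk.
  pose proof (density_eigen_le1 _ _ _ _ H Hs Hk). pose proof (Cnorm2_ge0 (inner (e k) v)). nra.
Qed.
Lemma density_tr_Qf A e : density d n A -> onb d n e -> sumR W (fun k => Qf A (e k)) = 1.
Proof. intros [_ H] He. rewrite <- Qf_onb_tr, H; auto. Qed.

Lemma tr_psd_mul_ge0 A B : psd d n A -> psd d n B -> 0 <= Cre (tr d n (mulop d n A B)).
Proof.
  intros HA HB. destruct (psd_spec_exists B) as (lam & e & Hs); auto.
  rewrite (tr_mul_spec A B lam e) by auto. apply sumR_ge0; intros k Hk. apply words_valid in Hk.
  apply Rmult_le_pos; [eapply psd_eigen_ge0; eauto | apply psd_Qf; auto].
Qed.

Lemma mulop_addop_r T A B i j :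
  mulop d n T (addop A B) i j = Cadd (mulop d n T A i j) (mulop d n T B i j).
Proof. unfold mulop. rewrite <- sumC_add. apply sumC_ext; intros; unfold addop; ring. Qed.
Lemma tr_mul_addop T A B : Cre (tr d n (mulop d n T (addop A B))) =
  Cre (tr d n (mulop d n T A)) + Cre (tr d n (mulop d n T B)).
Proof.
  unfold tr. erewrite sumC_ext by (intros; apply mulop_addop_r). rewrite sumC_add. reflexivity.
Qed.
Lemma tr_mul_scaleop T t A : Cre (tr d n (mulop d n T (scaleop t A))) =
  t * Cre (tr d n (mulop d n T A)).
Proof.
  transitivity (Cre (Cmul (RtoC t) (tr d n (mulop d n T A)))); [|simpl; ring].
  unfold tr, mulop. rewrite <- sumC_mul_l. f_equal. apply sumC_ext; intros i _.
  rewrite <- sumC_mul_l. apply sumC_ext; intros j _. unfold scaleop; ring.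
Qed.
Lemma tr_complement_mul T A : density d n A ->
  Cre (tr d n (mulop d n (subop (idop d n) T) A)) = 1 - Cre (tr d n (mulop d n T A)).
Proof.
  intros H. destruct (psd_spec_exists A) as (lam & e & Hs); [apply H|].
  rewrite !(tr_mul_spec _ A lam e), <- (density_eigen_sum A lam e), <- sumR_sub by auto.
  apply sumR_ext; intros k Hk. apply words_valid in Hk.
  rewrite Qf_sub, Qf_id, (onb_nrm2 e k); auto. ring. eapply spec_onb; eauto.
Qed.

(* [T - T^2 = T (1 - T) T + (1 - T) T (1 - T)] is positive. *)
Lemma povm_square_le T v : povm_elem d n T -> nrm2 (apply T v) <= Qf T v.
Proof.
  intros [HT HT']. set (S := subop (idop d n) T). set (u := apply T v). set (w := apply S v).
  assert (Hw : forall i, valid i -> w i = Cadd (v i) (Cneg (u i))).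
  { intros i Hi. unfold w, S, u. rewrite <- (apply_id v i) at 1 by auto.
    unfold Defs.apply, subop. rewrite <- sumC_neg, <- sumC_add. apply sumC_ext; intros; ring. }
  assert (Hq : 0 <= Qf S u + Qf T w).
  { apply Rplus_le_le_0_compat; apply psd_Qf; auto. }
  assert (E1 : Qf S u = nrm2 u - Qf T u) by (unfold S; rewrite Qf_sub, Qf_id; auto).
  assert (Htw : forall i, valid i -> apply T w i = Cadd (u i) (Cneg (apply T u i))).
  { intros i Hi. unfold u at 1. unfold Defs.apply. rewrite <- sumC_neg, <- sumC_add.
    apply sumC_ext; intros j Hj. apply words_valid in Hj. rewrite Hw by auto. unfold u; ring. }
  assert (E2 : Qf T w = Qf T v - 2 * nrm2 u + Qf T u).
  { unfold Qf. rewrite (inner_ext w (fun i => Cadd (v i) (Cmul (RtoC (-1)) (u i))) _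
      (fun i => Cadd (u i) (Cmul (RtoC (-1)) (apply T u i)))).
    2: intros; rewrite Hw by auto; ceq. 2: intros; rewrite Htw by auto; ceq.
    rewrite inner_add_r, inner_mul_r.
    rewrite <- (inner_sym u), <- (inner_sym (apply T u)).
    rewrite !inner_add_r, !inner_mul_r.
    rewrite <- (apply_adjoint T u v) by (apply psd_hermitian; auto). fold u.
    rewrite <- (inner_sym v u). rewrite <- (inner_sym u (apply T u)).
    unfold nrm2. simpl. ring_simplify. ring. }
  rewrite E1, E2 in Hq. unfold u in *. lra.
Qed.
End Hilbert.

(** * The Nussbaum-Szkola distribution *)

(** The free weight [s] keeps the factor of the type-I error at [1 + s], close to 1. The plain bound
    with factor 2 would only push that error up to about 1/2. *)
Lemma Cnorm2_add_le a b s : 0 < s ->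
  Cnorm2 (Cadd a b) <= (1 + s) * Cnorm2 a + (1 + / s) * Cnorm2 b.
Proof.
  intros Hs. unfold Cnorm2; simpl.
  assert (H : forall x y, (x + y) * (x + y) <= (1 + s) * (x * x) + (1 + / s) * (y * y)).
  { intros x y.
    assert (E : (1 + s) * (x * x) + (1 + / s) * (y * y) - (x + y) * (x + y)
                = / s * ((s * x - y) * (s * x - y))) by (field; lra).
    assert (0 < / s) by (apply Rinv_0_lt_compat; auto).
    assert (0 <= / s * ((s * x - y) * (s * x - y))) by (apply Rmult_le_pos; [lra|apply Rle_0_sqr]).
    lra. }
  pose proof (H (Cre a) (Cre b)). pose proof (H (Cim a) (Cim b)). lra.
Qed.

Lemma povm_complement d n T : povm_elem d n T -> povm_elem d n (subop (idop d n) T).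
Proof.
  intros [H1 H2]. split; auto.
  replace (subop (idop d n) (subop (idop d n) T)) with T; auto.
  extensionality i; extensionality j. unfold subop. ring.
Qed.

Definition overlap (d n : nat) (e f : word -> Vec) (j k : word) : R :=
  Cnorm2 (inner d n (e j) (f k)).

Lemma overlap_ge0 d n e f j k : 0 <= overlap d n e f j k.
Proof. apply Cnorm2_ge0. Qed.

Lemma overlap_mass d n e f j : onb d n e -> onb d n f -> valid d n j ->
  sumR (words d n) (overlap d n e f j) = 1.
Proof. intros He Hf Hj. apply onb_mass; auto. apply onb_nrm2; auto. Qed.

(** As [T] is self-adjoint, Parseval turns the sum into the squared norm of [T u], and
    [T^2 <= T]. *)
Lemma sum_overlap_povm d n T u f : povm_elem d n T -> onb d n f ->
  sumR (words d n) (fun k => Cnorm2 (inner d n u (apply d n T (f k)))) <= Qf d n T u.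
Proof.
  intros HT Hf. eapply Rle_trans; [|apply povm_square_le; auto].
  rewrite (parseval d n f) by auto. apply Req_le. apply sumR_ext; intros k _.
  rewrite apply_adjoint by (apply (psd_hermitian d n), HT). apply Cnorm2_inner_sym.
Qed.

(* Insert [1 = (1 - T) + T] between the two eigenbases. *)
Lemma test_errors_lower_bound d n rho sigma lam e mu f T c s :
  psd d n rho -> psd d n sigma -> spec d n rho lam e -> spec d n sigma mu f ->
  povm_elem d n T -> 0 <= c -> 0 < s ->
  sumR (words d n) (fun j => sumR (words d n) (fun k =>
     Rmin (lam j) (c * mu k) * overlap d n e f j k))
  <= (1 + s) * Cre (tr d n (mulop d n (subop (idop d n) T) rho))
     + (1 + / s) * (c * Cre (tr d n (mulop d n T sigma))).
Proof.
  intros Hr Hs Sr Ss HT Hc Hs0. set (T' := subop (idop d n) T).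
  pose proof (povm_complement _ _ _ HT) as HT'. fold T' in HT'.
  pose proof (spec_onb _ _ _ _ _ Sr) as Oe. pose proof (spec_onb _ _ _ _ _ Ss) as Of.
  assert (Hsi : 0 < / s) by (apply Rinv_0_lt_compat; auto).
  apply Rle_trans with (sumR (words d n) (fun j => sumR (words d n) (fun k =>
     (1 + s) * (lam j * Cnorm2 (inner d n (e j) (apply d n T' (f k))))))
   + sumR (words d n) (fun j => sumR (words d n) (fun k =>
     (1 + / s) * (c * (mu k * Cnorm2 (inner d n (f k) (apply d n T (e j)))))))).
  - rewrite <- sumR_add. apply sumR_le; intros j Hj. rewrite <- sumR_add. apply sumR_le; intros k Hk.
    apply words_valid in Hj, Hk. unfold overlap.
    assert (E : inner d n (e j) (f k) =
      Cadd (inner d n (e j) (apply d n T' (f k))) (inner d n (e j) (apply d n T (f k)))).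
    { rewrite <- inner_add_r. apply inner_ext; auto. intros i Hi.
      rewrite <- (apply_id d n (f k) i) by auto. unfold apply, T', subop. rewrite <- sumC_add.
      apply sumC_ext; intros; ring. }
    rewrite E.
    pose proof (Cnorm2_add_le (inner d n (e j) (apply d n T' (f k)))
      (inner d n (e j) (apply d n T (f k))) s Hs0) as HC.
    assert (E2 : Cnorm2 (inner d n (f k) (apply d n T (e j)))
       = Cnorm2 (inner d n (e j) (apply d n T (f k)))).
    { rewrite apply_adjoint by (apply (psd_hermitian d n), HT). apply Cnorm2_inner_sym. }
    rewrite E2.
    set (x := Cnorm2 (inner d n (e j) (apply d n T' (f k)))) in *.
    set (y := Cnorm2 (inner d n (e j) (apply d n T (f k)))) in *.
    assert (Hx : 0 <= x) by apply Cnorm2_ge0. assert (Hy : 0 <= y) by apply Cnorm2_ge0.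
    assert (Hl : 0 <= lam j) by (eapply (psd_eigen_ge0 d n rho); eauto).
    assert (Hm : 0 <= mu k) by (eapply (psd_eigen_ge0 d n sigma); eauto).
    assert (0 <= c * mu k) by (apply Rmult_le_pos; auto).
    (* The minimum is replaced by [lam j] in the part with [1 - T] and by [c * mu k] in the part
       with [T]; each part can then be summed freely over the other index. *)
    set (m := Rmin (lam j) (c * mu k)).
    assert (0 <= m) by (apply Rmin_glb; auto).
    assert (m <= lam j) by apply Rmin_l. assert (m <= c * mu k) by apply Rmin_r.
    apply Rle_trans with (m * ((1 + s) * x + (1 + / s) * y)).
    + apply Rmult_le_compat_l; auto.
    + assert (m * x <= lam j * x) by (apply Rmult_le_compat_r; auto).
      assert (m * y <= c * mu k * y) by (apply Rmult_le_compat_r; auto).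
      assert ((1 + s) * (m * x) <= (1 + s) * (lam j * x)) by (apply Rmult_le_compat_l; lra).
      assert ((1 + / s) * (m * y) <= (1 + / s) * (c * mu k * y)) by (apply Rmult_le_compat_l; lra).
      lra.
  - apply Rplus_le_compat.
    + rewrite (tr_mul_spec d n T' rho lam e) by auto. rewrite <- sumR_mul_l.
      apply sumR_le; intros j Hj. apply words_valid in Hj.
      rewrite sumR_mul_l. apply Rmult_le_compat_l; [lra|]. rewrite sumR_mul_l.
      apply Rmult_le_compat_l; [eapply (psd_eigen_ge0 d n rho); eauto|].
      apply sum_overlap_povm; auto.
    + rewrite (tr_mul_spec d n T sigma mu f) by auto. rewrite sumR_swap, <- !sumR_mul_l.
      apply sumR_le; intros k Hk. apply words_valid in Hk.
      rewrite sumR_mul_l. apply Rmult_le_compat_l; [lra|]. rewrite sumR_mul_l.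
      apply Rmult_le_compat_l; [lra|]. rewrite sumR_mul_l.
      apply Rmult_le_compat_l; [eapply (psd_eigen_ge0 d n sigma); eauto|].
      apply sum_overlap_povm; auto.
Qed.

(** The eigenbases are fixed and carried along because tensor powers have to be diagonalised in
    product bases. The clause [ps_supp] expresses finiteness of the relative entropy. *)
Record pair_spec (d n : nat) (rho sigma : Op) (lam : word -> R) (e : word -> Vec)
  (mu : word -> R) (f : word -> Vec) : Prop := {
  ps_rho : spec d n rho lam e;
  ps_sigma : spec d n sigma mu f;
  ps_lam : forall j, valid d n j -> 0 <= lam j;
  ps_mu : forall k, valid d n k -> 0 <= mu k;
  ps_mass : sumR (words d n) lam = 1;
  ps_supp : forall j k, valid d n j -> valid d n k ->
    0 < lam j -> mu k = 0 -> inner d n (e j) (f k) = C0 }.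

(* Expectation of [h lam_j mu_k] under the Nussbaum-Szkola distribution
   [lam_j * |<e_j|f_k>|^2]. *)
Definition ns_mean (d n : nat) lam (e : word -> Vec) mu (f : word -> Vec) (h : R -> R -> R) : R :=
  sumR (words d n) (fun j => sumR (words d n) (fun k =>
    lam j * overlap d n e f j k * h (lam j) (mu k))).

Definition llr (x y : R) : R := ln x - ln y.
(** The relative entropy in nats ([ns_entropy_relent]). Pairs where [ln] would meet a zero
    eigenvalue have weight 0 by [ps_supp], so the default value of [ln] never enters. *)
Definition ns_entropy d n lam e mu f : R := ns_mean d n lam e mu f llr.
Definition ns_mgf d n lam e mu f (s : R) : R := ns_mean d n lam e mu f (fun x y => exp (s * llr x y)).

(** From [exp (- y) >= 1 - y] comes [exp y <= 1 / (1 - y)], and [(1 - y) (1 + y + 2 y^2) = 1 + y^2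
    (1 - 2 y)]. *)
Lemma exp_le_quadratic y : y <= 1 / 2 -> exp y <= 1 + y + 2 * (y * y).
Proof.
  intros Hy. pose proof (exp_ineq1_le (- y)) as H. rewrite exp_Ropp in H.
  assert (0 < exp y) by apply exp_pos.
  assert (exp y * (1 - y) <= 1).
  { apply Rle_trans with (exp y * / exp y); [|rewrite Rinv_r; lra].
    apply Rmult_le_compat_l; lra. }
  apply Rmult_le_reg_l with (1 - y); [lra|].
  assert (0 <= y * y * (1 - 2 * y)) by (apply Rmult_le_pos; [apply Rle_0_sqr|lra]). lra.
Qed.

Section NS.
Context (d n : nat) (rho sigma : Op) (lam : word -> R) (e : word -> Vec) (mu : word -> R) (f : word -> Vec).
Context (P : pair_spec d n rho sigma lam e mu f).
Notation W := (words d n).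

(** The case split behind every computation with logarithms: either the term drops out or all
    arguments of [ln] are positive. *)
Lemma ns_weight_pos j k : valid d n j -> valid d n k ->
  lam j * overlap d n e f j k = 0 \/
  (0 < lam j /\ 0 < mu k /\ 0 < overlap d n e f j k).
Proof.
  intros Hj Hk. pose proof (ps_lam _ _ _ _ _ _ _ _ P j Hj). pose proof (ps_mu _ _ _ _ _ _ _ _ P k Hk).
  pose proof (overlap_ge0 d n e f j k).
  destruct (Req_dec (lam j) 0) as [E|E]; [left; rewrite E; ring|].
  destruct (Req_dec (overlap d n e f j k) 0) as [E'|E']; [left; rewrite E'; ring|].
  right. split; [lra|]. split; [|lra].
  destruct (Req_dec (mu k) 0) as [E''|E'']; [|lra].
  exfalso; apply E'. unfold overlap. rewrite (ps_supp _ _ _ _ _ _ _ _ P j k); auto; [|lra].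
  unfold Cnorm2; simpl; ring.
Qed.

Lemma ns_weight_ge0 j k : valid d n j -> 0 <= lam j * overlap d n e f j k.
Proof.
  intros Hj. apply Rmult_le_pos; [|apply overlap_ge0]. apply (ps_lam _ _ _ _ _ _ _ _ P); auto.
Qed.

Lemma ns_mean_le h h' :
  (forall j k, valid d n j -> valid d n k -> 0 < lam j -> 0 < mu k ->
     h (lam j) (mu k) <= h' (lam j) (mu k)) ->
  ns_mean d n lam e mu f h <= ns_mean d n lam e mu f h'.
Proof.
  intros H. apply sumR_le; intros j Hj. apply sumR_le; intros k Hk. apply words_valid in Hj, Hk.
  destruct (ns_weight_pos j k) as [E|(E1 & E2 & E3)]; auto; [rewrite E; lra|].
  apply Rmult_le_compat_l; [apply ns_weight_ge0; auto | auto].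
Qed.

Lemma ns_mean_add h h' :
  ns_mean d n lam e mu f (fun x y => h x y + h' x y) =
  ns_mean d n lam e mu f h + ns_mean d n lam e mu f h'.
Proof.
  unfold ns_mean. rewrite <- sumR_add. apply sumR_ext; intros. rewrite <- sumR_add.
  apply sumR_ext; intros. ring.
Qed.
Lemma ns_mean_scal c h :
  ns_mean d n lam e mu f (fun x y => c * h x y) = c * ns_mean d n lam e mu f h.
Proof.
  unfold ns_mean. rewrite <- sumR_mul_l. apply sumR_ext; intros. rewrite <- sumR_mul_l.
  apply sumR_ext; intros. ring.
Qed.
Lemma ns_mean_left h :
  ns_mean d n lam e mu f (fun x _ => h x) = sumR W (fun j => lam j * h (lam j)).
Proof.
  apply sumR_ext; intros j Hj. apply words_valid in Hj. rewrite sumR_mul_r, sumR_mul_l.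
  rewrite overlap_mass; auto. ring.
  apply (spec_onb _ _ _ _ _ (ps_rho _ _ _ _ _ _ _ _ P)).
  apply (spec_onb _ _ _ _ _ (ps_sigma _ _ _ _ _ _ _ _ P)).
Qed.
Lemma ns_mean_const c : ns_mean d n lam e mu f (fun _ _ => c) = c.
Proof.
  rewrite (ns_mean_left (fun _ => c)), sumR_mul_r, (ps_mass _ _ _ _ _ _ _ _ P). ring.
Qed.

(** Markov's inequality: where the ratio is at most [a] the minimum is [lam j], and the remaining
    pairs have probability at most [exp (- (s * a))] times the moment generating function. *)
Lemma ns_tail s a : 0 < s ->
  1 - exp (- (s * a)) * ns_mgf d n lam e mu f s <=
  sumR W (fun j => sumR W (fun k => Rmin (lam j) (exp a * mu k) * overlap d n e f j k)).
Proof.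
  intros Hs. unfold ns_mgf. rewrite <- ns_mean_scal.
  rewrite <- (ns_mean_const 1).
  assert (E : forall x y, x - y = x + -1 * y) by (intros; ring). rewrite E.
  rewrite <- ns_mean_scal, <- ns_mean_add.
  apply sumR_le; intros j Hj. apply sumR_le; intros k Hk. apply words_valid in Hj, Hk.
  destruct (ns_weight_pos j k) as [E'|(E1 & E2 & E3)]; auto.
  - rewrite E', Rmult_0_l. apply Rmult_le_pos; [|apply overlap_ge0]. apply Rmin_glb.
    apply (ps_lam _ _ _ _ _ _ _ _ P); auto. apply Rmult_le_pos; [left; apply exp_pos|].
    apply (ps_mu _ _ _ _ _ _ _ _ P); auto.
  - rewrite (Rmult_comm (lam j)), Rmult_assoc, Rmult_comm.
    apply Rmult_le_compat_r; [lra|].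
    rewrite <- exp_plus. set (t := exp (- (s * a) + s * llr (lam j) (mu k))).
    assert (0 < t) by apply exp_pos.
    unfold Rmin. destruct (Rle_dec (lam j) (exp a * mu k)) as [L|L]; [nra|].
    assert (1 <= t).
    { rewrite <- exp_0. unfold t. left. apply exp_increasing.
      assert (a < llr (lam j) (mu k)); [|nra].
      unfold llr. assert (ln (exp a * mu k) < ln (lam j)).
      { apply ln_increasing; [|lra]. apply Rmult_lt_0_compat; auto. apply exp_pos. }
      rewrite ln_mult, ln_exp in H0; auto; [lra|apply exp_pos]. }
    assert (0 < exp a * mu k) by (apply Rmult_lt_0_compat; auto; apply exp_pos). nra.
Qed.

(** The moment generating function has slope [ns_entropy] at 0; since the ratio takes finitely many
    values, a quadratic bound on [exp] replaces differentiation. *)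
Lemma ns_mgf_bound delta : 0 < delta -> exists s, 0 < s /\
  ns_mgf d n lam e mu f s <= exp (s * (ns_entropy d n lam e mu f + delta)).
Proof.
  intros Hd.
  set (B := sumR W (fun j => sumR W (fun k => Rabs (llr (lam j) (mu k))))).
  assert (HB : forall j k, valid d n j -> valid d n k -> Rabs (llr (lam j) (mu k)) <= B).
  { intros j k Hj Hk. apply words_valid in Hj, Hk.
    apply Rle_trans with (sumR W (fun k => Rabs (llr (lam j) (mu k)))).
    - apply (sumR_term_le W (fun k => Rabs (llr (lam j) (mu k)))); auto. intros; apply Rabs_pos.
    - apply (sumR_term_le W (fun j => sumR W (fun k => Rabs (llr (lam j) (mu k))))); auto.
      intros. apply sumR_ge0; intros; apply Rabs_pos. }
  assert (B0 : 0 <= B).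
  { apply sumR_ge0; intros. apply sumR_ge0; intros; apply Rabs_pos. }
  (* The first bound puts [s] times the ratio below 1/2, where [exp_le_quadratic] applies; the
     second keeps the quadratic term below [s * delta]. *)
  set (s := Rmin (/ (2 * (B + 1))) (delta / (2 * (B * B + 1)))).
  assert (Hs : 0 < s).
  { apply Rmin_glb_lt. apply Rinv_0_lt_compat; lra. apply Rdiv_lt_0_compat; nra. }
  assert (HsB : s * B <= 1 / 2).
  { apply Rle_trans with (/ (2 * (B + 1)) * (B + 1)); [|right; field; lra].
    apply Rmult_le_compat; try lra. apply Rmin_l. }
  assert (HsBB : 2 * (s * (B * B)) <= delta).
  { apply Rle_trans with (2 * (delta / (2 * (B * B + 1)) * (B * B + 1))); [|right; field; nra].
    apply Rmult_le_compat_l; [lra|].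
    apply Rmult_le_compat; try nra. apply Rmin_r. }
  exists s. split; auto.
  apply Rle_trans with (1 + s * ns_entropy d n lam e mu f + s * delta).
  - unfold ns_mgf, ns_entropy. rewrite <- ns_mean_scal.
    rewrite <- (ns_mean_const 1) at 1. rewrite <- (ns_mean_const (s * delta)).
    rewrite <- !ns_mean_add. apply ns_mean_le. intros j k Hj Hk _ _.
    specialize (HB j k Hj Hk). set (y := llr (lam j) (mu k)) in *.
    assert (Hy : y <= B) by (eapply Rle_trans; [apply RRle_abs|exact HB]).
    assert (Hyy : y * y <= B * B).
    { rewrite <- (Rabs_right (y * y)) by (apply Rle_ge, Rle_0_sqr). rewrite Rabs_mult.
      pose proof (Rabs_pos y). apply Rmult_le_compat; auto. }
    assert (Hsy : s * y <= 1 / 2) by (eapply Rle_trans; [apply Rmult_le_compat_l; [lra|exact Hy]|exact HsB]).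
    pose proof (exp_le_quadratic (s * y) Hsy).
    assert (s * (y * y) <= s * (B * B)) by (apply Rmult_le_compat_l; lra).
    assert (s * (2 * (s * (y * y))) <= s * delta) by (apply Rmult_le_compat_l; lra). lra.
  - rewrite Rmult_plus_distr_l. pose proof (exp_ineq1_le (s * ns_entropy d n lam e mu f + s * delta)). lra.
Qed.

(** Gibbs' inequality: apply [ln z <= z - 1] to [z = mu k / lam j], whose mean is at most the sum of
    [mu] because the overlaps with each [f k] add up to 1. *)
Lemma ns_entropy_ge0 : sumR W mu <= 1 -> 0 <= ns_entropy d n lam e mu f.
Proof.
  intros Hm.
  assert (H : ns_mean d n lam e mu f (fun x y => 1 + -1 * (y * / x)) <= ns_entropy d n lam e mu f).
  { apply ns_mean_le. intros j k Hj Hk Hl Hmu. unfold llr.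
    assert (E : ln (lam j) - ln (mu k) = - ln (mu k * / lam j)).
    { rewrite ln_mult, ln_Rinv; auto; [ring|]. apply Rinv_0_lt_compat; auto. }
    rewrite E. pose proof (exp_ineq1_le (ln (mu k * / lam j))).
    rewrite exp_ln in H; [lra|]. apply Rmult_lt_0_compat; auto. apply Rinv_0_lt_compat; auto. }
  rewrite ns_mean_add, ns_mean_const, ns_mean_scal in H.
  assert (H' : ns_mean d n lam e mu f (fun x y => y * / x) <= sumR W mu); [|lra].
  unfold ns_mean. rewrite sumR_swap. apply sumR_le; intros k Hk. apply words_valid in Hk.
  apply Rle_trans with (sumR W (fun j => mu k * overlap d n f e k j)).
  - apply sumR_le; intros j Hj. apply words_valid in Hj.
    assert (E : overlap d n f e k j = overlap d n e f j k) by apply Cnorm2_inner_sym. rewrite E.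
    pose proof (ps_lam _ _ _ _ _ _ _ _ P j Hj). pose proof (ps_mu _ _ _ _ _ _ _ _ P k Hk).
    pose proof (overlap_ge0 d n e f j k).
    destruct (Req_dec (lam j) 0) as [E'|E'].
    + rewrite E'. rewrite !Rmult_0_l. nra.
    + right. field. auto.
  - rewrite sumR_mul_l, overlap_mass; auto; [lra| |].
    apply (spec_onb _ _ _ _ _ (ps_sigma _ _ _ _ _ _ _ _ P)).
    apply (spec_onb _ _ _ _ _ (ps_rho _ _ _ _ _ _ _ _ P)).
Qed.
End NS.

Lemma ln2_pos : 0 < ln 2.
Proof. rewrite <- ln_1. apply ln_increasing; lra. Qed.

Lemma ns_entropy_relent d n rho sigma lam e mu f : pair_spec d n rho sigma lam e mu f ->
  sumR (words d n) (fun j => xlog2x (lam j))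
   - sumR (words d n) (fun j => sumR (words d n) (fun k =>
        lam j * Cnorm2 (inner d n (e j) (f k)) * log2pos (mu k)))
  = ns_entropy d n lam e mu f / ln 2.
Proof.
  intros P. pose proof ln2_pos.
  apply Rmult_eq_reg_l with (ln 2); [|lra]. unfold Rdiv. rewrite (Rmult_comm _ (/ ln 2)), <- Rmult_assoc, Rinv_r, Rmult_1_l by lra.
  unfold ns_entropy, llr.
  transitivity (ns_mean d n lam e mu f (fun x y => (fun x _ => ln x) x y + -1 * ln y)).
  2:{ unfold ns_mean. do 2 (apply sumR_ext; intros). ring. }
  rewrite ns_mean_add, ns_mean_scal, (ns_mean_left _ _ _ _ _ _ _ _ P (fun x => ln x)).
  rewrite Rmult_minus_distr_l. unfold Rminus. f_equal.
  - rewrite <- sumR_mul_l. apply sumR_ext; intros j Hj. apply words_valid in Hj.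
    pose proof (ps_lam _ _ _ _ _ _ _ _ P j Hj). unfold xlog2x, log2.
    destruct (Rlt_dec 0 (lam j)); [field; lra|]. replace (lam j) with 0 by lra. ring.
  - unfold ns_mean. match goal with |- _ = -1 * ?x => replace (-1 * x) with (- x) by ring end.
    f_equal. rewrite <- sumR_mul_l.
    apply sumR_ext; intros j Hj. rewrite <- sumR_mul_l. apply sumR_ext; intros k Hk.
    apply words_valid in Hj, Hk. change (Cnorm2 (inner d n (e j) (f k))) with (overlap d n e f j k).
    destruct (ns_weight_pos _ _ _ _ _ _ _ _ P j k) as [E|(E1 & E2 & E3)]; auto.
    + rewrite E. ring.
    + unfold log2pos, log2. destruct (Rlt_dec 0 (mu k)); [field; lra|lra].
Qed.

Lemma relent_pair_spec d n rho sigma x : density d n rho -> density d n sigma ->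
  relent_is d n rho sigma (Some x) ->
  exists lam e mu f, pair_spec d n rho sigma lam e mu f /\ x * ln 2 = ns_entropy d n lam e mu f.
Proof.
  intros Hr Hs (lam & e & mu & f & Sr & Ss & [[H E]|[_ E]]); [|discriminate].
  exists lam, e, mu, f.
  assert (P : pair_spec d n rho sigma lam e mu f).
  { constructor; auto.
    - intros j Hj. eapply (psd_eigen_ge0 d n rho); eauto. apply Hr.
    - intros j Hj. eapply (psd_eigen_ge0 d n sigma); eauto. apply Hs.
    - apply (density_eigen_sum d n rho lam e); auto. }
  split; auto. injection E as E. rewrite E, (ns_entropy_relent _ _ _ _ _ _ _ _ P).
  pose proof ln2_pos. field. lra.
Qed.

(** [relent_is] quantifies existentially over eigenbases, so any choice of them gives a value over
    which the infimum [E_M] ranges; independence of the choice is never an issue. *)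
Lemma pair_spec_relent d n rho sigma lam e mu f : pair_spec d n rho sigma lam e mu f ->
  relent_is d n rho sigma (Some (ns_entropy d n lam e mu f / ln 2)).
Proof.
  intros P. exists lam, e, mu, f. split; [apply P|]. split; [apply P|].
  left. split; [apply (ps_supp _ _ _ _ _ _ _ _ P)|].
  rewrite (ns_entropy_relent _ _ _ _ _ _ _ _ P). reflexivity.
Qed.

(** * Tensor products *)

Lemma valid_app d n m u v : valid d n u -> valid d m v -> valid d (n + m) (u ++ v).
Proof.
  rewrite !validE. intros [H1 H2] [H3 H4]. rewrite length_app. split; [lia|].
  intros a Ha. apply in_app_iff in Ha. destruct Ha; auto.
Qed.
Lemma firstn_valid d n m w : valid d (n + m) w -> valid d n (firstn n w).
Proof.
  rewrite !validE. intros [H1 H2]. rewrite length_firstn. split; [lia|].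
  intros a Ha. apply H2. rewrite <- (firstn_skipn n w). apply in_app_iff; auto.
Qed.
Lemma skipn_valid d n m w : valid d (n + m) w -> valid d m (skipn n w).
Proof.
  rewrite !validE. intros [H1 H2]. rewrite length_skipn. split; [lia|].
  intros a Ha. apply H2. rewrite <- (firstn_skipn n w). apply in_app_iff; auto.
Qed.
Lemma firstn_app_valid d n u v : valid d n u -> firstn n (u ++ v) = u.
Proof.
  rewrite validE. intros [H _]. rewrite firstn_app, <- H, firstn_all, Nat.sub_diag. simpl. apply app_nil_r.
Qed.
Lemma skipn_app_valid d n u v : valid d n u -> skipn n (u ++ v) = v.
Proof.
  rewrite validE. intros [H _]. rewrite skipn_app, <- H, skipn_all, Nat.sub_diag. reflexivity.
Qed.

Lemma sumC_words_split d n m (f : word -> word -> C) :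
  sumC (words d (n + m)) (fun w => f (firstn n w) (skipn n w)) =
  sumC (words d n) (fun u => sumC (words d m) (fun v => f u v)).
Proof.
  rewrite sumC_words_add. apply sumC_ext; intros u Hu. apply sumC_ext; intros v Hv.
  apply words_valid in Hu. rewrite (firstn_app_valid d n), (skipn_app_valid d n) by auto. reflexivity.
Qed.
Lemma sumR_words_split d n m (f : word -> word -> R) :
  sumR (words d (n + m)) (fun w => f (firstn n w) (skipn n w)) =
  sumR (words d n) (fun u => sumR (words d m) (fun v => f u v)).
Proof.
  rewrite sumR_words_add. apply sumR_ext; intros u Hu. apply sumR_ext; intros v Hv.
  apply words_valid in Hu. rewrite (firstn_app_valid d n), (skipn_app_valid d n) by auto. reflexivity.
Qed.
Lemma sumR_words_prod d n m (f g : word -> R) :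
  sumR (words d (n + m)) (fun w => f (firstn n w) * g (skipn n w)) =
  sumR (words d n) f * sumR (words d m) g.
Proof.
  rewrite (sumR_words_split d n m (fun u v => f u * g v)).
  rewrite <- sumR_mul_r. apply sumR_ext; intros; apply sumR_mul_l.
Qed.
Lemma sumC_words_prod d n m (f g : word -> C) :
  sumC (words d (n + m)) (fun w => Cmul (f (firstn n w)) (g (skipn n w))) =
  Cmul (sumC (words d n) f) (sumC (words d m) g).
Proof.
  rewrite (sumC_words_split d n m (fun u v => Cmul (f u) (g v))).
  rewrite <- sumC_mul_r. apply sumC_ext; intros; apply sumC_mul_l.
Qed.

Definition tens_val (n : nat) (a b : word -> R) : word -> R := fun w => a (firstn n w) * b (skipn n w).
Definition tens_vec (n : nat) (e f : word -> Vec) : word -> Vec :=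
  fun w i => Cmul (e (firstn n w) (firstn n i)) (f (skipn n w) (skipn n i)).

Lemma inner_tens_vec d n m e f e' f' j k :
  inner d (n + m) (tens_vec n e f j) (tens_vec n e' f' k) =
  Cmul (inner d n (e (firstn n j)) (e' (firstn n k))) (inner d m (f (skipn n j)) (f' (skipn n k))).
Proof.
  unfold inner. rewrite <- sumC_words_prod. apply sumC_ext; intros i _. unfold tens_vec.
  rewrite Cconj_mul. ring.
Qed.

Lemma spec_tens d n m A B a e b f : spec d n A a e -> spec d m B b f ->
  spec d (n + m) (tens n A B) (tens_val n a b) (tens_vec n e f).
Proof.
  intros [He HA] [Hf HB]. split.
  - intros j k Hj Hk. rewrite inner_tens_vec, He, Hf by eauto using firstn_valid, skipn_valid.
    destruct (list_eq_dec Nat.eq_dec j k) as [<-|E].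
    + destruct (list_eq_dec Nat.eq_dec (firstn n j) (firstn n j)); [|congruence].
      destruct (list_eq_dec Nat.eq_dec (skipn n j) (skipn n j)); [|congruence]. ring.
    + destruct (list_eq_dec Nat.eq_dec (firstn n j) (firstn n k)) as [E1|]; [|ring].
      destruct (list_eq_dec Nat.eq_dec (skipn n j) (skipn n k)) as [E2|]; [|ring].
      exfalso; apply E. rewrite <- (firstn_skipn n j), <- (firstn_skipn n k). congruence.
  - intros i i' Hi Hi'. unfold tens. rewrite HA, HB by eauto using firstn_valid, skipn_valid.
    rewrite <- sumC_words_prod. apply sumC_ext; intros j _. unfold tens_val, tens_vec. ceq.
Qed.

Lemma pair_spec_tens d n m rho sigma lam e mu f rho' sigma' lam' e' mu' f' :
  pair_spec d n rho sigma lam e mu f -> pair_spec d m rho' sigma' lam' e' mu' f' ->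
  pair_spec d (n + m) (tens n rho rho') (tens n sigma sigma')
    (tens_val n lam lam') (tens_vec n e e') (tens_val n mu mu') (tens_vec n f f').
Proof.
  intros P Q. constructor.
  - apply spec_tens; [apply P|apply Q].
  - apply spec_tens; [apply P|apply Q].
  - intros j Hj. apply Rmult_le_pos.
    apply (ps_lam _ _ _ _ _ _ _ _ P); eauto using firstn_valid.
    apply (ps_lam _ _ _ _ _ _ _ _ Q); eauto using skipn_valid.
  - intros j Hj. apply Rmult_le_pos.
    apply (ps_mu _ _ _ _ _ _ _ _ P); eauto using firstn_valid.
    apply (ps_mu _ _ _ _ _ _ _ _ Q); eauto using skipn_valid.
  - unfold tens_val. rewrite sumR_words_prod, (ps_mass _ _ _ _ _ _ _ _ P), (ps_mass _ _ _ _ _ _ _ _ Q). ring.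
  - intros j k Hj Hk Hl Hm. rewrite inner_tens_vec. unfold tens_val in *.
    pose proof (firstn_valid _ _ _ _ Hj) as V1. pose proof (skipn_valid _ _ _ _ Hj) as V2.
    pose proof (firstn_valid _ _ _ _ Hk) as V3. pose proof (skipn_valid _ _ _ _ Hk) as V4.
    pose proof (ps_lam _ _ _ _ _ _ _ _ P _ V1). pose proof (ps_lam _ _ _ _ _ _ _ _ Q _ V2).
    assert (lam (firstn n j) <> 0) by (intros E; rewrite E in Hl; lra).
    assert (lam' (skipn n j) <> 0) by (intros E; rewrite E in Hl; lra).
    apply Rmult_integral in Hm. destruct Hm as [Hm|Hm].
    + rewrite (ps_supp _ _ _ _ _ _ _ _ P); auto; [ring|lra].
    + rewrite (ps_supp _ _ _ _ _ _ _ _ Q _ _ V2 V4); auto; [ring|lra].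
Qed.

Lemma overlap_tens d n m e e' f f' j k :
  overlap d (n + m) (tens_vec n e e') (tens_vec n f f') j k =
  overlap d n e f (firstn n j) (firstn n k) * overlap d m e' f' (skipn n j) (skipn n k).
Proof. unfold overlap. rewrite inner_tens_vec. apply Cnorm2_mul. Qed.

(** Independence: weights multiply and log-likelihood ratios add. Zero-weight terms are discarded
    first, because splitting the logarithm needs positive factors. *)
Lemma ns_mgf_tens d n m rho sigma lam e mu f rho' sigma' lam' e' mu' f' s :
  pair_spec d n rho sigma lam e mu f -> pair_spec d m rho' sigma' lam' e' mu' f' ->
  ns_mgf d (n + m) (tens_val n lam lam') (tens_vec n e e') (tens_val n mu mu') (tens_vec n f f') s
  = ns_mgf d n lam e mu f s * ns_mgf d m lam' e' mu' f' s.
Proof.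
  intros P Q. unfold ns_mgf, ns_mean. rewrite <- sumR_words_prod.
  apply sumR_ext; intros j Hj. rewrite <- sumR_words_prod. apply sumR_ext; intros k Hk.
  apply words_valid in Hj, Hk.
  pose proof (firstn_valid _ _ _ _ Hj) as V1. pose proof (skipn_valid _ _ _ _ Hj) as V2.
  pose proof (firstn_valid _ _ _ _ Hk) as V3. pose proof (skipn_valid _ _ _ _ Hk) as V4.
  rewrite overlap_tens. unfold tens_val.
  destruct (ns_weight_pos _ _ _ _ _ _ _ _ P _ _ V1 V3) as [E|(A1 & A2 & A3)].
  { transitivity 0; [|rewrite E; ring].
    transitivity (lam (firstn n j) * overlap d n e f (firstn n j) (firstn n k) *
      (lam' (skipn n j) * overlap d m e' f' (skipn n j) (skipn n k) *
       exp (s * llr (lam (firstn n j) * lam' (skipn n j)) (mu (firstn n k) * mu' (skipn n k)))));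
    [ring|rewrite E; ring]. }
  destruct (ns_weight_pos _ _ _ _ _ _ _ _ Q _ _ V2 V4) as [E|(B1 & B2 & B3)].
  { transitivity 0; [|rewrite E; ring].
    transitivity (lam' (skipn n j) * overlap d m e' f' (skipn n j) (skipn n k) *
      (lam (firstn n j) * overlap d n e f (firstn n j) (firstn n k) *
       exp (s * llr (lam (firstn n j) * lam' (skipn n j)) (mu (firstn n k) * mu' (skipn n k)))));
    [ring|rewrite E; ring]. }
  assert (E : exp (s * llr (lam (firstn n j) * lam' (skipn n j)) (mu (firstn n k) * mu' (skipn n k)))
    = exp (s * llr (lam (firstn n j)) (mu (firstn n k))) * exp (s * llr (lam' (skipn n j)) (mu' (skipn n k)))).
  { rewrite <- exp_plus. f_equal. unfold llr. rewrite !ln_mult by auto. ring. }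
  rewrite E. ring.
Qed.

Lemma ns_entropy_tens d n m rho sigma lam e mu f rho' sigma' lam' e' mu' f' :
  pair_spec d n rho sigma lam e mu f -> pair_spec d m rho' sigma' lam' e' mu' f' ->
  ns_entropy d (n + m) (tens_val n lam lam') (tens_vec n e e') (tens_val n mu mu') (tens_vec n f f')
  = ns_entropy d n lam e mu f + ns_entropy d m lam' e' mu' f'.
Proof.
  intros P Q.
  (* The total masses, equal to 1, are inserted so that both summands become products of sums over
     the two factors. *)
  transitivity (ns_entropy d n lam e mu f * ns_mean d m lam' e' mu' f' (fun _ _ => 1)
    + ns_mean d n lam e mu f (fun _ _ => 1) * ns_entropy d m lam' e' mu' f').
  2:{ rewrite (ns_mean_const _ _ _ _ _ _ _ _ P), (ns_mean_const _ _ _ _ _ _ _ _ Q). ring. }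
  unfold ns_entropy, ns_mean. rewrite <- !sumR_words_prod, <- sumR_add.
  apply sumR_ext; intros j Hj. rewrite <- !sumR_words_prod, <- sumR_add. apply sumR_ext; intros k Hk.
  apply words_valid in Hj, Hk.
  pose proof (firstn_valid _ _ _ _ Hj) as V1. pose proof (skipn_valid _ _ _ _ Hj) as V2.
  pose proof (firstn_valid _ _ _ _ Hk) as V3. pose proof (skipn_valid _ _ _ _ Hk) as V4.
  rewrite overlap_tens. unfold tens_val.
  set (a := lam (firstn n j)) in *. set (b := lam' (skipn n j)) in *.
  set (w := overlap d n e f (firstn n j) (firstn n k)) in *.
  set (w' := overlap d m e' f' (skipn n j) (skipn n k)) in *.
  set (X := llr (a * b) (mu (firstn n k) * mu' (skipn n k))).
  replace (a * b * (w * w') * X) with (a * w * (b * w') * X) by ring.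
  destruct (ns_weight_pos _ _ _ _ _ _ _ _ P _ _ V1 V3) as [E|(A1 & A2 & A3)];
    [fold a w in E; rewrite E; ring|].
  destruct (ns_weight_pos _ _ _ _ _ _ _ _ Q _ _ V2 V4) as [E|(B1 & B2 & B3)];
    [fold b w' in E; rewrite E; ring|].
  unfold X, llr. fold a in A1. fold b in B1. rewrite !ln_mult by auto. ring.
Qed.

Lemma tpow_add n m A : tpow (n + m) A = tens n (tpow n A) (tpow m A).
Proof.
  induction n as [|n IH]; simpl.
  - extensionality i; extensionality j. unfold tens. simpl. ring.
  - rewrite IH. extensionality i; extensionality j. unfold tens. simpl.
    destruct i as [|a i], j as [|b j]; simpl; rewrite ?firstn_nil, ?skipn_nil; ring.
Qed.

(** Hiding the eigenbases lets tensor products be iterated on the states alone, while remembering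
    the one number that is needed. *)
Definition has_pair_mgf d n rho sigma s x :=
  exists lam e mu f, pair_spec d n rho sigma lam e mu f /\ ns_mgf d n lam e mu f s = x.

Lemma has_pair_mgf_tens d n m rho sigma rho' sigma' s x y :
  has_pair_mgf d n rho sigma s x -> has_pair_mgf d m rho' sigma' s y ->
  has_pair_mgf d (n + m) (tens n rho rho') (tens n sigma sigma') s (x * y).
Proof.
  intros (lam & e & mu & f & P & <-) (lam' & e' & mu' & f' & P' & <-).
  do 4 eexists. split; [apply (pair_spec_tens _ _ _ _ _ _ _ _ _ _ _ _ _ _ _ P P')|].
  eapply ns_mgf_tens; eauto.
Qed.

Lemma spec_tpow0 d A : spec d 0 (tpow 0 A) (fun _ => 1) (fun _ _ => C1).
Proof.
  split.
  - intros j k Hj Hk. apply validE in Hj, Hk. destruct Hj as [Hj _], Hk as [Hk _].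
    destruct j, k; try discriminate. unfold inner; simpl. ceq.
  - intros i i' Hi Hi'. apply validE in Hi, Hi'. destruct Hi as [Hj _], Hi' as [Hk _].
    destruct i, i'; try discriminate. simpl. ceq.
Qed.

Lemma pair_spec_tpow0 d A B : pair_spec d 0 (tpow 0 A) (tpow 0 B) (fun _ => 1) (fun _ _ => C1) (fun _ => 1) (fun _ _ => C1).
Proof.
  constructor; try apply spec_tpow0; intros; try lra. simpl; ring.
Qed.

Lemma has_pair_mgf_tpow0 d A B s : has_pair_mgf d 0 (tpow 0 A) (tpow 0 B) s 1.
Proof.
  do 4 eexists. split; [apply pair_spec_tpow0|].
  unfold ns_mgf, ns_mean, overlap, inner, llr, Cnorm2; simpl.
  replace (s * (ln 1 - ln 1)) with 0 by ring. rewrite exp_0. ring.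
Qed.

(** [tpow] iterates an operator on a single factor; here the repeated operator acts on [n] factors
    and may be entangled across them. *)
Fixpoint block_power (n : nat) (A : Op) (k : nat) : Op :=
  match k with O => tpow 0 A | S k' => tens n A (block_power n A k') end.

Lemma has_pair_mgf_block d n rho sigma s x k :
  has_pair_mgf d n (tpow n rho) sigma s x ->
  has_pair_mgf d (k * n) (tpow (k * n) rho) (block_power n sigma k) s (x ^ k).
Proof.
  intros H. induction k as [|k IH]; simpl.
  - exact (has_pair_mgf_tpow0 d rho rho s).
  - rewrite tpow_add. apply has_pair_mgf_tens; auto.
Qed.

(** Operators are functions on all words, so equality must also be checked at words of wrong length
    or alphabet, where [op_on] forces both sides to vanish. *)
Lemma tens_tpow0_r d n A B : op_on d n A -> tens n A (tpow 0 B) = A.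
Proof.
  intros HA. extensionality i; extensionality j. unfold tens.
  destruct (valid_dec d n i) as [Hi|Hi]; [destruct (valid_dec d n j) as [Hj|Hj]|].
  - apply validE in Hi, Hj. destruct Hi as [Hi _], Hj as [Hj _].
    rewrite (firstn_all2 i), (firstn_all2 j), (skipn_all2 i), (skipn_all2 j) by lia. simpl. ring.
  - rewrite (HA i j) by tauto. destruct (skipn n i) eqn:Ei, (skipn n j) eqn:Ej; simpl; try ring.
    rewrite (HA (firstn n i)); [ring|]. intros [_ H]. apply Hj. rewrite <- (firstn_skipn n j), Ej, app_nil_r; auto.
  - rewrite (HA i j) by tauto. destruct (skipn n i) eqn:Ei, (skipn n j) eqn:Ej; simpl; try ring.
    rewrite (HA (firstn n i)); [ring|]. intros [H _]. apply Hi. rewrite <- (firstn_skipn n i), Ei, app_nil_r; auto.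
Qed.

Lemma tpow_1 d A : op_on d 1 A -> tpow 1 A = A.
Proof. intros H. exact (tens_tpow0_r d 1 A A H). Qed.

Lemma psd_of_spec d n A lam e : op_on d n A -> hermitian A -> spec d n A lam e ->
  (forall j, valid d n j -> 0 <= lam j) -> psd d n A.
Proof.
  intros Ho Hh Hs Hl. apply psd_intro; auto. intros v. rewrite (spec_Qf d n A lam e) by auto.
  apply sumR_ge0; intros j Hj. apply words_valid in Hj. apply Rmult_le_pos; auto. apply Cnorm2_ge0.
Qed.

Lemma op_on_tens d n m A B : op_on d n A -> op_on d m B -> op_on d (n + m) (tens n A B).
Proof.
  intros HA HB i j H. unfold tens.
  destruct (valid_dec d n (firstn n i)), (valid_dec d n (firstn n j)); try (rewrite HA by tauto; ring).
  destruct (valid_dec d m (skipn n i)), (valid_dec d m (skipn n j)); try (rewrite HB by tauto; ring).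
  exfalso; apply H. rewrite <- (firstn_skipn n i), <- (firstn_skipn n j). split; apply valid_app; auto.
Qed.

Lemma tr_tens d n m A B : tr d (n + m) (tens n A B) = Cmul (tr d n A) (tr d m B).
Proof. unfold tr. rewrite <- sumC_words_prod. reflexivity. Qed.

Lemma density_tens d n m A B : density d n A -> density d m B -> density d (n + m) (tens n A B).
Proof.
  intros [HA TA] [HB TB]. split; [|rewrite tr_tens, TA, TB; ring].
  destruct (psd_spec_exists d n A HA) as (a & e & SA). destruct (psd_spec_exists d m B HB) as (b & f & SB).
  apply (psd_of_spec _ _ _ _ _) with (3 := spec_tens _ _ _ _ _ _ _ _ _ SA SB).
  - apply op_on_tens; [apply HA|apply HB].
  - intros i j. unfold tens. rewrite (psd_hermitian d n A HA (firstn n i)), (psd_hermitian d m B HB (skipn n i)), Cconj_mul. reflexivity.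
  - intros j Hj. apply Rmult_le_pos.
    apply (psd_eigen_ge0 d n A a e); eauto using firstn_valid.
    apply (psd_eigen_ge0 d m B b f); eauto using skipn_valid.
Qed.

Lemma density_tpow d n A : density d 1 A -> density d n (tpow n A).
Proof.
  intros H. induction n as [|n IH].
  - split; [|unfold tr; simpl; ceq]. apply (psd_of_spec _ _ _ _ _) with (3 := spec_tpow0 d A).
    + intros i j Hij. destruct i, j; simpl; auto. exfalso; apply Hij; split; reflexivity.
    + intros i j. destruct i, j; simpl; ceq.
    + intros; lra.
  - change (density d (1 + n) (tens 1 A (tpow n A))). apply density_tens; auto.
Qed.

(** Quantitative full rank: the least eigenvalue decays only exponentially, so minus its logarithm
    is O(n). This later bounds both the number of blocks and the likelihood ratio. *)
Lemma tpow_eigen_lower d A m n : 0 < m -> density d 1 A ->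
  (forall v, m * nrm2 d 1 v <= Qf d 1 A v) ->
  forall v, m ^ n * nrm2 d n v <= Qf d n (tpow n A) v.
Proof.
  intros Hm HA Hv.
  destruct (psd_spec_exists d 1 A) as (a & e & SA); [apply HA|].
  assert (Ha : forall j, valid d 1 j -> m <= a j).
  { intros j Hj. rewrite <- (spec_Qf_eigen d 1 A a e) by auto.
    eapply Rle_trans; [|apply Hv]. rewrite onb_nrm2; [lra| |auto]. eapply spec_onb; eauto. }
  assert (H : exists b f, spec d n (tpow n A) b f /\ forall j, valid d n j -> m ^ n <= b j).
  { induction n as [|n (b & f & Sb & Hb)].
    - do 2 eexists. split; [apply spec_tpow0|]. intros; simpl; lra.
    - do 2 eexists. split; [apply (spec_tens d 1 n _ _ _ _ _ _ SA Sb)|].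
      intros j Hj. simpl. unfold tens_val. apply Rmult_le_compat; try lra.
      left; apply pow_lt; auto.
      apply Ha, (firstn_valid d 1 n); auto. apply Hb, (skipn_valid d 1 n); auto. }
  destruct H as (b & f & Sb & Hb). intros v.
  rewrite (spec_Qf d n _ b f), (parseval d n f), <- sumR_mul_l by (auto; eapply spec_onb; eauto).
  apply sumR_le; intros j Hj. apply words_valid in Hj. apply Rmult_le_compat_r; auto. apply Cnorm2_ge0.
Qed.

Lemma list_lower_bound (l : list word) (g : word -> R) : (forall x, In x l -> 0 < g x) ->
  exists m, 0 < m /\ m <= 1 /\ forall x, In x l -> m <= g x.
Proof.
  induction l as [|a l IH]; intros H.
  - exists 1. split; [lra|split; [lra|]]. intros x [].
  - destruct IH as (m & Hm & Hm1 & Hl); [intros; apply H; right; auto|].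
    exists (Rmin m (g a)). split; [apply Rmin_glb_lt; auto; apply H; left; auto|].
    split; [eapply Rle_trans; [apply Rmin_l|auto]|].
    intros x [<-|Hx]; [apply Rmin_r|]. eapply Rle_trans; [apply Rmin_l|auto].
Qed.

Lemma full_rank_lower d n A : density d n A -> full_rank d n A ->
  exists m, 0 < m /\ m <= 1 /\ forall v, m * nrm2 d n v <= Qf d n A v.
Proof.
  intros HA HF. destruct (psd_spec_exists d n A) as (a & e & S); [apply HA|].
  pose proof (spec_onb _ _ _ _ _ S) as Oe.
  destruct (list_lower_bound (words d n) a) as (m & Hm & Hm1 & Hl).
  - intros k Hk. apply words_valid in Hk.
    assert (0 <= a k) by (eapply psd_eigen_ge0; eauto; apply HA).
    destruct (Req_dec (a k) 0) as [E|]; [|lra]. exfalso.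
    assert (Z : forall i, valid d n i -> e k i = C0).
    { apply HF. intros i Hi. rewrite (spec_eigen d n A a e) by auto. rewrite E. ceq. }
    pose proof (onb_nrm2 d n e k Oe Hk) as N. rewrite nrm2_sum in N.
    rewrite sumR_zero in N; [lra|]. intros i Hi. apply words_valid in Hi. rewrite Z by auto.
    unfold Cnorm2; simpl; ring.
  - exists m. split; [auto|split; [auto|]]. intros v.
    rewrite (spec_Qf d n A a e), (parseval d n e), <- sumR_mul_l by auto.
    apply sumR_le; intros k Hk. apply Rmult_le_compat_r; [apply Cnorm2_ge0|auto].
Qed.

Lemma pair_spec_full_rank d n rho sigma m : density d n rho -> density d n sigma -> 0 < m ->
  (forall v, m * nrm2 d n v <= Qf d n sigma v) ->
  exists lam e mu f, pair_spec d n rho sigma lam e mu f.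
Proof.
  intros Hr Hs Hm H.
  destruct (psd_spec_exists d n rho) as (lam & e & Sr); [apply Hr|].
  destruct (psd_spec_exists d n sigma) as (mu & f & Ss); [apply Hs|].
  assert (Hmu : forall k, valid d n k -> m <= mu k).
  { intros k Hk. rewrite <- (spec_Qf_eigen d n sigma mu f) by auto.
    eapply Rle_trans; [|apply H]. rewrite onb_nrm2; [lra| |auto]. eapply spec_onb; eauto. }
  exists lam, e, mu, f. constructor; auto.
  - intros; eapply (psd_eigen_ge0 d n rho); eauto; apply Hr.
  - intros k Hk; specialize (Hmu k Hk); lra.
  - apply (density_eigen_sum d n rho lam e); auto.
  - intros j k _ Hk _ E. specialize (Hmu k Hk). lra.
Qed.

(** * The regularised relative entropy and the strong converse *)

Lemma is_inf_exists (E : R -> Prop) (b : R) : (exists x, E x) -> (forall y, E y -> b <= y) ->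
  exists x, is_inf E x.
Proof.
  intros [x0 H0] Hb.
  destruct (completeness (fun y => E (- y))) as [s [Hs1 Hs2]].
  - exists (- b). intros y Hy. specialize (Hb _ Hy). lra.
  - exists (- x0). rewrite Ropp_involutive. auto.
  - exists (- s). split.
    + intros y Hy. assert (- y <= s) by (apply Hs1; rewrite Ropp_involutive; auto). lra.
    + intros z Hz. assert (s <= - z); [|lra]. apply Hs2. intros y Hy. specialize (Hz _ Hy). lra.
Qed.

Lemma is_inf_near (E : R -> Prop) x delta : is_inf E x -> 0 < delta -> exists y, E y /\ y < x + delta.
Proof.
  intros [H1 H2] Hd. destruct (classic (exists y, E y /\ y < x + delta)) as [H|H]; auto.
  exfalso. assert (x + delta <= x); [|lra]. apply H2. intros y Hy.
  destruct (Rle_dec (x + delta) y); auto. exfalso; apply H; exists y; split; auto; lra.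
Qed.

Lemma fekete (a : nat -> R) : (forall n, 0 <= a n) -> (forall n m, a (n + m)%nat <= a n + a m) ->
  exists L, Un_cv (fun n => a n / INR n) L /\ 0 <= L /\
    forall n, (1 <= n)%nat -> INR n * L <= a n.
Proof.
  intros Ha Hsub.
  destruct (is_inf_exists (fun x => exists n, (1 <= n)%nat /\ x = a n / INR n) 0) as [L HL].
  - exists (a 1%nat / INR 1), 1%nat. split; auto.
  - intros y (n & Hn & ->). apply Rmult_le_pos; auto. left. apply Rinv_0_lt_compat, lt_0_INR; lia.
  - exists L. pose proof HL as [HL1 HL2].
    assert (L0 : 0 <= L).
    { apply HL2. intros y (n & Hn & ->). apply Rmult_le_pos; auto. left. apply Rinv_0_lt_compat, lt_0_INR; lia. }
    assert (Hlow : forall n, (1 <= n)%nat -> INR n * L <= a n).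
    { intros n Hn. assert (0 < INR n) by (apply lt_0_INR; lia).
      assert (L <= a n / INR n) by (apply HL1; eauto).
      apply Rmult_le_compat_l with (r := INR n) in H0; [|lra].
      replace (INR n * (a n / INR n)) with (a n) in H0 by (field; lra). auto. }
    split; [|split]; auto.
    intros eps Heps.
    destruct (is_inf_near _ L (eps / 2) HL) as (y & (n0 & Hn0 & ->) & Hy); [lra|].
    assert (Hp0 : 0 < INR n0) by (apply lt_0_INR; lia).
    assert (Hmul : forall k, a (k * n0)%nat <= INR k * a n0 + a 0%nat).
    { induction k as [|k IH]; [simpl; lra|]. rewrite S_INR. simpl.
      specialize (Hsub n0 (k * n0)%nat). lra. }
    assert (Hone : forall r, a r <= INR r * a 1%nat + a 0%nat).
    { induction r as [|r IH]; [simpl; lra|]. rewrite S_INR.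
      specialize (Hsub 1%nat r). simpl in Hsub. lra. }
    (* With [n = k * n0 + r], the constant absorbs the remainder [r < n0] and the starting value
       [a 0] of each of the two inductions, which subadditivity does not force to vanish. *)
    set (B := INR n0 * a 1%nat + 2 * a 0%nat).
    destruct (INR_unbounded (2 * B / eps)) as [N HN].
    exists (S N). intros n Hn. assert (HnN : INR N <= INR n) by (apply le_INR; lia).
    assert (Hpn : 0 < INR n) by (apply lt_0_INR; lia).
    assert (E : (n = (n / n0) * n0 + n mod n0)%nat).
    { rewrite Nat.mul_comm. apply Nat.div_mod; lia. }
    assert (Hr : (n mod n0 < n0)%nat) by (apply Nat.mod_upper_bound; lia).
    set (k := (n / n0)%nat) in *. set (r := (n mod n0)%nat) in *.
    assert (Hup : a n <= INR k * a n0 + B).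
    { rewrite E. specialize (Hsub (k * n0)%nat r). specialize (Hmul k). specialize (Hone r).
      assert (INR r * a 1%nat <= INR n0 * a 1%nat).
      { apply Rmult_le_compat_r; auto. apply le_INR; lia. }
      unfold B. lra. }
    assert (Hkn : INR k * INR n0 <= INR n).
    { rewrite <- mult_INR. apply le_INR. lia. }
    assert (Hk : INR k * a n0 <= INR n * (L + eps / 2)).
    { replace (INR k * a n0) with (INR k * INR n0 * (a n0 / INR n0)) by (field; lra).
      apply Rmult_le_compat; try lra.
      - apply Rmult_le_pos; apply pos_INR.
      - apply Rmult_le_pos; auto. left; apply Rinv_0_lt_compat; auto. }
    assert (HB : B < INR n * (eps / 2)).
    { apply Rlt_le_trans with (INR N * (eps / 2)); [|apply Rmult_le_compat_r; lra].
      apply Rmult_lt_reg_r with (2 / eps); [apply Rdiv_lt_0_compat; lra|].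
      replace (INR N * (eps / 2) * (2 / eps)) with (INR N) by (field; lra).
      replace (B * (2 / eps)) with (2 * B / eps) by (field; lra). auto. }
    specialize (Hlow n ltac:(lia)).
    unfold R_dist. apply Rabs_def1.
    + apply Rmult_lt_reg_l with (INR n); auto.
      replace (INR n * (a n / INR n - L)) with (a n - INR n * L) by (field; lra). lra.
    + apply Rmult_lt_reg_l with (INR n); auto.
      replace (INR n * (a n / INR n - L)) with (a n - INR n * L) by (field; lra).
      assert (0 < INR n * eps) by (apply Rmult_lt_0_compat; auto). lra.
Qed.

Lemma exp_decay b eps : 0 < b -> 0 < eps -> exists N : nat, forall n, (N <= n)%nat -> exp (- (INR n * b)) < eps.
Proof.
  intros Hb He. destruct (INR_unbounded (/ (b * eps))) as [N HN].
  exists N. intros n Hn. assert (INR N <= INR n) by (apply le_INR; auto).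
  rewrite exp_Ropp.
  assert (0 < b * eps) by (apply Rmult_lt_0_compat; auto).
  assert (0 < / (b * eps)) by (apply Rinv_0_lt_compat; auto).
  assert (H2 : / eps < INR n * b).
  { apply Rmult_lt_reg_r with (/ b); [apply Rinv_0_lt_compat; auto|].
    replace (INR n * b * / b) with (INR n) by (field; lra).
    rewrite <- Rinv_mult. rewrite (Rmult_comm eps). lra. }
  pose proof (exp_ineq1_le (INR n * b)).
  rewrite <- (Rinv_inv eps). apply Rinv_lt_contravar; [|lra].
  apply Rmult_lt_0_compat; [apply Rinv_0_lt_compat; auto|apply exp_pos].
Qed.

Lemma exp_pow x k : exp x ^ k = exp (x * INR k).
Proof.
  induction k as [|k IH]; [simpl; rewrite Rmult_0_r, exp_0; auto|].
  simpl pow. rewrite IH, <- exp_plus, S_INR. f_equal. ring.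
Qed.

(** * Relative entropy to a family and its regularisation *)

Section Family.
Context (d : nat) (M : Family) (rho : Op).
Context (HM : P_props d M) (Hrho : density d 1 rho).

Lemma M_density n A : M n A -> density d n A.
Proof. apply HM. Qed.
Lemma M_convex n A B t : M n A -> M n B -> 0 <= t <= 1 ->
  M n (addop (scaleop t A) (scaleop (1 - t) B)).
Proof. apply HM. Qed.
Lemma M_tens n m A B : M n A -> M m B -> M (n + m)%nat (tens n A B).
Proof. apply HM. Qed.
Lemma M_full : exists sigma m, density d 1 sigma /\ 0 < m <= 1 /\
  (forall v, m * nrm2 d 1 v <= Qf d 1 sigma v) /\ forall n, M n (tpow n sigma).
Proof.
  destruct HM as (_ & _ & _ & (sigma & H1 & H2 & H3) & _).
  destruct (full_rank_lower d 1 sigma H1 H2) as (m & Hm & Hm1 & Hv).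
  exists sigma, m. auto.
Qed.
Lemma M_block n A k : M n A -> M (k * n)%nat (block_power n A k).
Proof.
  intros H. induction k as [|k IH]; simpl; [|apply M_tens; auto].
  destruct M_full as (sigma & m & _ & _ & _ & Hs). exact (Hs 0%nat).
Qed.

(** [E_M] is a choice term and means something only once the infimum exists: the full-rank product
    states provide a finite value, and Gibbs' inequality a lower bound. *)
Lemma E_M_is_inf n :
  is_inf (fun x => exists sigma, M n sigma /\ relent_is d n (tpow n rho) sigma (Some x))
    (E_M M d n (tpow n rho)).
Proof.
  unfold E_M. apply epsilon_spec. pose proof ln2_pos. apply is_inf_exists with 0.
  - destruct M_full as (sigma & m & Hs & Hm & Hv & HMs).
    destruct (pair_spec_full_rank d n (tpow n rho) (tpow n sigma) (m ^ n)) as (lam & e & mu & f & P).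
    + apply density_tpow; auto.
    + apply density_tpow; auto.
    + apply pow_lt; lra.
    + apply tpow_eigen_lower; auto; lra.
    + eexists; exists (tpow n sigma). split; auto. eapply pair_spec_relent; eauto.
  - intros y (sigma & Hs & Hy). pose proof (M_density _ _ Hs) as Ds.
    destruct (relent_pair_spec _ _ _ _ _ (density_tpow d n rho Hrho) Ds Hy) as (lam & e & mu & f & P & E).
    assert (0 <= y * ln 2); [|nra]. rewrite E. eapply ns_entropy_ge0; eauto.
    right. eapply density_eigen_sum; eauto. apply (ps_sigma _ _ _ _ _ _ _ _ P).
Qed.

Lemma E_M_pair n delta : 0 < delta -> exists sigma lam e mu f, M n sigma /\
  pair_spec d n (tpow n rho) sigma lam e mu f /\
  ns_entropy d n lam e mu f < (E_M M d n (tpow n rho) + delta) * ln 2.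
Proof.
  intros Hd. pose proof ln2_pos.
  destruct (is_inf_near _ _ delta (E_M_is_inf n) Hd) as (y & (sigma & Hs & Hy) & Hlt).
  destruct (relent_pair_spec _ _ _ _ _ (density_tpow d n rho Hrho) (M_density _ _ Hs) Hy)
    as (lam & e & mu & f & P & E).
  exists sigma, lam, e, mu, f. split; [auto|split; [auto|]]. rewrite <- E.
  apply Rmult_lt_compat_r; auto.
Qed.

Lemma E_M_le n sigma lam e mu f : M n sigma -> pair_spec d n (tpow n rho) sigma lam e mu f ->
  E_M M d n (tpow n rho) * ln 2 <= ns_entropy d n lam e mu f.
Proof.
  intros Hs P. pose proof ln2_pos. destruct (E_M_is_inf n) as [H1 _].
  assert (E_M M d n (tpow n rho) <= ns_entropy d n lam e mu f / ln 2).
  { apply H1. exists sigma. split; auto. eapply pair_spec_relent; eauto. }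
  apply Rmult_le_compat_r with (r := ln 2) in H0; [|lra].
  unfold Rdiv in H0. rewrite Rmult_assoc, Rinv_l, Rmult_1_r in H0; lra.
Qed.

Lemma E_M_ge0 n : 0 <= E_M M d n (tpow n rho).
Proof.
  destruct (E_M_is_inf n) as [_ H2]. apply H2. intros y (sigma & Hs & Hy). pose proof ln2_pos.
  destruct (relent_pair_spec _ _ _ _ _ (density_tpow d n rho Hrho) (M_density _ _ Hs) Hy)
    as (lam & e & mu & f & P & E).
  assert (0 <= y * ln 2); [|nra]. rewrite E. eapply ns_entropy_ge0; eauto.
  right. eapply density_eigen_sum; [apply (M_density _ _ Hs)|apply (ps_sigma _ _ _ _ _ _ _ _ P)].
Qed.

Lemma E_M_subadditive n m :
  E_M M d (n + m) (tpow (n + m) rho) <= E_M M d n (tpow n rho) + E_M M d m (tpow m rho).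
Proof.
  pose proof ln2_pos. apply Rmult_le_reg_r with (ln 2); auto.
  apply le_epsilon. intros eps He. set (delta := eps / (2 * ln 2)).
  assert (Hd : 0 < delta) by (apply Rdiv_lt_0_compat; lra).
  destruct (E_M_pair n delta Hd) as (s1 & l1 & e1 & m1 & f1 & M1 & P1 & H1).
  destruct (E_M_pair m delta Hd) as (s2 & l2 & e2 & m2 & f2 & M2 & P2 & H2).
  pose proof (pair_spec_tens _ _ _ _ _ _ _ _ _ _ _ _ _ _ _ P1 P2) as P.
  rewrite <- tpow_add in P.
  pose proof (E_M_le _ _ _ _ _ _ (M_tens _ _ _ _ M1 M2) P) as H3.
  rewrite (ns_entropy_tens _ _ _ _ _ _ _ _ _ _ _ _ _ _ _ P1 P2) in H3.
  assert (delta * ln 2 * 2 = eps) by (unfold delta; field; lra). lra.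
Qed.

Lemma E_inf_spec : Un_cv (fun n => E_M M d n (tpow n rho) / INR n) (E_inf M d rho) /\
  0 <= E_inf M d rho /\
  forall n, (1 <= n)%nat -> INR n * E_inf M d rho <= E_M M d n (tpow n rho).
Proof.
  destruct (fekete (fun n => E_M M d n (tpow n rho))) as (L & HL & HL0 & HL1).
  - apply E_M_ge0.
  - apply E_M_subadditive.
  - assert (H : Un_cv (fun n => E_M M d n (tpow n rho) / INR n) (E_inf M d rho)).
    { unfold E_inf. apply epsilon_spec. exists L; auto. }
    rewrite (UL_sequence _ _ _ H HL). rewrite (UL_sequence _ _ _ H HL) in H. auto.
Qed.

(** The [L] of the overview; [E_inf] itself is in bits. *)
Notation Einf := (E_inf M d rho * ln 2).

Lemma Einf_ge0 : 0 <= Einf.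
Proof. pose proof ln2_pos. destruct E_inf_spec as (_ & H0 & _). apply Rmult_le_pos; lra. Qed.

Lemma Einf_lower n sigma lam e mu f : (1 <= n)%nat -> M n sigma ->
  pair_spec d n (tpow n rho) sigma lam e mu f ->
  INR n * Einf <= ns_entropy d n lam e mu f.
Proof.
  intros Hn Hs P. pose proof ln2_pos. eapply Rle_trans; [|eapply E_M_le; eauto].
  destruct E_inf_spec as (_ & _ & H1). specialize (H1 n Hn).
  rewrite <- Rmult_assoc. apply Rmult_le_compat_r; lra.
Qed.

Lemma Einf_near delta : 0 < delta -> exists n sigma lam e mu f, (1 <= n)%nat /\ M n sigma /\
  pair_spec d n (tpow n rho) sigma lam e mu f /\
  ns_entropy d n lam e mu f <= INR n * (Einf + delta).
Proof.
  intros Hd. pose proof ln2_pos.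
  destruct E_inf_spec as (Hcv & _ & _). destruct (Hcv (delta / (2 * ln 2))) as [N HN].
  { apply Rdiv_lt_0_compat; lra. }
  specialize (HN (S N) ltac:(lia)). set (n := S N) in *.
  assert (Hn : 0 < INR n) by (apply lt_0_INR; unfold n; lia).
  assert (Hd' : 0 < INR n * (delta / (2 * ln 2))).
  { apply Rmult_lt_0_compat; auto. apply Rdiv_lt_0_compat; lra. }
  destruct (E_M_pair n _ Hd') as (sigma & lam & e & mu & f & Ms & P & Hlt).
  exists n, sigma, lam, e, mu, f. split; [unfold n; lia|]. split; [auto|split; [auto|]].
  apply Rabs_def2 in HN. destruct HN as [HN _].
  apply Rmult_lt_compat_l with (r := INR n) in HN; auto.
  replace (INR n * (E_M M d n (tpow n rho) / INR n - E_inf M d rho))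
    with (E_M M d n (tpow n rho) - INR n * E_inf M d rho) in HN by (field; lra).
  left. eapply Rlt_le_trans; [exact Hlt|].
  apply Rle_trans with ((INR n * E_inf M d rho + 2 * (INR n * (delta / (2 * ln 2)))) * ln 2).
  - apply Rmult_le_compat_r; lra.
  - right. field. lra.
Qed.

(** The states [om n] are fixed before [K] and [tau], and [N] does not depend on the test. The
    direct part needs this: it mixes [om n] into another state, which costs a constant [K], and then
    applies the bound to a test built from that mixture. *)
Lemma strong_converse_core eps : 0 < eps -> exists om, (forall n, M n (om n)) /\
  forall K tau, 0 < tau -> 0 <= K -> exists N, forall n T, (N <= n)%nat -> povm_elem d n T ->
    Cre (tr d n (mulop d n T (om n))) <= K * exp (- (INR n * (Einf + eps))) ->
    1 - tau <= Cre (tr d n (mulop d n (subop (idop d n) T) (tpow n rho))).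
Proof.
  (* Rates are spaced by [delta]: the moment generating function grows with [Einf + 2 * delta], the
     threshold [a] uses [Einf + 3 * delta], and the test has [Einf + 4 * delta = Einf + eps]. Each
     gap yields exponential decay. *)
  intros He. set (delta := eps / 4). assert (Hd : 0 < delta) by (unfold delta; lra).
  destruct (Einf_near delta Hd) as (n0 & s0 & l0 & e0 & m0 & f0 & Hn0 & Ms0 & P0 & H0).
  assert (Hp0 : 0 < INR n0) by (apply lt_0_INR; lia).
  destruct (ns_mgf_bound _ _ _ _ _ _ _ _ P0 (INR n0 * delta)) as (s & Hs & Hmgf).
  { apply Rmult_lt_0_compat; auto. }
  destruct M_full as (sg & m & Dsg & Hm & Hv & HMs).
  destruct (pair_spec_full_rank d 1 (tpow 1 rho) sg m) as (l1 & e1 & m1 & f1 & P1); auto; try lra.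
  { apply density_tpow; auto. }
  set (x0 := ns_mgf d n0 l0 e0 m0 f0 s) in *. set (x1 := ns_mgf d 1 l1 e1 m1 f1 s).
  assert (Hsg : M 1%nat sg).
  { specialize (HMs 1%nat). rewrite (tpow_1 d) in HMs; auto. apply Dsg. }
  assert (Hmgf0 : has_pair_mgf d n0 (tpow n0 rho) s0 s x0) by (do 4 eexists; split; [exact P0|reflexivity]).
  assert (Hmgf1 : has_pair_mgf d 1 (tpow 1 rho) sg s x1) by (do 4 eexists; split; [exact P1|reflexivity]).
  assert (Hm_ge0 : forall n rho' sigma' lam e mu f, pair_spec d n rho' sigma' lam e mu f ->
     0 <= ns_mgf d n lam e mu f s).
  { intros n r' sg' lam e mu f P. apply sumR_ge0; intros j Hj. apply sumR_ge0; intros k _.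
    apply words_valid in Hj. apply Rmult_le_pos; [|left; apply exp_pos].
    eapply ns_weight_ge0; eauto. }
  assert (Hx0 : 0 <= x0) by (eapply Hm_ge0; exact P0).
  assert (Hx1 : 0 <= x1) by (eapply Hm_ge0; exact P1).
  (* Fewer than [n0] factors are left over by the blocks of length [n0]. They are filled with the
     full-rank state [sg], which multiplies the moment generating function by at most [B], uniformly
     in [n]. *)
  set (B := (1 + x1) ^ n0).
  assert (HB : 0 < B) by (apply pow_lt; lra).
  set (om := fun n => tens ((n / n0) * n0) (block_power n0 s0 (n / n0)) (block_power 1 sg (n mod n0))).
  assert (En : forall n, ((n / n0) * n0 + (n mod n0) * 1 = n)%nat).
  { intros n. rewrite Nat.mul_1_r, Nat.mul_comm. symmetry. apply Nat.div_mod; lia. }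
  assert (Hom : forall n, M n (om n)).
  { intros n. rewrite <- (En n) at 1. unfold om. apply M_tens.
    - apply M_block; auto.
    - apply M_block; auto. }
  exists om. split; auto. pose proof Einf_ge0 as HE0.
  assert (Hmgfn : forall n, exists y, has_pair_mgf d n (tpow n rho) (om n) s y /\
     y <= exp (s * (INR n * (Einf + 2 * delta))) * B).
  { intros n. exists (x0 ^ (n / n0) * x1 ^ (n mod n0)). split.
    - pose proof (has_pair_mgf_block _ _ _ _ _ _ (n / n0) Hmgf0) as A1.
      pose proof (has_pair_mgf_block _ _ _ _ _ _ (n mod n0) Hmgf1) as A2.
      pose proof (has_pair_mgf_tens _ _ _ _ _ _ _ _ _ _ A1 A2) as A3.
      rewrite <- tpow_add, En in A3. exact A3.
    - apply Rmult_le_compat; try (apply pow_le; auto).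
      + apply Rle_trans with (exp (s * (INR n0 * (Einf + 2 * delta))) ^ (n / n0)).
        * apply pow_incr. split; auto. eapply Rle_trans; [exact Hmgf|]. 
          assert (HH : s * (ns_entropy d n0 l0 e0 m0 f0 + INR n0 * delta) <= s * (INR n0 * (Einf + 2 * delta))).
          { apply Rmult_le_compat_l; lra. }
          destruct HH as [HH|HH]; [left; apply exp_increasing; auto|rewrite HH; lra].
        * rewrite exp_pow.
          assert (HH : s * (INR n0 * (Einf + 2 * delta)) * INR (n / n0) <= s * (INR n * (Einf + 2 * delta))).
          { rewrite Rmult_assoc. apply Rmult_le_compat_l; [lra|].
            replace (INR n0 * (Einf + 2 * delta) * INR (n / n0)) with (INR (n / n0) * INR n0 * (Einf + 2 * delta)) by ring.
            apply Rmult_le_compat_r; [lra|]. rewrite <- mult_INR. apply le_INR. specialize (En n). lia. }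
          destruct HH as [HH|HH]; [left; apply exp_increasing; auto|rewrite HH; lra].
      + apply Rle_trans with ((1 + x1) ^ (n mod n0)).
        * apply pow_incr; lra.
        * apply Rle_pow; [lra|]. apply Nat.lt_le_incl, Nat.mod_upper_bound. lia. }
  intros K tau Ht HK.
  (* One [t] goes to the tail, one to the type-II term, and [t] is also the weight of
     [Cnorm2_add_le]: [1 - 2 * t <= (1 + t) * Z] implies [1 - 3 * t <= Z]. *)
  set (t := tau / 3). assert (Htp : 0 < t) by (unfold t; lra).
  assert (Hit : 0 < / t) by (apply Rinv_0_lt_compat; auto).
  destruct (exp_decay (s * delta) (t / B)) as [N1 HN1]; [apply Rmult_lt_0_compat; auto|apply Rdiv_lt_0_compat; auto|].
  assert (HKK : 0 < (1 + / t) * K + 1) by nra.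
  destruct (exp_decay delta (t / ((1 + / t) * K + 1))) as [N2 HN2]; auto; [apply Rdiv_lt_0_compat; auto|].
  exists (Nat.max N1 N2). intros n T Hn HT Htr.
  specialize (HN1 n ltac:(lia)). specialize (HN2 n ltac:(lia)).
  destruct (Hmgfn n) as (y & (lam & e & mu & f & P & Hy) & Hyb).
  set (a := INR n * (Einf + 3 * delta)).
  pose proof (ns_tail _ _ _ _ _ _ _ _ P s a Hs) as Htail. rewrite Hy in Htail.
  pose proof (test_errors_lower_bound d n (tpow n rho) (om n) lam e mu f T (exp a) t) as Herr.
  specialize (Herr ltac:(apply density_tpow; auto) ltac:(apply M_density; auto) (ps_rho _ _ _ _ _ _ _ _ P)
    (ps_sigma _ _ _ _ _ _ _ _ P) HT ltac:(left; apply exp_pos) Htp).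
  set (Z := Cre (tr d n (mulop d n (subop (idop d n) T) (tpow n rho)))) in *.
  set (Q := Cre (tr d n (mulop d n T (om n)))) in *.
  assert (A1 : exp (- (s * a)) * y <= t).
  { apply Rle_trans with (exp (- (s * a)) * (exp (s * (INR n * (Einf + 2 * delta))) * B)).
    - apply Rmult_le_compat_l; [left; apply exp_pos|auto].
    - rewrite <- Rmult_assoc, <- exp_plus.
      replace (- (s * a) + s * (INR n * (Einf + 2 * delta))) with (- (INR n * (s * delta))) by (unfold a; ring).
      apply Rmult_lt_compat_r with (r := B) in HN1; auto.
      unfold Rdiv in HN1. rewrite Rmult_assoc, Rinv_l, Rmult_1_r in HN1; lra. }
  assert (A2 : (1 + / t) * (exp a * Q) <= t).
  { apply Rle_trans with ((1 + / t) * (exp a * (K * exp (- (INR n * (Einf + eps)))))).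
    - apply Rmult_le_compat_l; [lra|]. apply Rmult_le_compat_l; [left; apply exp_pos|auto].
    - replace (exp a * (K * exp (- (INR n * (Einf + eps))))) with (K * (exp a * exp (- (INR n * (Einf + eps))))) by ring.
      rewrite <- exp_plus.
      replace (a + - (INR n * (Einf + eps))) with (- (INR n * delta)) by (unfold a, delta; field).
      set (E := exp (- (INR n * delta))) in *. assert (0 < E) by apply exp_pos.
      apply Rmult_lt_compat_r with (r := (1 + / t) * K + 1) in HN2; auto.
      unfold Rdiv in HN2. rewrite Rmult_assoc, Rinv_l, Rmult_1_r in HN2 by lra. lra. }
  assert (A3 : 1 - 2 * t <= (1 + t) * Z) by lra.
  assert (A4 : 1 - 3 * t <= Z).
  { apply Rmult_le_reg_l with (1 + t); [lra|]. assert (0 <= t * t) by apply Rle_0_sqr. lra. }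
  unfold t in A4. lra.
Qed.
End Family.

(** * Pinching *)

Definition nat_floor (x : R) : nat := Z.to_nat (Int_part x).
Lemma nat_floor_spec x : 0 <= x -> INR (nat_floor x) <= x < INR (nat_floor x) + 1.
Proof.
  intros Hx. destruct (base_Int_part x) as [H1 H2]. unfold nat_floor.
  assert (0 <= Int_part x)%Z.
  { assert (-1 < Int_part x)%Z; [|lia]. apply lt_IZR. lra. }
  rewrite INR_IZR_INZ, Z2Nat.id by auto. lra.
Qed.

(** * A basis adapted to the blocks *)

Section BlockBasis.
Context (d n : nat) (rho : Op) (Hrho : density d n rho) (f : word -> Vec) (Hf : onb d n f)
  (l : word -> nat).
Notation W := (words d n).

(** The vector with coordinates [x] in the basis [f]. In coordinates, lying in a block is merely a
    condition on which entries vanish. *)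
Definition lift (x : Vec) : Vec := fun i => sumC W (fun p => Cmul (x p) (f p i)).

Lemma inner_lift_r u x : inner d n u (lift x) = sumC W (fun p => Cmul (x p) (inner d n u (f p))).
Proof.
  unfold lift. rewrite (inner_sum_r d n W u (fun p i => Cmul (x p) (f p i))).
  apply sumC_ext; intros. apply inner_mul_r.
Qed.
Lemma inner_basis_lift i x : valid d n i -> inner d n (f i) (lift x) = x i.
Proof.
  intros Hi. rewrite inner_lift_r.
  rewrite (sumC_ext _ _ (fun p => Cmul (if eqw i p then C1 else C0) (x p))).
  - apply sumC_delta; [apply words_NoDup|apply words_valid; auto].
  - intros p Hp. apply words_valid in Hp. rewrite Hf by auto. ring.
Qed.
Lemma inner_lift x y : inner d n (lift x) (lift y) = inner d n x y.
Proof.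
  rewrite inner_lift_r. unfold inner at 2. apply sumC_ext; intros p Hp. apply words_valid in Hp.
  rewrite <- (inner_sym d n (f p)), inner_basis_lift by auto. ring.
Qed.

Definition coord (i i' : word) : C := inner d n (f i) (apply d n rho (f i')).

Lemma inner_apply_lift x y : inner d n (lift x) (apply d n rho (lift y)) =
  sumC W (fun p => Cmul (Cconj (x p)) (sumC W (fun p' => Cmul (coord p p') (y p')))).
Proof.
  rewrite <- (inner_sym d n). rewrite inner_lift_r, sumC_conj. apply sumC_ext; intros p _.
  rewrite Cconj_mul, inner_sym. f_equal.
  rewrite (inner_ext d n (f p) (f p) _ (fun i => sumC W (fun p' => Cmul (y p') (apply d n rho (f p') i)))); auto.
  - rewrite (inner_sum_r d n W (f p) (fun p' i => Cmul (y p') (apply d n rho (f p') i))).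
    apply sumC_ext; intros p' _. rewrite inner_mul_r. unfold coord. ring.
  - intros i _. unfold lift. rewrite (apply_sum d n rho W (fun p' i => Cmul (y p') (f p' i))).
    apply sumC_ext; intros. apply apply_mul.
Qed.

(* The pinched state in the basis [f], plus a term whose gaps exceed its norm,
   so that every eigenvector lies in a single block. *)
Definition pinch : Op := fun i i' =>
  Cadd (if Nat.eqb (l i) (l i') then coord i i' else C0)
       (Cmul (if eqw i i' then C1 else C0) (RtoC (3 * INR (l i)))).

Lemma pinch_hermitian : hermitian pinch.
Proof.
  intros i j. unfold pinch. rewrite Cconj_add, (Nat.eqb_sym (l j)).
  assert (E : coord j i = Cconj (coord i j)).
  { unfold coord. rewrite inner_sym, apply_adjoint; auto. apply (psd_hermitian d n). apply Hrho. }
  f_equal.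
  - destruct (Nat.eqb (l i) (l j)); [auto|ceq].
  - destruct (eqw j i), (eqw i j); try congruence; subst; ceq.
Qed.

Definition in_block (b : nat) (x : Vec) : Prop := forall p, valid d n p -> x p = C0 \/ l p = b.

Lemma pinch_in_block b x y : in_block b x -> in_block b y ->
  inner d n x (apply d n pinch y) =
  Cadd (inner d n (lift x) (apply d n rho (lift y))) (Cmul (RtoC (3 * INR b)) (inner d n x y)).
Proof.
  intros Hx Hy. rewrite inner_apply_lift. unfold inner, apply.
  rewrite <- sumC_mul_l, <- sumC_add. apply sumC_ext; intros p Hp.
  pose proof Hp as Hp'. apply words_valid in Hp'.
  destruct (Hx p Hp') as [E|E]; [rewrite E; ceq|].
  rewrite (sumC_ext _ (fun j => Cmul (pinch p j) (y j)) (fun j => Cadd (Cmul (coord p j) (y j))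
     (Cmul (if eqw p j then C1 else C0) (Cmul (RtoC (3 * INR b)) (y j))))).
  - rewrite sumC_add, (sumC_delta W p (fun j => Cmul (RtoC (3 * INR b)) (y j))); auto; [ring|apply words_NoDup].
  - intros j Hj. apply words_valid in Hj. destruct (Hy j Hj) as [E'|E']; [rewrite E'; ring|].
    unfold pinch. rewrite E, E', Nat.eqb_refl. ring.
Qed.

Definition block_part (b : nat) (x : Vec) : Vec := fun p => if Nat.eqb (l p) b then x p else C0.

Lemma block_part_in_block b x : in_block b (block_part b x).
Proof.
  intros p _. unfold block_part. destruct (Nat.eqb_spec (l p) b); auto.
Qed.

Lemma pinch_block_part b x p : valid d n p ->
  apply d n pinch (block_part b x) p = block_part b (apply d n pinch x) p.
Proof.
  intros Hp. unfold block_part at 2, apply. destruct (Nat.eqb_spec (l p) b) as [E|E].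
  - apply sumC_ext; intros j _. unfold block_part. destruct (Nat.eqb_spec (l j) b) as [E'|E']; auto.
    unfold pinch. destruct (Nat.eqb_spec (l p) (l j)); [congruence|].
    destruct (eqw p j); [congruence|ring].
  - apply sumC_zero; intros j _. unfold block_part. destruct (Nat.eqb_spec (l j) b) as [E'|E']; [|ring].
    unfold pinch. destruct (Nat.eqb_spec (l p) (l j)); [congruence|].
    destruct (eqw p j); [congruence|ring].
Qed.

(** The part of [u] in the block of [i] is again an eigenvector. On that block [pinch] is a
    compression of [rho], with spectrum in [[0, 1]], shifted by [3 * INR (l i)]. These intervals are
    disjoint for different labels, so an eigenvector cannot meet two blocks. *)
Lemma pinch_eigenvalue h u i : (forall p, valid d n p -> apply d n pinch u p = Cmul (RtoC h) (u p)) ->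
  valid d n i -> u i <> C0 -> 3 * INR (l i) <= h <= 3 * INR (l i) + 1.
Proof.
  intros Hu Hi Hne. set (b := l i). set (x := block_part b u).
  assert (E : inner d n x (apply d n pinch x) = Cmul (RtoC h) (inner d n x x)).
  { rewrite <- inner_mul_r. apply inner_ext; auto. intros p Hp. unfold x. rewrite pinch_block_part by auto.
    unfold block_part. destruct (Nat.eqb (l p) b); [auto|ring]. }
  rewrite (pinch_in_block b) in E by apply block_part_in_block.
  apply (f_equal Cre) in E. simpl in E.
  assert (Hn : 0 < nrm2 d n x).
  { assert (0 <= nrm2 d n x) by apply nrm2_ge0. destruct (Req_dec (nrm2 d n x) 0) as [Z|]; [|lra].
    exfalso; apply Hne. apply (nrm2_eq0 _ _ _ i) in Z; auto. unfold x, block_part, b in Z.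
    rewrite Nat.eqb_refl in Z; auto. }
  assert (H1 : 0 <= Qf d n rho (lift x)) by (apply psd_Qf; apply Hrho).
  assert (H2 : Qf d n rho (lift x) <= nrm2 d n x).
  { eapply Rle_trans; [apply density_Qf_le; auto|]. unfold nrm2. rewrite inner_lift. lra. }
  unfold Qf in H1, H2. unfold nrm2 in *. 
  split; apply Rmult_le_reg_r with (Cre (inner d n x x)); auto; nra.
Qed.

(** Diagonalising the shifted operator [pinch] once sorts its eigenvectors into blocks by
    themselves, which avoids a spectral theorem on subspaces of varying dimension. That each [lb k]
    is a value of [l] is what later bounds the labels. *)
Lemma block_basis : exists (g : word -> Vec) (lb : word -> nat), onb d n g /\
  (forall k i, valid d n k -> valid d n i -> inner d n (f i) (g k) = C0 \/ l i = lb k) /\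
  (forall k, valid d n k -> exists i, valid d n i /\ l i = lb k) /\
  (forall k k', valid d n k -> valid d n k' -> k <> k' -> lb k = lb k' ->
     inner d n (g k) (apply d n rho (g k')) = C0).
Proof.
  destruct (spectral_theorem d n pinch pinch_hermitian) as (h & u & Hs).
  pose proof (spec_onb _ _ _ _ _ Hs) as Hu.
  set (Lab := fun k b => exists i, valid d n i /\ u k i <> C0 /\ l i = b).
  set (lb := fun k => epsilon (inhabits 0%nat) (Lab k)).
  assert (Hlb : forall k, valid d n k -> Lab k (lb k)).
  { intros k Hk. apply epsilon_spec.
    destruct (classic (exists i, valid d n i /\ u k i <> C0)) as [(i & Hi & Hne)|H].
    - exists (l i), i. auto.
    - exfalso. pose proof (onb_nrm2 d n u k Hu Hk) as N. rewrite nrm2_sum, sumR_zero in N; [lra|].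
      intros i Hi. apply words_valid in Hi. destruct (classic (u k i = C0)) as [E|E].
      + rewrite E. unfold Cnorm2; simpl; ring.
      + exfalso; apply H; eauto. }
  assert (Hblk : forall k, valid d n k -> in_block (lb k) (u k)).
  { intros k Hk p Hp. destruct (classic (u k p = C0)) as [E|E]; auto. right.
    destruct (Hlb k Hk) as (i & Hi & Hne & <-).
    pose proof (pinch_eigenvalue (h k) (u k) i (spec_eigen _ _ _ _ _ _ Hs Hk) Hi Hne).
    pose proof (pinch_eigenvalue (h k) (u k) p (spec_eigen _ _ _ _ _ _ Hs Hk) Hp E).
    destruct (Nat.lt_total (l p) (l i)) as [L|[L|L]]; auto; exfalso;
      apply le_INR in L; rewrite S_INR in L; lra. }
  exists (fun k => lift (u k)), lb. split; [|split; [|split]].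
  - intros j k Hj Hk. rewrite inner_lift. apply Hu; auto.
  - intros k i Hk Hi. rewrite inner_basis_lift by auto. apply Hblk; auto.
  - intros k Hk. destruct (Hlb k Hk) as (i & Hi & _ & E). eauto.
  - intros k k' Hk Hk' Hne E.
    pose proof (pinch_in_block (lb k) (u k) (u k') (Hblk k Hk)) as HH. rewrite E in HH.
    specialize (HH (Hblk k' Hk')). rewrite Hu in HH by auto. destruct (eqw k k'); [congruence|].
    rewrite (inner_ext d n (u k) (u k) _ (fun i => Cmul (RtoC (h k')) (u k' i))) in HH; auto.
    + rewrite inner_mul_r, Hu in HH by auto. destruct (eqw k k'); [congruence|].
      apply C_eq; [apply (f_equal Cre) in HH|apply (f_equal Cim) in HH]; simpl in *; lra.
    + apply (spec_eigen _ _ _ _ _ _ Hs Hk').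
Qed.
End BlockBasis.

(** * Entropy cost of the pinching *)

Section Pinching.
Context (d n : nat) (rho : Op) (Hrho : density d n rho) (lam : word -> R) (e : word -> Vec)
  (Hs : spec d n rho lam e) (g : word -> Vec) (Hg : onb d n g) (lb : word -> nat)
  (Hoff : forall k k', valid d n k -> valid d n k' -> k <> k' -> lb k = lb k' ->
     inner d n (g k) (apply d n rho (g k')) = C0).
Notation W := (words d n).
Notation q k := (Qf d n rho (g k)).

Lemma pinched_weight k : q k = sumR W (fun j => lam j * overlap d n e g j k).
Proof. apply spec_Qf; auto. Qed.

Lemma pinched_weight_ge j k : valid d n j -> lam j * overlap d n e g j k <= q k.
Proof.
  intros Hj. rewrite pinched_weight.
  apply (sumR_term_le W (fun j => lam j * overlap d n e g j k)); [|apply words_valid; auto].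
  intros i Hi. apply words_valid in Hi. apply Rmult_le_pos; [|apply overlap_ge0].
  apply (psd_eigen_ge0 d n rho lam e); auto; apply Hrho.
Qed.

(** The second operator is the diagonal of [rho] in the basis [g]. By [Hoff] it is the pinching of
    [rho] onto the label blocks, already diagonalised. *)
Lemma pinched_pair_spec : pair_spec d n rho
  (fun i i' => sumC W (fun k => Cmul (RtoC (q k)) (Cmul (g k i) (Cconj (g k i')))))
  lam e (fun k => q k) g.
Proof.
  constructor.
  - auto.
  - split; auto.
  - intros j Hj. apply (psd_eigen_ge0 d n rho lam e); auto; apply Hrho.
  - intros k Hk. apply psd_Qf, Hrho.
  - apply (density_eigen_sum d n rho lam e); auto.
  - intros j k Hj Hk Hl Hq. apply Cnorm2_eq0. pose proof (pinched_weight_ge j k Hj) as H.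
    rewrite Hq in H. pose proof (overlap_ge0 d n e g j k). change (overlap d n e g j k = 0). nra.
Qed.

(* [Pi rho Pi >= lam_j Pi|e_j><e_j|Pi], hence [<e_j|(Pi rho Pi)^-1|e_j> <= 1 / lam_j]. *)
Lemma block_inverse_bound j b : valid d n j -> 0 < lam j ->
  sumR W (fun k => if Nat.eqb (lb k) b then overlap d n e g j k * / q k else 0) <= / lam j.
Proof.
  intros Hj Hl.
  set (t := sumR W (fun k => if Nat.eqb (lb k) b then overlap d n e g j k * / q k else 0)).
  assert (Hq0 : forall k, 0 <= q k) by (intros; apply psd_Qf, Hrho).
  assert (Hov : forall k, q k = 0 -> overlap d n e g j k = 0).
  { intros k Hk. pose proof (pinched_weight_ge j k Hj) as H. pose proof (overlap_ge0 d n e g j k). nra. }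
  (* [x] is the pseudo-inverse of [Pi rho Pi] applied to [e j]. Hence [<e_j|x>] and [<x|rho|x>] both
     equal [t], and [lam j * t^2 <= t] follows. Where [q k = 0], the inverse is multiplied by an
     overlap that vanishes by [Hov]. *)
  set (c := fun k => if Nat.eqb (lb k) b then Cmul (RtoC (/ q k)) (inner d n (g k) (e j)) else C0).
  set (x := fun i => sumC W (fun k => Cmul (c k) (g k i))).
  assert (Ex : forall v, inner d n v x = sumC W (fun k => Cmul (c k) (inner d n v (g k)))).
  { intros v. unfold x. rewrite (inner_sum_r d n W v (fun k i => Cmul (c k) (g k i))).
    apply sumC_ext; intros; apply inner_mul_r. }
  assert (E1 : Cre (inner d n (e j) x) = t).
  { rewrite Ex, Cre_sumC. apply sumR_ext; intros k _. unfold c. destruct (Nat.eqb (lb k) b); [|simpl; ring].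
    rewrite <- (inner_sym d n (e j) (g k)). unfold overlap, Cnorm2. simpl. ring. }
  assert (E2 : Qf d n rho x = t).
  { unfold Qf. rewrite <- (inner_sym d n). rewrite Ex. simpl. rewrite Cre_sumC. apply sumR_ext; intros k Hk.
    pose proof Hk as Hk'. apply words_valid in Hk'.
    rewrite <- (apply_adjoint d n rho x (g k)) by (apply (psd_hermitian d n), Hrho).
    rewrite <- (inner_sym d n), <- (apply_adjoint d n rho (g k) x) by (apply (psd_hermitian d n), Hrho).
    rewrite (inner_ext d n (g k) (g k) _ (fun i => sumC W (fun k' => Cmul (c k') (apply d n rho (g k') i)))); auto.
    2:{ intros i _. unfold x. rewrite (apply_sum d n rho W (fun k' i => Cmul (c k') (g k' i))).
        apply sumC_ext; intros; apply apply_mul. }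
    rewrite (inner_sum_r d n W (g k) (fun k' i => Cmul (c k') (apply d n rho (g k') i))).
    unfold c at 1. destruct (Nat.eqb_spec (lb k) b) as [Eb|Eb]; [|simpl; ring].
    rewrite (sumC_ext _ _ (fun k' => Cmul (if eqw k k' then C1 else C0) (Cmul (c k') (inner d n (g k) (apply d n rho (g k')))))).
    - rewrite (sumC_delta W k (fun k' => Cmul (c k') (inner d n (g k) (apply d n rho (g k'))))); auto; [|apply words_NoDup].
      unfold c. rewrite Eb, Nat.eqb_refl.
      assert (R1 : Cconj (inner d n (g k) (apply d n rho (g k))) = inner d n (g k) (apply d n rho (g k))).
      { rewrite inner_sym, apply_adjoint; auto. apply (psd_hermitian d n), Hrho. }
      assert (R2 : Cim (inner d n (g k) (apply d n rho (g k))) = 0) by (apply (f_equal Cim) in R1; simpl in R1; lra).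
      assert (R3 : Cre (inner d n (g k) (apply d n rho (g k))) = q k) by reflexivity.
      assert (R4 : overlap d n e g j k = Cnorm2 (inner d n (g k) (e j))) by apply Cnorm2_inner_sym.
      simpl. rewrite R2, R3.
      destruct (Req_dec (q k) 0) as [Z|Z].
      + rewrite (Hov k Z). pose proof (Hov k Z) as Z'. rewrite R4 in Z'. apply Cnorm2_eq0 in Z'.
        rewrite Z'. simpl. ring.
      + rewrite R4. unfold Cnorm2. field. auto.
    - intros k' Hk2. apply words_valid in Hk2. rewrite inner_mul_r.
      destruct (eqw k k') as [<-|Ne]; [ring|].
      unfold c. destruct (Nat.eqb_spec (lb k') b) as [Eb'|Eb']; [|ring].
      rewrite Hoff by (auto; congruence). ring. }
  assert (Ht : 0 <= t).
  { rewrite <- E2. apply psd_Qf, Hrho. }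
  assert (H : lam j * (t * t) <= t).
  { rewrite <- E2 at 3. rewrite (spec_Qf d n rho lam e) by auto.
    apply Rle_trans with (lam j * Cnorm2 (inner d n (e j) x)).
    - apply Rmult_le_compat_l; [lra|]. unfold Cnorm2. rewrite E1.
      pose proof (Rle_0_sqr (Cim (inner d n (e j) x))). unfold Rsqr in H. lra.
    - apply (sumR_term_le W (fun i => lam i * Cnorm2 (inner d n (e i) x))); [|apply words_valid; auto].
      intros i Hi. apply words_valid in Hi. apply Rmult_le_pos; [|apply Cnorm2_ge0].
      apply (psd_eigen_ge0 d n rho lam e); auto; apply Hrho. }
  destruct (Req_dec t 0) as [Z|Z]; [rewrite Z; left; apply Rinv_0_lt_compat; auto|].
  apply Rmult_le_reg_l with (lam j); auto. rewrite Rinv_r by lra.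
  apply Rmult_le_reg_r with t; lra.
Qed.

(** The pinching inequality on average: each of the [N] blocks contributes at most [/ lam j], so the
    mean of [lam j / q k] is at most [N]; the tangent bound [ln z <= z - 1] at [z = lam j / (N q k)]
    passes to logarithms. *)
Lemma pinching_entropy (N : nat) : (forall k, valid d n k -> (lb k < N)%nat) ->
  ns_entropy d n lam e (fun k => q k) g <= ln (INR N).
Proof.
  intros HN. pose proof pinched_pair_spec as P.
  assert (HN0 : 0 < INR N).
  { destruct (words d n) as [|w l] eqn:E.
    - pose proof (ps_mass _ _ _ _ _ _ _ _ P) as H. rewrite E in H. simpl in H. lra.
    - apply lt_0_INR. assert (valid d n w) by (apply words_valid; rewrite E; left; auto).
      specialize (HN w H). lia. }
  apply Rle_trans with (ns_mean d n lam e (fun k => q k) g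
     (fun x y => (/ INR N) * (x * / y) + (ln (INR N) - 1))).
  - eapply ns_mean_le; [exact P|]. intros j k Hj Hk Hl Hq. unfold llr.
    assert (E : ln (lam j) - ln (q k) = ln (/ INR N * (lam j * / q k)) + ln (INR N)).
    { rewrite ln_mult, ln_mult, !ln_Rinv; auto; [ring|..];
      try apply Rmult_lt_0_compat; try apply Rinv_0_lt_compat; auto. }
    rewrite E. set (z := / INR N * (lam j * / q k)).
    assert (Hz : 0 < z) by (unfold z; repeat apply Rmult_lt_0_compat; try apply Rinv_0_lt_compat; auto).
    pose proof (exp_ineq1_le (ln z)) as H. rewrite exp_ln in H by auto. lra.
  - rewrite ns_mean_add, ns_mean_scal, (ns_mean_const _ _ _ _ _ _ _ _ P).
    assert (H : ns_mean d n lam e (fun k => q k) g (fun x y => x * / y) <= INR N).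
    { rewrite <- (Rmult_1_r (INR N)), <- (density_eigen_sum d n rho lam e), <- sumR_mul_l by auto.
      unfold ns_mean. apply sumR_le; intros j Hj. apply words_valid in Hj.
      destruct (Req_dec (lam j) 0) as [Z|Z].
      { rewrite sumR_zero, Z; [lra|]. intros; rewrite Z; ring. }
      assert (Hl : 0 < lam j) by (pose proof (ps_lam _ _ _ _ _ _ _ _ P j Hj); lra).
      apply Rle_trans with (lam j * lam j * sumR W (fun k => overlap d n e g j k * / q k)).
      { right. rewrite <- sumR_mul_l. apply sumR_ext; intros; ring. }
      assert (HS : sumR W (fun k => overlap d n e g j k * / q k) <= INR N * / lam j).
      { apply Rle_trans with (sumR (seq 0 N) (fun b => sumR W (fun k =>
          if Nat.eqb (lb k) b then overlap d n e g j k * / q k else 0))).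
        - rewrite sumR_swap. right. apply sumR_ext; intros k Hk. apply words_valid in Hk.
          specialize (HN k Hk). set (z := overlap d n e g j k * / q k).
          clear - HN. assert (HN' : (0 <= lb k < 0 + N)%nat) by lia. revert HN'.
          generalize 0%nat as s. generalize (lb k) as b. intros b s Hb.
          clear HN. revert s Hb. induction N as [|N' IH]; intros s Hb; [lia|]. simpl.
          destruct (Nat.eqb_spec b s) as [->|E].
          + rewrite sumR_zero; [ring|]. intros x Hx. apply in_seq in Hx.
            destruct (Nat.eqb_spec s x); [lia|auto].
          + rewrite <- IH by lia. ring.
        - apply Rle_trans with (sumR (seq 0 N) (fun _ => / lam j)).
          + apply sumR_le; intros b _. apply block_inverse_bound; auto.
          + right. clear. generalize 0%nat as s. induction N as [|N' IH]; intros s.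
            * simpl; ring. * rewrite S_INR. simpl. rewrite IH. ring. }
      apply Rle_trans with (lam j * lam j * (INR N * / lam j)).
      + apply Rmult_le_compat_l; [nra|auto].
      + right; field; auto. }
    assert (/ INR N * ns_mean d n lam e (fun k => q k) g (fun x y => x * / y) <= 1); [|lra].
    rewrite <- (Rinv_l (INR N)) by lra. apply Rmult_le_compat_l; auto.
    left; apply Rinv_0_lt_compat; auto.
Qed.

Lemma pinched_entropy_split : ns_entropy d n lam e (fun k => q k) g =
  sumR W (fun j => lam j * ln (lam j)) - sumR W (fun k => q k * ln (q k)).
Proof.
  pose proof pinched_pair_spec as P.
  transitivity (ns_mean d n lam e (fun k => q k) g (fun x y => (fun x _ => ln x) x y + -1 * ln y)).
  { unfold ns_entropy, ns_mean, llr. do 2 (apply sumR_ext; intros). ring. }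
  rewrite ns_mean_add, ns_mean_scal, (ns_mean_left _ _ _ _ _ _ _ _ P (fun x => ln x)).
  assert (E : ns_mean d n lam e (fun k => q k) g (fun _ y => ln y) = sumR W (fun k => q k * ln (q k))); [|rewrite E; ring].
  unfold ns_mean. rewrite sumR_swap. apply sumR_ext; intros k _.
  rewrite sumR_mul_r, <- pinched_weight. reflexivity.
Qed.
End Pinching.

(* The labels [lb k] are (floors of) [- ln] of the eigenvalues of [sigma] on the
   blocks, so that [ln q_k + lb k] is a log-likelihood ratio. *)
Lemma pinching d n rho sigma m : density d n rho -> density d n sigma -> 0 < m ->
  (forall v, m * nrm2 d n v <= Qf d n sigma v) ->
  exists g (lb : word -> nat) lam e mu f, onb d n g /\ pair_spec d n rho sigma lam e mu f /\
   (forall k, valid d n k -> Qf d n sigma (g k) <= exp (- INR (lb k))) /\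
   (forall k, valid d n k -> INR (lb k) <= - ln m) /\
   ns_entropy d n lam e mu f <= ln (1 - ln m) + 1 +
     sumR (words d n) (fun k => Qf d n rho (g k) * (ln (Qf d n rho (g k)) + INR (lb k))).
Proof.
  intros Hr Hs Hm Hv.
  destruct (pair_spec_full_rank d n rho sigma m) as (lam & e & mu & f & P); auto.
  pose proof (spec_onb _ _ _ _ _ (ps_sigma _ _ _ _ _ _ _ _ P)) as Hf.
  assert (Hmu : forall k, valid d n k -> m <= mu k <= 1).
  { intros k Hk. split.
    - rewrite <- (spec_Qf_eigen d n sigma mu f) by (auto; apply (ps_sigma _ _ _ _ _ _ _ _ P)).
      eapply Rle_trans; [|apply Hv]. rewrite onb_nrm2; auto. lra.
    - apply (density_eigen_le1 d n sigma mu f); auto. apply (ps_sigma _ _ _ _ _ _ _ _ P). }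
  set (l := fun k => nat_floor (- ln (mu k))).
  assert (Hln : forall k, valid d n k -> ln m <= ln (mu k) <= 0).
  { intros k Hk. specialize (Hmu k Hk). split.
    - destruct (Req_dec m (mu k)) as [->|]; [lra|]. left; apply ln_increasing; lra.
    - rewrite <- ln_1. destruct (Req_dec (mu k) 1) as [->|]; [lra|]. left; apply ln_increasing; lra. }
  assert (Hl : forall k, valid d n k -> INR (l k) <= - ln (mu k) < INR (l k) + 1).
  { intros k Hk. apply nat_floor_spec. specialize (Hln k Hk). lra. }
  destruct (block_basis d n rho Hr f Hf l) as (g & lb & Hg & Hlb & Hlbr & Hoff).
  assert (Hlbm : forall k, valid d n k -> INR (lb k) <= - ln m).
  { intros k Hk. destruct (Hlbr k Hk) as (i & Hi & <-). specialize (Hl i Hi). specialize (Hln i Hi). lra. }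
  exists g, lb, lam, e, mu, f. split; [auto|split; [auto|split; [|split; [auto|]]]].
  - intros k Hk. rewrite (spec_Qf d n sigma mu f) by apply (ps_sigma _ _ _ _ _ _ _ _ P).
    rewrite <- (Rmult_1_r (exp _)), <- (onb_nrm2 d n g k), (parseval d n f), <- sumR_mul_l by auto.
    apply sumR_le; intros i Hi. apply words_valid in Hi.
    destruct (Hlb k i Hk Hi) as [E|E]; [rewrite E; unfold Cnorm2; simpl; lra|].
    apply Rmult_le_compat_r; [apply Cnorm2_ge0|]. specialize (Hl i Hi). rewrite E in Hl.
    specialize (Hmu i Hi). rewrite <- (exp_ln (mu i)) by lra.
    destruct (Req_dec (ln (mu i)) (- INR (lb k))) as [->|]; [lra|]. left; apply exp_increasing. lra.
  - set (q := fun k => Qf d n rho (g k)).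
    assert (Hlm : 0 <= - ln m).
    { destruct (words d n) as [|w ws] eqn:E.
      - pose proof (ps_mass _ _ _ _ _ _ _ _ P) as H. rewrite E in H. simpl in H. lra.
      - assert (Hw : valid d n w) by (apply words_valid; rewrite E; left; auto).
        specialize (Hln w Hw). lra. }
    destruct (nat_floor_spec _ Hlm) as [F1 F2].
    (* Labels run from 0 to the integer part of [- ln m], whence the successor. *)
    pose proof (pinching_entropy d n rho Hr lam e (ps_rho _ _ _ _ _ _ _ _ P) g Hg lb Hoff (S (nat_floor (- ln m)))) as HE.
    rewrite (pinched_entropy_split d n rho Hr lam e (ps_rho _ _ _ _ _ _ _ _ P) g Hg) in HE.
    assert (HE' : sumR (words d n) (fun j => lam j * ln (lam j)) - sumR (words d n) (fun k => q k * ln (q k)) <= ln (1 - ln m)).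
    { eapply Rle_trans; [apply HE|].
      - intros k Hk. specialize (Hlbm k Hk). apply INR_lt. rewrite S_INR. lra.
      - rewrite S_INR. destruct (Req_dec (INR (nat_floor (- ln m)) + 1) (1 - ln m)) as [->|]; [lra|].
        left; apply ln_increasing; [|lra]. pose proof (pos_INR (nat_floor (- ln m))). lra. }
    clear HE.
    assert (HT : ns_entropy d n lam e mu f <= sumR (words d n) (fun j => lam j * ln (lam j)) + 1
       + sumR (words d n) (fun k => q k * INR (lb k))).
    { apply Rle_trans with (ns_mean d n lam e mu f
        (fun x y => ((fun x _ => ln x) x y + (fun _ _ => 1) x y) + INR (nat_floor (- ln y)))).
      - eapply ns_mean_le; [exact P|]. intros j k Hj Hk Hlj Hmk. unfold llr.
        specialize (Hl k Hk). unfold l in Hl. lra.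
      - rewrite !ns_mean_add, (ns_mean_left _ _ _ _ _ _ _ _ P (fun x => ln x)), (ns_mean_const _ _ _ _ _ _ _ _ P).
        apply Rplus_le_compat_l. right. unfold ns_mean.
        transitivity (sumR (words d n) (fun j => sumR (words d n) (fun k => lam j * overlap d n e g j k * INR (lb k)))).
        + apply sumR_ext; intros j Hj.
          (* The operator with eigenvalues [l i] on [f i] is the one with eigenvalues [lb k] on
             [g k]: both bases are inserted, and [Hlb] exchanges the labels wherever [<f_i|g_k>] is
             nonzero. *)
          transitivity (lam j * Cre (sumC (words d n) (fun i => sumC (words d n) (fun k =>
             Cmul (RtoC (INR (lb k))) (Cmul (inner d n (e j) (f i)) (Cmul (inner d n (f i) (g k)) (inner d n (g k) (e j)))))))).
          * rewrite Cre_sumC, <- sumR_mul_l. apply sumR_ext; intros i Hi. apply words_valid in Hi.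
            rewrite (sumC_ext _ _ (fun k => Cmul (Cmul (RtoC (INR (l i))) (inner d n (e j) (f i)))
               (Cmul (inner d n (f i) (g k)) (inner d n (g k) (e j))))).
            -- rewrite sumC_mul_l, <- (onb_expand d n g (f i) (e j)) by auto.
               rewrite <- (inner_sym d n (e j) (f i)). unfold overlap, Cnorm2, l. simpl. ring.
            -- intros k Hk. apply words_valid in Hk. destruct (Hlb k i Hk Hi) as [E|E]; rewrite E; ring.
          * rewrite sumC_swap, Cre_sumC, <- sumR_mul_l. apply sumR_ext; intros k Hk.
            rewrite (sumC_ext _ _ (fun i => Cmul (Cmul (RtoC (INR (lb k))) (inner d n (g k) (e j)))
               (Cmul (inner d n (e j) (f i)) (inner d n (f i) (g k))))).
            -- rewrite sumC_mul_l, <- (onb_expand d n f (e j) (g k)) by auto.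
               rewrite <- (inner_sym d n (e j) (g k)). unfold overlap, Cnorm2. simpl. ring.
            -- intros; ring.
        + rewrite sumR_swap. apply sumR_ext; intros k Hk. rewrite sumR_mul_r. unfold q.
          rewrite (pinched_weight d n rho lam e); auto. apply (ps_rho _ _ _ _ _ _ _ _ P). }
    rewrite (sumR_ext (words d n) (fun k => Qf d n rho (g k) * (ln (Qf d n rho (g k)) + INR (lb k)))
      (fun k => q k * ln (q k) + q k * INR (lb k))) by (intros; unfold q; ring).
    rewrite sumR_add. lra.
Qed.

(** * Approximate minimax and the direct part *)

Section Minimax.
Context (d n : nat).
Notation W := (words d n).

Definition hs2 (A : Op) : R := sumR W (fun i => sumR W (fun j => Cnorm2 (A i j))).

Lemma hs2_ge0 A : 0 <= hs2 A.
Proof. apply sumR_ge0; intros; apply sumR_ge0; intros; apply Cnorm2_ge0. Qed.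

Lemma hs2_le A : psd d n A -> (forall v, Qf d n A v <= nrm2 d n v) -> hs2 A <= INR (length W).
Proof.
  intros HA H1. destruct (psd_spec_exists d n A HA) as (lam & e & Hs).
  assert (E : hs2 A = Cre (tr d n (mulop d n A A))).
  { unfold tr, mulop. rewrite Cre_sumC. apply sumR_ext; intros i _. rewrite Cre_sumC.
    apply sumR_ext; intros j _. rewrite (psd_hermitian d n A HA i j). unfold Cnorm2; simpl; ring. }
  rewrite E, (tr_mul_spec d n A A lam e) by auto.
  apply Rle_trans with (sumR W (fun _ => 1)).
  - apply sumR_le; intros k Hk. apply words_valid in Hk. rewrite (spec_Qf_eigen d n A lam e) by auto.
    pose proof (psd_eigen_ge0 d n A lam e k HA Hs Hk). specialize (H1 (e k)).
    rewrite (spec_Qf_eigen d n A lam e), onb_nrm2 in H1; auto; [nra|]. eapply spec_onb; eauto.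
  - right. clear. induction W as [|w l IH]; [reflexivity|]. simpl sumR. rewrite IH. simpl length. rewrite S_INR. ring.
Qed.

Lemma povm_Qf_le T v : povm_elem d n T -> Qf d n T v <= nrm2 d n v.
Proof.
  intros [_ H]. pose proof (psd_Qf d n _ v H) as H0. rewrite Qf_sub, Qf_id in H0. lra.
Qed.

Definition mix (t : R) (A B : Op) : Op := addop (scaleop t A) (scaleop (1 - t) B).

(** The parallelogram identity, source of the strong convexity used in the minimax argument. *)
Lemma hs2_midpoint A B : hs2 (mix (1 / 2) A B) = (hs2 A + hs2 B) / 2 - hs2 (subop A B) / 4.
Proof.
  transitivity (1 / 2 * hs2 A + 1 / 2 * hs2 B - 1 / 4 * hs2 (subop A B)); [|field].
  unfold hs2. rewrite <- !sumR_mul_l, <- sumR_add, <- sumR_sub. apply sumR_ext; intros i _.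
  rewrite <- !sumR_mul_l, <- sumR_add, <- sumR_sub. apply sumR_ext; intros j _.
  unfold mix, addop, scaleop, subop, Cnorm2; simpl. field.
Qed.

Notation b T w := (Cre (tr d n (mulop d n T w))).

Lemma pairing_mix_r T A B t : b T (mix t A B) = t * b T A + (1 - t) * b T B.
Proof. unfold mix. rewrite tr_mul_addop, !tr_mul_scaleop. reflexivity. Qed.
Lemma pairing_mix_l A B t w : b (mix t A B) w = t * b A w + (1 - t) * b B w.
Proof. rewrite !(tr_mul_comm d n _ w). apply pairing_mix_r. Qed.

(** Cauchy-Schwarz in Young's form, which avoids square roots; [r] balances the distance of the
    tests against the norm of [w]. *)
Lemma pairing_lipschitz A B w r : 0 < r -> psd d n w -> (forall v, Qf d n w v <= nrm2 d n v) ->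
  b A w <= b B w + hs2 (subop A B) / (2 * r) + r * INR (length W) / 2.
Proof.
  intros Hr Hw Hw1. pose proof (hs2_le w Hw Hw1) as Hh.
  assert (H : b A w - b B w <= / (2 * r) * hs2 (subop A B) + r / 2 * hs2 w).
  { unfold tr, mulop, hs2. rewrite !Cre_sumC, <- !sumR_mul_l, <- sumR_add, <- sumR_sub.
    apply sumR_le; intros i _. rewrite !Cre_sumC, <- !sumR_mul_l, <- sumR_add, <- sumR_sub.
    apply sumR_le; intros j _. rewrite (psd_hermitian d n w Hw i j). unfold subop, Cnorm2; simpl.
    set (x := Cre (A i j)). set (y := Cre (B i j)). set (x' := Cim (A i j)). set (y' := Cim (B i j)).
    set (p := Cre (w i j)). set (p' := Cim (w i j)).
    assert (0 <= / (2 * r)) by (left; apply Rinv_0_lt_compat; lra).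
    assert (E : / (2 * r) * ((x + - y) * (x + - y) + (x' + - y') * (x' + - y')) + r / 2 * (p * p + p' * p')
      - (x * p - x' * - p' - (y * p - y' * - p')) =
      / (2 * r) * ((x - y - r * p) * (x - y - r * p) + (x' - y' - r * p') * (x' - y' - r * p'))) by (field; lra).
    pose proof (Rle_0_sqr (x - y - r * p)) as S1. pose proof (Rle_0_sqr (x' - y' - r * p')) as S2. unfold Rsqr in *.
    assert (0 <= / (2 * r) * ((x - y - r * p) * (x - y - r * p) + (x' - y' - r * p') * (x' - y' - r * p'))).
    { apply Rmult_le_pos; lra. }
    lra. }
  assert (r / 2 * hs2 w <= r / 2 * INR (length W)) by (apply Rmult_le_compat_l; lra).
  unfold Rdiv in *. lra.
Qed.

(* Regularising the pairing by a multiple of the squared Hilbert-Schmidt norm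
   makes near-minimisers stable, so a best response to a near-optimal state is
   good against every state. *)
Lemma approximate_minimax (S Y : Op -> Prop) c delta :
  (forall T, S T -> povm_elem d n T) -> (forall w, Y w -> density d n w) ->
  (forall A B t, S A -> S B -> 0 <= t <= 1 -> S (mix t A B)) ->
  (forall A B t, Y A -> Y B -> 0 <= t <= 1 -> Y (mix t A B)) ->
  (exists w, Y w) -> 0 < delta ->
  (forall w, Y w -> exists T, S T /\ b T w <= c) ->
  exists T, S T /\ forall w, Y w -> b T w <= c + delta.
Proof.
  intros HS HY CS CY [w0 Hw0] Hdel Hc.
  set (K := INR (length W)). assert (HK : 0 <= K) by apply pos_INR.
  assert (Hb0 : forall T w, S T -> Y w -> 0 <= b T w).
  { intros T w HT Hw. apply tr_psd_mul_ge0; [apply HS; auto|apply HY; auto]. }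
  assert (Hc0 : 0 <= c).
  { destruct (Hc w0 Hw0) as (T & HT & HTc). specialize (Hb0 T w0 HT Hw0). lra. }
  assert (HhT : forall T, S T -> hs2 T <= K).
  { intros T HT. apply hs2_le; [apply HS; auto|]. intros v. apply povm_Qf_le; auto. }
  (* Small enough for the regularisation to add at most [delta / 4] to any pairing. *)
  set (gam := delta / (4 * (K + 1))). assert (Hg : 0 < gam) by (apply Rdiv_lt_0_compat; lra).
  assert (HgK : gam * K <= delta / 4).
  { apply Rle_trans with (gam * (K + 1)); [apply Rmult_le_compat_l; lra|]. right; unfold gam; field; lra. }
  set (F := fun T w => b T w + gam * hs2 T).
  assert (HF0 : forall T w, S T -> Y w -> 0 <= F T w).
  { intros T w HT Hw. apply Rplus_le_le_0_compat; auto. apply Rmult_le_pos; [lra|apply hs2_ge0]. }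
  set (f := fun w => epsilon (inhabits 0) (is_inf (fun x => exists T, S T /\ x = F T w))).
  assert (Hf : forall w, Y w -> is_inf (fun x => exists T, S T /\ x = F T w) (f w)).
  { intros w Hw. apply epsilon_spec, is_inf_exists with 0.
    - destruct (Hc w Hw) as (T & HT & _). eauto.
    - intros y (T & HT & ->). auto. }
  set (c1 := c + delta / 4).
  assert (Hf1 : forall w, Y w -> f w <= c1).
  { intros w Hw. destruct (Hc w Hw) as (T & HT & HTc). destruct (Hf w Hw) as [H1 _].
    specialize (H1 (F T w) (ex_intro _ T (conj HT eq_refl))). unfold F in H1.
    assert (gam * hs2 T <= gam * K) by (apply Rmult_le_compat_l; [lra|auto]). unfold c1. lra. }
  destruct (is_inf_exists (fun x => exists w, Y w /\ x = - f w) (- c1)) as [s Hs].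
  { exists (- f w0), w0. auto. }
  { intros y (w & Hw & ->). specialize (Hf1 w Hw). lra. }
  set (r := delta / (2 * (K + 1))). assert (Hr : 0 < r) by (apply Rdiv_lt_0_compat; lra).
  assert (HrK : r * K / 2 <= delta / 4).
  { assert (r * K <= r * (K + 1)) by (apply Rmult_le_compat_l; lra).
    assert (r * (K + 1) = delta / 2) by (unfold r; field; lra). lra. }
  (* The near-optimal state [ws] is perturbed by a weight [t], while optima are taken up to [t * t]:
     dividing by [t] in [A4] still leaves an error of order [t]. The last bound on [t] makes the two
     best responses close, in [A7]. *)
  set (t := Rmin (1 / 2) (Rmin (delta / 8) (delta * gam * r / (8 * (c1 + 2))))).
  assert (Hc1 : 0 <= c1) by (unfold c1; lra).
  assert (Ht0 : 0 < t).
  { repeat apply Rmin_glb_lt; try lra. apply Rdiv_lt_0_compat; [|lra].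
    apply Rmult_lt_0_compat; [apply Rmult_lt_0_compat|]; auto. }
  assert (Ht1 : t <= 1 / 2) by apply Rmin_l.
  assert (Ht2 : t <= delta / 8) by (eapply Rle_trans; [apply Rmin_r|apply Rmin_l]).
  assert (Ht3 : 2 * (t * (c1 + 2)) / (gam * r) <= delta / 4).
  { assert (H : t <= delta * gam * r / (8 * (c1 + 2))) by (eapply Rle_trans; [apply Rmin_r|apply Rmin_r]).
    apply Rmult_le_compat_r with (r := 2 * (c1 + 2) / (gam * r)) in H.
    - replace (delta * gam * r / (8 * (c1 + 2)) * (2 * (c1 + 2) / (gam * r))) with (delta / 4) in H by (field; lra).
      replace (2 * (t * (c1 + 2)) / (gam * r)) with (t * (2 * (c1 + 2) / (gam * r))) by (field; lra). auto.
    - left; apply Rdiv_lt_0_compat; [lra|apply Rmult_lt_0_compat; auto]. }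
  assert (Htt : 0 < t * t) by (apply Rmult_lt_0_compat; auto).
  destruct (is_inf_near _ _ _ Hs Htt) as (y1 & (ws & Hws & ->) & Hlt).
  destruct (is_inf_near _ _ _ (Hf ws Hws) Htt) as (y2 & (Ts & HTs & ->) & HTlt).
  set (v := f ws) in *. assert (Hv1 : v <= c1) by (apply Hf1; auto).
  assert (Hv0 : 0 <= v).
  { destruct (Hf ws Hws) as [_ H2]. apply H2. intros y (T & HT & ->). auto. }
  exists Ts. split; auto. intros w Hw.
  set (wt := mix (1 - t) ws w). assert (Hwt : Y wt) by (apply CY; auto; lra).
  destruct (is_inf_near _ _ _ (Hf wt Hwt) Htt) as (y3 & (Tt & HTt & ->) & HTtlt).
  assert (A1 : F Tt wt < v + 2 * (t * t)).
  { destruct Hs as [Hs1 _]. specialize (Hs1 (- f wt) (ex_intro _ wt (conj Hwt eq_refl))). lra. }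
  assert (A2 : F Tt wt = (1 - t) * F Tt ws + t * F Tt w).
  { unfold F, wt. rewrite pairing_mix_r. ring. }
  assert (A3 : v <= F Tt ws).
  { destruct (Hf ws Hws) as [H1 _]. apply H1. eauto. }
  (* The best response to the perturbed state is good against [w], since [ws] nearly maximises the
     value and [Tt] cannot do better than [v] against [ws]. *)
  assert (A4 : F Tt w <= v + 2 * t).
  { apply Rmult_le_reg_l with t; auto.
    assert ((1 - t) * v <= (1 - t) * F Tt ws) by (apply Rmult_le_compat_l; lra). lra. }
  assert (A5 : F Tt ws <= v + t * (2 * c1 + 2)).
  { assert (B0 : 0 <= F Tt w) by auto.
    assert (B1 : (1 - t) * F Tt ws <= v + 2 * (t * t)).
    { assert (0 <= t * F Tt w) by (apply Rmult_le_pos; lra). lra. }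
    assert (B2 : F Tt ws <= (1 + 2 * t) * ((1 - t) * F Tt ws)).
    { assert (0 <= t * (1 - 2 * t) * F Tt ws); [|lra]. apply Rmult_le_pos; [apply Rmult_le_pos; lra|lra]. }
    assert (B3 : (1 + 2 * t) * ((1 - t) * F Tt ws) <= (1 + 2 * t) * (v + 2 * (t * t))) by (apply Rmult_le_compat_l; lra).
    assert (B4 : t * v <= t * c1) by (apply Rmult_le_compat_l; lra).
    assert (B5 : t * t <= t * (1 / 2)) by (apply Rmult_le_compat_l; lra).
    assert (B6 : t * (t * t) <= t * (t * (1 / 2))) by (apply Rmult_le_compat_l; lra). lra. }
  (* Both [Ts] and [Tt] are nearly optimal against [ws], and their midpoint cannot beat [v]; strong
     convexity then makes [D] small, so what [Tt] achieves against [w] passes to [Ts], which does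
     not depend on [w]. *)
  set (D := hs2 (subop Ts Tt)).
  assert (A6 : gam * D / 4 <= t * (c1 + 2)).
  { destruct (Hf ws Hws) as [H1 _].
    specialize (H1 (F (mix (1 / 2) Ts Tt) ws)). 
    assert (H2 : v <= F (mix (1 / 2) Ts Tt) ws).
    { apply H1. eexists; split; [|reflexivity]. apply CS; auto; lra. }
    assert (H3 : F (mix (1 / 2) Ts Tt) ws = (F Ts ws + F Tt ws) / 2 - gam * D / 4).
    { unfold F. rewrite pairing_mix_l, hs2_midpoint. unfold D. field. }
    assert (B5 : t * t <= t * (1 / 2)) by (apply Rmult_le_compat_l; lra).
    lra. }
  assert (A7 : D / (2 * r) <= delta / 4).
  { eapply Rle_trans; [|exact Ht3].
    apply Rmult_le_reg_l with (gam * r); [apply Rmult_lt_0_compat; auto|].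
    replace (gam * r * (D / (2 * r))) with (2 * (gam * D / 4)) by (field; lra).
    replace (gam * r * (2 * (t * (c1 + 2)) / (gam * r))) with (2 * (t * (c1 + 2))) by (field; lra). lra. }
  pose proof (pairing_lipschitz Ts Tt w r Hr (proj1 (HY w Hw)) (fun v => density_Qf_le d n w v (HY w Hw))) as A8.
  fold D K in A8.
  assert (A9 : b Tt w <= F Tt w).
  { unfold F. assert (0 <= gam * hs2 Tt) by (apply Rmult_le_pos; [lra|apply hs2_ge0]). lra. }
  unfold c1 in *. lra.
Qed.
End Minimax.

(** * Projections onto subsets of an orthonormal basis *)

Section SubsetTest.
Context (d n : nat) (g : word -> Vec) (Hg : onb d n g) (p : word -> bool).
Notation W := (words d n).

(** The coefficient [RtoC 1] gives the sum the shape expected by [tr_mul_sum]; the validity guard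
    ensures [op_on]. *)
Definition subset_test : Op := fun i j =>
  if validb d n i && validb d n j
  then sumC (filter p W) (fun k => Cmul (RtoC 1) (Cmul (g k i) (Cconj (g k j)))) else C0.

Lemma sumR_filter {A} (l : list A) (P : A -> bool) (f : A -> R) :
  sumR (filter P l) f = sumR l (fun x => if P x then f x else 0).
Proof. induction l as [|a l IH]; simpl; auto. destruct (P a); simpl; rewrite IH; ring. Qed.

Lemma subset_test_valid i i' : valid d n i -> valid d n i' ->
  subset_test i i' = sumC (filter p W) (fun k => Cmul (RtoC 1) (Cmul (g k i) (Cconj (g k i')))).
Proof. unfold valid, subset_test. intros -> ->. reflexivity. Qed.

Lemma subset_test_tr A : Cre (tr d n (mulop d n subset_test A)) =
  sumR W (fun k => if p k then Qf d n A (g k) else 0).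
Proof.
  rewrite tr_mul_comm, (tr_mul_sum d n A (filter p W) (fun _ => 1) g), sumR_filter by apply subset_test_valid.
  apply sumR_ext; intros k _. destruct (p k); ring.
Qed.

Lemma subset_test_Qf v : Qf d n subset_test v = sumR W (fun k => if p k then Cnorm2 (inner d n (g k) v) else 0).
Proof.
  unfold Qf. rewrite (inner_ext d n v v _ (fun i => sumC (filter p W) (fun k => Cmul (inner d n (g k) v) (g k i)))); auto.
  - rewrite (inner_sum_r d n (filter p W) v (fun k i => Cmul (inner d n (g k) v) (g k i))).
    rewrite Cre_sumC, sumR_filter. apply sumR_ext; intros k _. destruct (p k); auto.
    rewrite inner_mul_r, <- (inner_sym d n (g k) v). unfold Cnorm2; simpl; ring.
  - intros i Hi. unfold apply, inner.
    rewrite (sumC_ext _ _ (fun j => sumC (filter p W) (fun k => Cmul (Cmul (Cconj (g k j)) (v j)) (g k i)))).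
    + rewrite sumC_swap. apply sumC_ext; intros k _. apply sumC_mul_r.
    + intros j Hj. apply words_valid in Hj. rewrite subset_test_valid by auto. rewrite <- sumC_mul_r.
      apply sumC_ext; intros k _. ceq.
Qed.

Lemma subset_test_povm : povm_elem d n subset_test.
Proof.
  assert (Ho : op_on d n subset_test).
  { intros i j H. unfold subset_test, valid in *. destruct (validb d n i), (validb d n j); simpl; auto. tauto. }
  assert (Hh : hermitian subset_test).
  { intros i j. unfold subset_test. rewrite andb_comm. destruct (validb d n i && validb d n j); [|ceq].
    rewrite sumC_conj. apply sumC_ext; intros; ceq. }
  split; apply psd_intro; auto.
  - intros v. rewrite subset_test_Qf. apply sumR_ge0; intros k _. destruct (p k); [apply Cnorm2_ge0|lra].
  - intros i j H. unfold subop. rewrite Ho by auto. unfold idop.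
    destruct (validb d n i) eqn:Ei; [|ceq]. destruct (list_eq_dec Nat.eq_dec i j) as [<-|]; [|ceq].
    exfalso; apply H; split; exact Ei.
  - intros i j. unfold subop. rewrite Hh, Cconj_add. f_equal. unfold idop.
    destruct (list_eq_dec Nat.eq_dec j i) as [->|E].
    + destruct (list_eq_dec Nat.eq_dec i i); [|congruence]. destruct (validb d n i); ceq.
    + destruct (list_eq_dec Nat.eq_dec i j); [congruence|]. destruct (validb d n i), (validb d n j); ceq.
  - intros v. rewrite Qf_sub, Qf_id, subset_test_Qf, (parseval d n g v Hg), <- sumR_sub.
    apply sumR_ge0; intros k _. pose proof (Cnorm2_ge0 (inner d n (g k) v)). destruct (p k); lra.
Qed.
End SubsetTest.

(** The zero test meets every type-II bound, so at each [n] there is an admissible test to choose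
    from. *)
Lemma povm_zero d n : povm_elem d n (fun _ _ => C0).
Proof.
  assert (HQ : forall v, Qf d n (fun _ _ => C0) v = 0).
  { intros v. unfold Qf, inner, apply. rewrite sumC_zero; [reflexivity|]. intros i _.
    rewrite sumC_zero; [ring|]. intros; ring. }
  split; apply psd_intro.
  - intros i j _; reflexivity.
  - intros i j; ceq.
  - intros v. rewrite HQ; lra.
  - intros i j H. unfold subop, idop. destruct (validb d n i) eqn:Ei; [|ceq].
    destruct (list_eq_dec Nat.eq_dec i j) as [<-|]; [|ceq]. exfalso; apply H; split; exact Ei.
  - intros i j. unfold subop, idop.
    destruct (list_eq_dec Nat.eq_dec j i) as [->|E].
    + destruct (list_eq_dec Nat.eq_dec i i); [|congruence]. destruct (validb d n i); ceq.
    + destruct (list_eq_dec Nat.eq_dec i j); [congruence|]. destruct (validb d n i), (validb d n j); ceq.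
  - intros v. rewrite Qf_sub, HQ, Qf_id. pose proof (nrm2_ge0 d n v). lra.
Qed.

Lemma povm_mix d n A B t : povm_elem d n A -> povm_elem d n B -> 0 <= t <= 1 -> povm_elem d n (mix t A B).
Proof.
  assert (H : forall A B, psd d n A -> psd d n B -> 0 <= t <= 1 -> psd d n (mix t A B)).
  { intros A' B' HA HB Ht. apply psd_intro.
    - intros i j Hij. unfold mix, addop, scaleop. destruct HA as [HA _], HB as [HB _].
      rewrite HA, HB by auto. ceq.
    - intros i j. unfold mix, addop, scaleop. rewrite (psd_hermitian d n A' HA i), (psd_hermitian d n B' HB i). ceq.
    - intros v. unfold mix. rewrite Qf_add, !Qf_scale. pose proof (psd_Qf d n A' v HA). pose proof (psd_Qf d n B' v HB).
      apply Rplus_le_le_0_compat; apply Rmult_le_pos; lra. }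
  intros [HA HA'] [HB HB'] Ht. split; auto.
  replace (subop (idop d n) (mix t A B)) with (mix t (subop (idop d n) A) (subop (idop d n) B)); auto.
  extensionality i; extensionality j. unfold mix, addop, scaleop, subop. ceq.
Qed.

(** The tangent bound [ln (s z) <= s z - 1], with [s] so small that the linear term uses half of
    [a]; the other half absorbs the constant for large [n]. *)
Lemma ln_sublinear C a : 0 <= C -> 0 < a -> exists N, forall n, (N <= n)%nat -> ln (1 + INR n * C) + 1 <= INR n * a.
Proof.
  intros HC Ha. set (s := a / (2 * (C + 1))). assert (Hs : 0 < s) by (apply Rdiv_lt_0_compat; lra).
  destruct (INR_unbounded ((s - ln s) / (a / 2))) as [N HN]. exists N. intros n Hn.
  assert (HnN : INR N <= INR n) by (apply le_INR; auto). pose proof (pos_INR n) as Hn0.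
  assert (0 <= INR n * C) by (apply Rmult_le_pos; auto).
  assert (H1 : ln s + ln (1 + INR n * C) <= s * (1 + INR n * C) - 1).
  { rewrite <- ln_mult by lra. pose proof (exp_ineq1_le (ln (s * (1 + INR n * C)))) as H1.
    rewrite exp_ln in H1; [lra|]. apply Rmult_lt_0_compat; lra. }
  assert (H2 : s * C <= a / 2).
  { apply Rle_trans with (s * (C + 1)); [apply Rmult_le_compat_l; lra|]. right; unfold s; field; lra. }
  assert (H3 : INR n * (s * C) <= INR n * (a / 2)) by (apply Rmult_le_compat_l; auto).
  assert (H4 : s - ln s <= INR n * (a / 2)).
  { apply Rmult_lt_compat_r with (r := a / 2) in HN; [|lra].
    unfold Rdiv at 1 in HN. rewrite Rmult_assoc, Rinv_l, Rmult_1_r in HN by lra.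
    assert (INR N * (a / 2) <= INR n * (a / 2)) by (apply Rmult_le_compat_r; lra). lra. }
  lra.
Qed.

(** * The direct part *)

Section Direct.
Context (d : nat) (M : Family) (rho : Op) (HM : P_props d M) (Hrho : density d 1 rho).
Notation Einf := (E_inf M d rho * ln 2).
Notation typeI n T := (Cre (tr d n (mulop d n (subop (idop d n) T) (tpow n rho)))).
Notation typeII n T w := (Cre (tr d n (mulop d n T w))).

(** The error level [eta] is fixed here, because the contradiction compares a loss proportional to
    [eta] with terms made small in terms of it. Turning this into one sequence with vanishing error
    is left to the theorem. *)
Lemma direct_core eps eta : 0 < eps -> 0 < eta -> exists N, forall n, (N <= n)%nat ->
  exists T, povm_elem d n T /\ typeI n T <= eta /\
    forall w, M n w -> typeII n T w <= exp (- (INR n * (Einf - eps))).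
Proof.
  intros He Heta. pose proof (Einf_ge0 d M rho HM Hrho) as HE0.
  destruct (M_full d M HM) as (sg & m & Dsg & Hm & Hv & HMs).
  assert (Hlnm : ln m <= 0).
  { rewrite <- ln_1. destruct (Req_dec m 1) as [->|]; [lra|]. left; apply ln_increasing; lra. }
  (* Bound on the likelihood ratio per copy: the mixture has least eigenvalue at least [m ^ n / 3],
     and the 2 covers [ln 3]. *)
  set (C := - ln m + 2). assert (HC : 2 <= C) by (unfold C; lra).
  (* The lower range gains at least [eta * eps / 2 = 4 * del] per copy. Against it stand one [del]
     each for the excess of [r2] over [Einf], for the upper range (via [tau]), and for the cost of
     pinching. *)
  set (del := eta * eps / 8). assert (Hdel : 0 < del).
  { unfold del. assert (0 < eta * eps) by (apply Rmult_lt_0_compat; auto). lra. }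
  set (tau := del / C). assert (Htau : 0 < tau) by (apply Rdiv_lt_0_compat; lra).
  destruct (strong_converse_core d M rho HM Hrho del Hdel) as (om & Hom & Hsc).
  (* The 3 is the inverse of the weight of [om n] in the mixture [st]. *)
  destruct (Hsc 3 tau Htau ltac:(lra)) as [N1 HN1].
  destruct (ln_sublinear C del ltac:(lra) Hdel) as [N2 HN2].
  (* Here 6 combines that factor 3, now for the weight of [w], with the halved level [c / 2] in
     [Hbad]. *)
  destruct (exp_decay (eps / 2) (/ 6)) as [N3 HN3]; [lra|lra|].
  exists (1 + N1 + N2 + N3)%nat. intros n Hn.
  specialize (HN2 n ltac:(lia)). specialize (HN3 n ltac:(lia)).
  assert (Hn1 : 1 <= INR n) by (change 1 with (INR 1); apply le_INR; lia).
  set (rn := tpow n rho). assert (Drn : density d n rn) by (apply density_tpow; auto).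
  set (c := exp (- (INR n * (Einf - eps)))). assert (Hc : 0 < c) by apply exp_pos.
  apply NNPP; intros Hno.
  (* The minimax statement has a slack, so it is applied at [c / 2]: were every state beaten at that
     level, one test would beat all of them at level [c]. *)
  assert (Hbad : exists w, M n w /\ forall T, povm_elem d n T -> typeI n T <= eta -> c / 2 < typeII n T w).
  { apply NNPP; intros Hno2. apply Hno.
    destruct (approximate_minimax d n (fun T => povm_elem d n T /\ typeI n T <= eta) (M n) (c / 2) (c / 2))
      as (T & [HT1 HT2] & HT3).
    - tauto.
    - apply (M_density d M HM).
    - intros A B t [HA1 HA2] [HB1 HB2] Ht. split; [apply povm_mix; auto|].
      fold rn in HA2, HB2 |- *. rewrite tr_complement_mul in * by auto. rewrite pairing_mix_l.
      assert (t * (1 - typeII n A rn) <= t * eta) by (apply Rmult_le_compat_l; lra).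
      assert ((1 - t) * (1 - typeII n B rn) <= (1 - t) * eta) by (apply Rmult_le_compat_l; lra). lra.
    - apply (M_convex d M HM).
    - exists (om n). apply Hom.
    - lra.
    - intros w Hw. apply NNPP; intros Hno3. apply Hno2. exists w. split; auto. intros T HT HT'.
      apply Rnot_le_lt. intros HL. apply Hno3. exists T. auto.
    - exists T. split; [auto|split; [auto|]]. intros w Hw. specialize (HT3 w Hw). unfold c in *. lra. }
  destruct Hbad as (w & Hw & Hbad).
  set (st := mix (1 / 3) (tpow n sg) (mix (1 / 2) w (om n))).
  assert (Mst : M n st) by (apply (M_convex d M HM); [auto|apply (M_convex d M HM); auto; lra|lra]).
  pose proof (M_density d M HM n st Mst) as Dst.
  assert (Htr : forall T, povm_elem d n T ->
    typeII n T w <= 3 * typeII n T st /\ typeII n T (om n) <= 3 * typeII n T st).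
  { intros T HT. unfold st. rewrite !pairing_mix_r.
    pose proof (tr_psd_mul_ge0 d n T (tpow n sg) (proj1 HT) (proj1 (density_tpow d n sg Dsg))).
    pose proof (tr_psd_mul_ge0 d n T w (proj1 HT) (proj1 (M_density d M HM n w Hw))).
    pose proof (tr_psd_mul_ge0 d n T (om n) (proj1 HT) (proj1 (M_density d M HM n _ (Hom n)))). lra. }
  set (mn := m ^ n / 3). assert (Hmn0 : 0 < m ^ n) by (apply pow_lt; lra).
  assert (Hmn : 0 < mn) by (unfold mn; lra).
  assert (HQst : forall v, mn * nrm2 d n v <= Qf d n st v).
  { intros v. unfold st, mix. rewrite !Qf_add, !Qf_scale, !Qf_add, !Qf_scale.
    pose proof (tpow_eigen_lower d sg m n ltac:(lra) Dsg Hv v).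
    pose proof (psd_Qf d n w v (proj1 (M_density d M HM n w Hw))).
    pose proof (psd_Qf d n (om n) v (proj1 (M_density d M HM n _ (Hom n)))). unfold mn. lra. }
  assert (Hlnmn : - ln mn <= INR n * C).
  { unfold mn, Rdiv. rewrite ln_mult, ln_Rinv, ln_pow by lra.
    pose proof (exp_ineq1_le (ln 3)) as H3. rewrite exp_ln in H3 by lra.
    unfold C. assert (1 * 2 <= INR n * 2) by (apply Rmult_le_compat_r; lra). lra. }
  destruct (pinching d n rn st mn Drn Dst Hmn HQst) as (g & lb & lam & e & mu & f & Hg & P & Hgs & Hlb & Hent).
  set (q := fun k => Qf d n rn (g k)) in *.
  assert (Hq0 : forall k, 0 <= q k) by (intros; apply psd_Qf, Drn).
  assert (Hq1 : sumR (words d n) q = 1) by (apply density_tr_Qf; auto).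
  assert (Hqle : forall k, valid d n k -> q k <= 1).
  { intros k Hk. unfold q. rewrite <- (onb_nrm2 d n g k Hg Hk). apply density_Qf_le; auto. }
  (* The likelihood-ratio test [ln (q k) + lb k >= n r], written without logarithms so that
     [q k = 0] is never selected. On selected [k] the weight of [st] is at most
     [exp (- INR (lb k)) <= exp (- (n r)) q k], which gives [Hst]. *)
  set (p := fun r k => if Rle_dec (exp (INR n * r - INR (lb k))) (q k) then true else false).
  assert (HT : forall r, povm_elem d n (subset_test d n g (p r))) by (intros; apply subset_test_povm; auto).
  assert (Hst : forall r, typeII n (subset_test d n g (p r)) st <= exp (- (INR n * r))).
  { intros r. rewrite subset_test_tr. rewrite <- (Rmult_1_r (exp _)), <- Hq1, <- sumR_mul_l.
    apply sumR_le; intros k Hk. apply words_valid in Hk. unfold p.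
    destruct (Rle_dec (exp (INR n * r - INR (lb k))) (q k)) as [L|L].
    - eapply Rle_trans; [apply Hgs; auto|].
      replace (- INR (lb k)) with (- (INR n * r) + (INR n * r - INR (lb k))) by ring.
      rewrite exp_plus. apply Rmult_le_compat_l; [left; apply exp_pos|auto].
    - apply Rmult_le_pos; [left; apply exp_pos|auto]. }
  assert (Hout : forall r k, p r k = false -> q k * (ln (q k) + INR (lb k)) <= q k * (INR n * r)).
  { intros r k. unfold p. destruct (Rle_dec (exp (INR n * r - INR (lb k))) (q k)) as [L|L]; [discriminate|intros _].
    destruct (Req_dec (q k) 0) as [Z|Z]; [rewrite Z; lra|]. specialize (Hq0 k).
    apply Rmult_le_compat_l; auto. apply Rnot_le_lt, ln_increasing in L; [|lra].
    rewrite ln_exp in L. lra. }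
  assert (Hany : forall k, valid d n k -> q k * (ln (q k) + INR (lb k)) <= q k * (INR n * C)).
  { intros k Hk. destruct (Req_dec (q k) 0) as [Z|Z]; [rewrite Z; lra|]. specialize (Hq0 k). specialize (Hqle k Hk).
    apply Rmult_le_compat_l; auto. specialize (Hlb k Hk).
    assert (ln (q k) <= 0); [|lra]. rewrite <- ln_1.
    destruct (Req_dec (q k) 1) as [->|]; [lra|]. left; apply ln_increasing; lra. }
  set (r1 := Einf - eps / 2). set (r2 := Einf + del).
  assert (Hlow : eta < sumR (words d n) (fun k => if p r1 k then 0 else q k)).
  { apply Rnot_le_lt. intros HL.
    assert (HI : typeI n (subset_test d n g (p r1)) <= eta).
    { fold rn. rewrite tr_complement_mul by auto. rewrite subset_test_tr, <- Hq1, <- sumR_sub.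
      eapply Rle_trans; [|exact HL]. right. apply sumR_ext; intros k _. fold (q k). destruct (p r1 k); ring. }
    pose proof (Hbad _ (HT r1) HI) as H1. destruct (Htr _ (HT r1)) as [H2 _]. specialize (Hst r1).
    assert (H3 : exp (- (INR n * r1)) = c * exp (- (INR n * (eps / 2)))).
    { unfold c. rewrite <- exp_plus. f_equal. unfold r1. field. }
    assert (H4 : c * exp (- (INR n * (eps / 2))) < c * / 6) by (apply Rmult_lt_compat_l; auto). lra. }
  assert (Hhigh : sumR (words d n) (fun k => if p r2 k then q k else 0) <= tau).
  { assert (HI : 1 - tau <= typeI n (subset_test d n g (p r2))).
    { apply HN1; [lia|auto|]. destruct (Htr _ (HT r2)) as [_ H2]. specialize (Hst r2). unfold r2 in *. lra. }
    fold rn in HI. rewrite tr_complement_mul in HI by auto. rewrite subset_test_tr in HI. unfold q. lra. }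
  (* Indices failing the threshold [r1] are charged [n r1], those failing only [r2] are charged
     [n r2], and the rest at most [n C] by [Hany]. Nonnegativity of the last charge makes it
     unnecessary to compare the two tests. *)
  assert (Hsum : sumR (words d n) (fun k => q k * (ln (q k) + INR (lb k))) <=
    INR n * r2 * sumR (words d n) q - INR n * (r2 - r1) * sumR (words d n) (fun k => if p r1 k then 0 else q k)
    + INR n * C * sumR (words d n) (fun k => if p r2 k then q k else 0)).
  { rewrite <- !sumR_mul_l, <- sumR_sub, <- sumR_add. apply sumR_le; intros k Hk. apply words_valid in Hk.
    specialize (Hany k Hk). specialize (Hq0 k).
    assert (G1 : 0 <= INR n * C * q k) by (repeat apply Rmult_le_pos; lra).
    assert (G2 : 0 <= INR n * r2 * q k) by (unfold r2; repeat apply Rmult_le_pos; lra).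
    destruct (p r1 k) eqn:E1; [|specialize (Hout r1 k E1); destruct (p r2 k); lra].
    destruct (p r2 k) eqn:E2; [lra|]. specialize (Hout r2 k E2). lra. }
  pose proof (Einf_lower d M rho HM Hrho n st lam e mu f ltac:(lia) Mst P) as HE.
  assert (G3 : INR n * (r2 - r1) * eta <= INR n * (r2 - r1) * sumR (words d n) (fun k => if p r1 k then 0 else q k)).
  { apply Rmult_le_compat_l; [|lra]. apply Rmult_le_pos; [lra|unfold r2, r1; lra]. }
  assert (G4 : INR n * C * sumR (words d n) (fun k => if p r2 k then q k else 0) <= INR n * del).
  { apply Rle_trans with (INR n * C * tau); [apply Rmult_le_compat_l; [apply Rmult_le_pos; lra|auto]|].
    right. unfold tau. field. lra. }
  assert (G5 : ln (1 - ln mn) <= ln (1 + INR n * C)).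
  { assert (0 < 1 - ln mn).
    { assert (ln mn < 0); [|lra]. rewrite <- ln_1. apply ln_increasing; auto.
      unfold mn. assert (m ^ n <= 1); [|lra]. rewrite <- (pow1 n). apply pow_incr; lra. }
    destruct (Req_dec (1 - ln mn) (1 + INR n * C)) as [->|]; [lra|]. left; apply ln_increasing; lra. }
  rewrite Hq1 in Hsum. pose proof (Rle_trans _ _ _ Hent (Rplus_le_compat_l _ _ _ Hsum)) as Htot.
  assert (G6 : INR n * (r2 - r1) * eta = INR n * del * eta + INR n * (4 * del)).
  { unfold r2, r1, del. field. }
  assert (G7 : 0 <= INR n * del * eta) by (repeat apply Rmult_le_pos; lra).
  assert (G8 : 0 < INR n * del) by (apply Rmult_lt_0_compat; lra).
  assert (G9 : INR n * r2 = INR n * Einf + INR n * del) by (unfold r2; ring).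
  lra.
Qed.
End Direct.

(** The disjunct [x = 0] stands for a logarithm equal to minus infinity, where [ln 0 = 0] would give
    the wrong exponent. The strong converse uses the equivalence with [- eps]. *)
Lemma exponent_bound_iff x a n eps : (1 <= n)%nat -> 0 <= x ->
  (x = 0 \/ - log2 x / INR n + eps >= a) <-> x <= exp (- (INR n * (a * ln 2 - eps * ln 2))).
Proof.
  intros Hn Hx. pose proof ln2_pos as H2. assert (Hn0 : 0 < INR n) by (apply lt_0_INR; lia).
  assert (E : 0 < x -> - ln x - INR n * (a * ln 2 - eps * ln 2)
    = INR n * ln 2 * (- log2 x / INR n + eps - a)) by (intros; unfold log2; field; lra).
  assert (Hp : 0 < INR n * ln 2) by (apply Rmult_lt_0_compat; auto).
  split.
  - intros [->|H]; [left; apply exp_pos|]. destruct Hx as [Hx|<-]; [|left; apply exp_pos].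
    specialize (E Hx).
    assert (0 <= INR n * ln 2 * (- log2 x / INR n + eps - a)) by (apply Rmult_le_pos; lra).
    rewrite <- (exp_ln x) at 1 by auto.
    destruct (Req_dec (ln x) (- (INR n * (a * ln 2 - eps * ln 2)))) as [->|]; [lra|].
    left; apply exp_increasing; lra.
  - intros H. destruct Hx as [Hx|]; [right|left; auto]. specialize (E Hx).
    assert (Hl : ln x <= - (INR n * (a * ln 2 - eps * ln 2))).
    { rewrite <- (ln_exp (- _)). destruct (Req_dec x (exp (- (INR n * (a * ln 2 - eps * ln 2))))) as [->|]; [lra|].
      left; apply ln_increasing; lra. }
    apply Rle_ge, Rmult_le_reg_l with (INR n * ln 2); auto. lra.
Qed.

Theorem theorem1 (d : nat) (M : Family) (rho : Op)
  (HM : P_props d M) (Hrho : density d 1 rho) :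
  (* direct part *)
  (forall eps : R, 0 < eps ->
     exists A : nat -> Op,
       (forall n, povm_elem d n (A n)) /\
       Un_cv (fun n => Cre (tr d n (mulop d n (subop (idop d n) (A n)) (tpow n rho)))) 0 /\
       (forall n omega, (1 <= n)%nat -> M n omega ->
          Cre (tr d n (mulop d n (A n) omega)) = 0 \/
          - log2 (Cre (tr d n (mulop d n (A n) omega))) / INR n + eps
            >= E_inf M d rho))
  /\
  (* strong converse *)
  (forall (eps : R) (A : nat -> Op), 0 < eps ->
     (forall n, povm_elem d n (A n)) ->
     (forall n omega, (1 <= n)%nat -> M n omega ->
          Cre (tr d n (mulop d n (A n) omega)) = 0 \/
          - log2 (Cre (tr d n (mulop d n (A n) omega))) / INR n - eps
            >= E_inf M d rho) ->
     Un_cv (fun n => Cre (tr d n (mulop d n (subop (idop d n) (A n)) (tpow n rho)))) 1).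
Proof.
  pose proof ln2_pos as H2.
  assert (Hpos : forall n T w, povm_elem d n T -> M n w -> 0 <= Cre (tr d n (mulop d n T w))).
  { intros n T w HT Hw. apply tr_psd_mul_ge0; [apply HT|apply (M_density d M HM n w Hw)]. }
  set (err := fun n T => Cre (tr d n (mulop d n (subop (idop d n) T) (tpow n rho)))).
  assert (Herr0 : forall n T, povm_elem d n T -> 0 <= err n T).
  { intros n T HT. apply tr_psd_mul_ge0; [apply HT|apply density_tpow; auto]. }
  split.
  - intros eps He.
    set (V := fun n T => povm_elem d n T /\ forall w, M n w ->
      Cre (tr d n (mulop d n T w)) <= exp (- (INR n * (E_inf M d rho * ln 2 - eps * ln 2)))).
    assert (HV0 : forall n, V n (fun _ _ => C0)).
    { intros n. split; [apply povm_zero|]. intros w _. unfold tr, mulop.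
      rewrite sumC_zero; [left; apply exp_pos|]. intros i _. apply sumC_zero; intros; ring. }
    (* For each [n] an admissible test is chosen whose type-I error is within [/ (INR n + 1)] of the
       best one. The sequence does not depend on [eta]: [direct_core] bounds the best error for
       large [n], for every [eta] in turn, while the type-II bound holds at all [n]. *)
    assert (HA : forall n, exists T, V n T /\ forall T', V n T' -> err n T < err n T' + / (INR n + 1)).
    { intros n. destruct (is_inf_exists (fun x => exists T, V n T /\ x = err n T) 0) as [x Hx].
      - exists (err n (fun _ _ => C0)), (fun _ _ => C0). auto.
      - intros y (T & [HT _] & ->). auto.
      - destruct (is_inf_near _ _ (/ (INR n + 1)) Hx) as (y & (T & HT & ->) & Hlt).
        { apply Rinv_0_lt_compat. pose proof (pos_INR n). lra. }
        exists T. split; auto. intros T' HT'. destruct Hx as [Hx _].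
        specialize (Hx (err n T') (ex_intro _ T' (conj HT' eq_refl))). lra. }
    set (A := fun n => epsilon (inhabits (fun _ _ => C0)) (fun T => V n T /\
      forall T', V n T' -> err n T < err n T' + / (INR n + 1))).
    assert (HAs : forall n, V n (A n) /\ forall T', V n T' -> err n (A n) < err n T' + / (INR n + 1)).
    { intros n. apply epsilon_spec, HA. }
    exists A. split; [intros n; apply HAs|split].
    + intros eta Heta.
      destruct (direct_core d M rho HM Hrho (eps * ln 2) (eta / 2)) as [N1 HN1];
        [apply Rmult_lt_0_compat; auto|lra|].
      destruct (INR_unbounded (2 / eta)) as [N2 HN2].
      exists (N1 + N2)%nat. intros n Hn. destruct (HN1 n ltac:(lia)) as (T & HT1 & HT2 & HT3).
      destruct (HAs n) as [[HA1 _] HA2]. specialize (HA2 T (conj HT1 HT3)). specialize (Herr0 n (A n) HA1).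
      assert (Hinv : / (INR n + 1) < eta / 2).
      { assert (INR N2 <= INR n) by (apply le_INR; lia).
        replace (eta / 2) with (/ (2 / eta)) by (field; lra).
        assert (0 < 2 / eta) by (apply Rdiv_lt_0_compat; lra).
        apply Rinv_lt_contravar; [apply Rmult_lt_0_compat; lra|lra]. }
      unfold R_dist. fold (err n (A n)). apply Rabs_def1; unfold err in *; lra.
    + intros n w Hn Hw. apply exponent_bound_iff; auto; [apply Hpos; auto; apply HAs|].
      apply HAs; auto.
  - intros eps A He HA Hbound eta Heta.
    destruct (strong_converse_core d M rho HM Hrho (eps * ln 2)) as (om & Hom & Hsc);
      [apply Rmult_lt_0_compat; auto|].
    destruct (Hsc 1 (eta / 2)) as [N HN]; [lra|lra|].
    exists (N + 1)%nat. intros n Hn. specialize (HN n (A n) ltac:(lia) (HA n)).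
    assert (H : Cre (tr d n (mulop d n (A n) (om n))) <=
      1 * exp (- (INR n * (E_inf M d rho * ln 2 + eps * ln 2)))).
    { rewrite Rmult_1_l.
      replace (E_inf M d rho * ln 2 + eps * ln 2) with (E_inf M d rho * ln 2 - (- eps) * ln 2) by ring.
      apply exponent_bound_iff; [lia|auto|]. exact (Hbound n (om n) ltac:(lia) (Hom n)). }
    specialize (HN H).
    assert (H1 : err n (A n) <= 1).
    { unfold err. rewrite tr_complement_mul by (apply density_tpow; auto).
      pose proof (tr_psd_mul_ge0 d n (A n) (tpow n rho) (proj1 (HA n)) (proj1 (density_tpow d n rho Hrho))). lra. }
    unfold R_dist. apply Rabs_def1; unfold err in *; lra.
Qed.
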